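(* Let $m\ge0$. For nonnegative integers $m_j,m_j'$ put $s_1=m$ and $s_{j+1}=s_j-m_j-m_j'$. If $N=2n$, then the polynomials $$\Xi_{\mathbf m,\mathbf m',k}=t^{(1)}_{m_1,m_1';s_1}\,t^{(2)}_{m_2,m_2';s_2}\cdots t^{(n-1)}_{m_{n-1},m_{n-1}';s_{n-1}}\;t^{2,k},$$ with $m_1,m_1',\dots,m_{n-1},m_{n-1}'\in\mathbb Z_{\ge0}$, $k\in\mathbb Z$, satisfying $m_1+m_1'+\dots+m_{n-1}+m_{n-1}'+|k|=m$, constitute an orthogonal basis of the space $\mathcal H_m$. If $N=2n+1$, then the polynomials $$\Xi_{\mathbf m,\mathbf m',\sigma}=t^{(1)}_{m_1,m_1';s_1}\,t^{(2)}_{m_2,m_2';s_2}\cdots t^{(n)}_{m_n,m_n';s_n}\;x_{n+1}^{\sigma},$$ with $m_1,m_1',\dots,m_n,m_n'\in\mathbb Z_{\ge0}$, $\sigma\in\{0,1\}$, satisfying $m_1+m_1'+\dots+m_n+m_n'+\sigma=m$, constitute an orthogonal basis of the space $\mathcal H_m$. Orthogonality is with respect to the scalar product $\langle\cdot,\cdot\rangle$.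
   Context: Fix an integer $N\ge3$, $N=2n$ or $N=2n+1$; put $j'=N-j+1$. Let $q>0$ be real, $q\ne1$; $[a]=\frac{1-q^a}{1-q}$, $[a]_q=\frac{q^a-q^{-a}}{q-q^{-1}}$, $(a;p)_s=(1-a)(1-ap)\cdots(1-ap^{s-1})$. Put $(\rho_1,\dots,\rho_N)=(n-\frac12,n-\frac32,\dots,\frac12,0,-\frac12,\dots,-n+\frac12)$ if $N=2n+1$ and $(\rho_1,\dots,\rho_N)=(n-1,\dots,1,0,0,-1,\dots,-n+1)$ if $N=2n$. $\mathcal A$ is the associative unital $\mathbb C$-algebra generated by $x_1,\dots,x_N$ with relations: $x_ix_j=qx_jx_i$ for $i<j$, $i\neq j'$; $x_{i'}x_i-x_ix_{i'}=\frac{q-q^{-1}}{q^{\rho_i-1}+q^{-\rho_i+1}}\sum_{j=i+1}^{(i+1)'}q^{\rho_{j'}}x_jx_{j'}$ for $i<n$; $x_{n'}x_n-x_nx_{n'}=(q^{1/2}-q^{-1/2})x_{n+1}^2$ if $N=2n+1$; $x_{n'}x_n=x_nx_{n'}$ if $N=2n$. The monomials $\mathbf x^\nu=x_1^{\nu_1}\cdots x_N^{\nu_N}$ form a basis of $\mathcal A$; $\mathcal A_m$ is the span of those with $|\nu|=\nu_1+\dots+\nu_N=m$. Put $Q_j=\sum_{i=j}^{j'}q^{\rho_{i'}}x_ix_{i'}$ for $1\le j\le n$, $Q=Q_1$. The $q$-Laplace operator $\Delta_q$ on $\mathcal A$ acts by $$\Delta_q\mathbf x^\nu=(1+q^{N-2})q^{|\nu|-1}\Big(\sum_{j=1}^n[\nu_j]_q[\nu_{j'}]_q\,q^{-\rho_j+d_j}\,\mathbf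 x^{\nu-\varepsilon_j-\varepsilon_{j'}}+[\nu_{n+1}-1][\nu_{n+1}]\frac{q^{|\nu|-2\nu_{n+1}+2}}{1+q}\,\mathbf x^{\nu-2\varepsilon_{n+1}}\Big),$$ with $d_j=\nu_1+\dots+\nu_{j-1}+\nu_{(j-1)'}+\dots+\nu_{1'}$, $\varepsilon_i$ the $i$th unit vector, last summand omitted if $N=2n$. $\mathcal H_m=\{p\in\mathcal A_m:\Delta_qp=0\}$, $\mathcal H=\{p\in\mathcal A:\Delta_qp=0\}$. The polynomials $t$: for $1\le j\le n$ and integers $a,b\ge0$, $s\ge a+b$, put $M=N-2j+2$, $l=s-a-b$ and $$t^{(j)}_{a,b;s}=\sum_{k=0}^{\min(a,b)}\frac{(q^{-2a};q^2)_k\,(q^{-2b};q^2)_k}{(q^2;q^2)_k\,(q^{-M-2s+4};q^2)_k}\,\frac{q^{(-(n-j+1)+\epsilon-2l+2)k}}{(1+q^{M-2})^k}\,Q_j^k\,x_j^{a-k}x_{j'}^{b-k},$$ with $\epsilon=1$ if $N=2n$ and $\epsilon=\frac12$ if $N=2n+1$ (this is $t^{M,s}_{a\,b}$ for the algebra generated by $x_j,\dots,x_{j'}$). For $N=2n$: $t^{2,k}=x_n^k$ if $k>0$, $t^{2,0}=1$, $t^{2,k}=x_{n'}^{-k}$ if $k<0$. Scalar product: $\mathcal A$ is a $*$-algebra with the conjugate-linear involutive anti-automorphism $x_i^*=q^{\rho_{i'}}x_{i'}$. Let $\tau:\mathcal A\to\mathcal F(S_q^{N-1})=\mathcal A/(Q-1)$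 be the canonical map ($(Q-1)$ the two-sided ideal generated by $Q-1$; it is $*$-stable). The invariant functional $h$ on $\mathcal F(S^{N-1}_q)$ is the linear functional with $h(\tau\mathbf x^\nu)=0$ unless $\nu_j=\nu_{j'}$ for $1\le j\le n$ and (if $N=2n+1$) $\nu_{n+1}=2r$ is even, in which case $$h(\tau\mathbf x^\nu)=\frac{(q^{-2};q^{-2})_{\nu_1}\cdots(q^{-2};q^{-2})_{\nu_n}\,(q^{-1};q^{-2})_r\,(1+q)^r}{q^{\rho_1\nu_1+\dots+\rho_n\nu_n+r}\,(1+q^{N-2})^{\nu_1+\dots+\nu_n+r}\,(q^{-N};q^{-2})_{\nu_1+\dots+\nu_n+r}}$$ ($r=0$ if $N=2n$). On $\mathcal H$: $\langle p_1,p_2\rangle=h((\tau p_1)^*(\tau p_2))$.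
   Formalization: In the formula for h with N odd, the factor (q^{-1};q^{-1})_r is corrected to (q^{-1};q^{-2})_r; as printed, h is not well defined on A/(Q-1), since for N=3 it gives h((Q-1)x_2^2)≠0. Even N is unaffected. *)

(* Defs.v *)
From HB Require Import structures.
From mathcomp Require Import all_boot all_order all_algebra.
From mathcomp Require Import generic_quotient.
From mathcomp Require Import boolp reals exp.
From mathcomp Require Import complex.
From mathcomp Require Import monalg.

Set Implicit Arguments.
Unset Strict Implicit.
Unset Printing Implicit Defensive.

Import Order.TTheory GRing.Theory Num.Theory.
Local Open Scope ring_scope.

Section LinearFamilies.
Variables (K : nzRingType) (V : lmodType K) (T : Type).
Implicit Types (P : T -> Prop) (v : T -> V) (W : V -> Prop).

Definition lin_span P v : V -> Prop := fun p =>
  exists (k : nat) (t : 'I_k -> T) (c : 'I_k -> K),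
    (forall i, P (t i)) /\ p = \sum_(i < k) c i *: v (t i).

Definition lin_free P v : Prop :=
  forall (k : nat) (t : 'I_k -> T) (c : 'I_k -> K),
    injective t -> (forall i, P (t i)) ->
    \sum_(i < k) c i *: v (t i) = 0 -> forall i, c i = 0.

Definition is_basis W P v : Prop :=
  [/\ forall t, P t -> W (v t),
      lin_free P v
    & forall p, W p -> lin_span P v p].

Definition is_orthogonal_basis (sp : V -> V -> K) W P v : Prop :=
  is_basis W P v /\
  (forall t u, P t -> P u -> t <> u -> sp (v t) (v u) = 0).

End LinearFamilies.

Section TwoSidedQuotient.
Variables (K : comNzRingType) (L : algType K) (S : L -> Prop).

Inductive ideal_gen : L -> Prop :=
| ideal_gen_mem s : S s -> ideal_gen s
| ideal_gen0 : ideal_gen 0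
| ideal_genD a b : ideal_gen a -> ideal_gen b -> ideal_gen (a + b)
| ideal_genMl c a : ideal_gen a -> ideal_gen (c * a)
| ideal_genMr a c : ideal_gen a -> ideal_gen (a * c).

Lemma ideal_genZ c a : ideal_gen a -> ideal_gen (c *: a).
Proof. by move=> ha; rewrite -[a]mul1r scalerAl; apply: ideal_genMl. Qed.

Lemma ideal_genN a : ideal_gen a -> ideal_gen (- a).
Proof. by move=> ha; rewrite -scaleN1r; apply: ideal_genZ. Qed.

Lemma ideal_genB a b : ideal_gen a -> ideal_gen b -> ideal_gen (a - b).
Proof. by move=> ha hb; apply: ideal_genD => //; apply: ideal_genN. Qed.

Definition ideal_eqv : rel L := fun a b => `[< ideal_gen (a - b) >].

Lemma ideal_eqv_equiv : equiv_class_of ideal_eqv.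
Proof.
split=> [a|a b|b a c].
- by apply/asboolP; rewrite subrr; apply: ideal_gen0.
- by apply/asboolP/asboolP => /ideal_genN; rewrite opprB.
- move=> /asboolP hab /asboolP hbc; apply/asboolP.
  by rewrite -[a](subrK b) -addrA; apply: ideal_genD.
Qed.

Canonical ideal_eqv_rel := EquivRelPack ideal_eqv_equiv.

Definition quot_alg := {eq_quot ideal_eqv_rel}%qT.

HB.instance Definition _ : EqQuotient L ideal_eqv_rel quot_alg :=
  EqQuotient.on quot_alg.
HB.instance Definition _ := Choice.on quot_alg.

Local Notation Qt := quot_alg.

Definition quot_pi (a : L) : Qt := (\pi_Qt a)%qT.

Lemma quot_piP a b : quot_pi a = quot_pi b <-> ideal_gen (a - b).
Proof.
split; first by move=> /(@eqquotP _ _ Qt)/asboolP.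
by move=> h; apply/(@eqquotP _ _ Qt)/asboolP.
Qed.

Lemma quot_reprK (u : Qt) : quot_pi (repr u) = u.
Proof. exact: reprK. Qed.

Lemma quot_repr_pi a : ideal_gen (repr (quot_pi a) - a).
Proof. by apply/quot_piP; rewrite quot_reprK. Qed.

(* The operations are locked so that unification does not unfold them. *)
Let zero : Qt := quot_pi 0.
Let one : Qt := quot_pi 1.
Let opp : Qt -> Qt := locked (fun u => quot_pi (- repr u)).
Let add : Qt -> Qt -> Qt := locked (fun u v => quot_pi (repr u + repr v)).
Let mul : Qt -> Qt -> Qt := locked (fun u v => quot_pi (repr u * repr v)).
Let scale : K -> Qt -> Qt := locked (fun c u => quot_pi (c *: repr u)).

Let piN a : opp (quot_pi a) = quot_pi (- a).
Proof.
rewrite /opp -lock.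
by apply/quot_piP; rewrite -opprD; apply: ideal_genN; apply: quot_repr_pi.
Qed.

Let piD a b : add (quot_pi a) (quot_pi b) = quot_pi (a + b).
Proof.
rewrite /add -lock.
by apply/quot_piP; rewrite opprD addrACA; apply: ideal_genD; apply: quot_repr_pi.
Qed.

Let piM a b : mul (quot_pi a) (quot_pi b) = quot_pi (a * b).
Proof.
rewrite /mul -lock.
apply/quot_piP; set a' := repr _; set b' := repr _.
have -> : a' * b' - a * b = (a' - a) * b' + a * (b' - b).
  by rewrite mulrBl mulrBr addrA subrK.
by apply: ideal_genD; [apply: ideal_genMr|apply: ideal_genMl];
  apply: quot_repr_pi.
Qed.

Let piZ c a : scale c (quot_pi a) = quot_pi (c *: a).
Proof.
rewrite /scale -lock.
by apply/quot_piP; rewrite -scalerBr; apply: ideal_genZ; apply: quot_repr_pi.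
Qed.

Let addA : associative add.
Proof.
move=> u v w; rewrite -[u]quot_reprK -[v]quot_reprK -[w]quot_reprK.
by rewrite !piD addrA.
Qed.
Let addC : commutative add.
Proof.
by move=> u v; rewrite -[u]quot_reprK -[v]quot_reprK !piD addrC.
Qed.
Let add0 : left_id zero add.
Proof. by move=> u; rewrite -[u]quot_reprK piD add0r. Qed.
Let addN : left_inverse zero opp add.
Proof. by move=> u; rewrite -[u]quot_reprK piN piD addNr. Qed.

HB.instance Definition _ := GRing.isZmodule.Build Qt addA addC add0 addN.

Let mulA : associative mul.
Proof.
move=> u v w; rewrite -[u]quot_reprK -[v]quot_reprK -[w]quot_reprK.
by rewrite !piM mulrA.
Qed.
Let mul1 : left_id one mul.
Proof. by move=> u; rewrite -[u]quot_reprK piM mul1r. Qed.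
Let mulr1 : right_id one mul.
Proof. by move=> u; rewrite -[u]quot_reprK piM mulr1. Qed.
Let mulDl : left_distributive mul +%R.
Proof.
move=> u v w; rewrite -[u]quot_reprK -[v]quot_reprK -[w]quot_reprK.
by rewrite [_ + _ in LHS]piD !piM [RHS]piD mulrDl.
Qed.
Let mulDr : right_distributive mul +%R.
Proof.
move=> u v w; rewrite -[u]quot_reprK -[v]quot_reprK -[w]quot_reprK.
by rewrite [_ + _ in LHS]piD !piM [RHS]piD mulrDr.
Qed.

HB.instance Definition _ :=
  GRing.Zmodule_isPzRing.Build Qt mulA mul1 mulr1 mulDl mulDr.

Let scaleA a b u : scale a (scale b u) = scale (a * b) u.
Proof. by rewrite -[u]quot_reprK !piZ scalerA. Qed.
Let scale1 : left_id 1 scale.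
Proof. by move=> u; rewrite -[u]quot_reprK piZ scale1r. Qed.
Let scaleDr : right_distributive scale +%R.
Proof.
move=> c u v; rewrite -[u]quot_reprK -[v]quot_reprK.
by rewrite [_ + _ in LHS]piD !piZ [RHS]piD scalerDr.
Qed.
Let scaleDl u : {morph scale^~ u : a b / a + b}.
Proof.
by move=> a b; rewrite -[u]quot_reprK !piZ [RHS]piD scalerDl.
Qed.

HB.instance Definition _ :=
  GRing.Zmodule_isLmodule.Build K Qt scaleA scale1 scaleDr scaleDl.

Lemma quot_piD a b : quot_pi (a + b) = quot_pi a + quot_pi b.
Proof. by rewrite [RHS]piD. Qed.
Lemma quot_piM a b : quot_pi (a * b) = quot_pi a * quot_pi b.
Proof. by rewrite [RHS]piM. Qed.
Lemma quot_pi1 : quot_pi 1 = 1. Proof. by []. Qed.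
Lemma quot_piZ c a : quot_pi (c *: a) = c *: quot_pi a.
Proof. by rewrite [RHS]piZ. Qed.

Let quot_piB : zmod_morphism quot_pi.
Proof. by move=> a b; rewrite -scaleN1r quot_piD quot_piZ scaleN1r. Qed.

HB.instance Definition _ := GRing.isZmodMorphism.Build L Qt quot_pi quot_piB.
HB.instance Definition _ :=
  GRing.isMonoidMorphism.Build L Qt quot_pi (conj quot_pi1 quot_piM).
HB.instance Definition _ :=
  GRing.isScalable.Build K L Qt *:%R quot_pi quot_piZ.

Lemma quot_scalerAl (c : K) (u v : Qt) : c *: (u * v) = (c *: u) * v.
Proof.
by rewrite -[u]quot_reprK -[v]quot_reprK -quot_piM -!quot_piZ -quot_piM scalerAl.
Qed.

Lemma quot_scalerAr (c : K) (u v : Qt) : c *: (u * v) = u * (c *: v).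
Proof.
by rewrite -[u]quot_reprK -[v]quot_reprK -quot_piM -!quot_piZ -quot_piM scalerAr.
Qed.

Lemma ideal_gen_ker (T : pzRingType) (f : {rmorphism L -> T}) :
  (forall s, S s -> f s = 0) -> forall a, ideal_gen a -> f a = 0.
Proof.
move=> hf a; elim=> {a} [s /hf//||a b _ ha _ hb|c a _ ha|a c _ ha].
- exact: rmorph0.
- by rewrite rmorphD ha hb addr0.
- by rewrite rmorphM ha mulr0.
- by rewrite rmorphM ha mul0r.
Qed.

Lemma quot_oner_neq0 (T : nzRingType) (f : {rmorphism L -> T}) :
  (forall s, S s -> f s = 0) -> (1 : Qt) != 0.
Proof.
move=> hf; apply/eqP => /quot_piP; rewrite subr0.
by move/(ideal_gen_ker hf)/eqP; rewrite rmorph1 oner_eq0.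
Qed.

End TwoSidedQuotient.

Section FreeAlgebra.

Let malg_scalerAr (M : monomType) (K : comNzRingType) (c : K) (a b : {malg K[M]}) :
  c *: (a * b) = a * (c *: b).
Proof.
apply/malgP => k; rewrite mcoeffZ mcoeffMl.
rewrite (mcoeffMlw k (finmap.fsubset_refl _) (msuppZ_le c b)) mulr_sumr.
apply: eq_bigr => k1 _; rewrite mulr_sumr; apply: eq_bigr => k2 _.
by rewrite mcoeffZ mulrnAr mulrCA.
Qed.

Variables (K : comNzRingType) (I : choiceType).

Definition free_alg := {malg K[{fmonom I}]}.
HB.instance Definition _ := GRing.Lalgebra.on free_alg.
HB.instance Definition _ :=
  GRing.Lalgebra_isAlgebra.Build K free_alg (@malg_scalerAr _ K).

Definition free_gen (i : I) : free_alg := mkmalgU (fmu i) 1.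

Definition free_aug : free_alg -> K := mcoeff mone.
HB.instance Definition _ := GRing.RMorphism.on free_aug.

Lemma free_aug_gen i : free_aug (free_gen i) = 0.
Proof.
rewrite /free_aug mcoeffU; case: eqP => // /(congr1 (@fmonom_val I)).
by rewrite fm1 fmU.
Qed.

Lemma free_aug0 : free_aug 0 = 0. Proof. exact: rmorph0. Qed.
Lemma free_augM a b : free_aug (a * b) = free_aug a * free_aug b.
Proof. exact: rmorphM. Qed.
Lemma free_aug_kerB a b :
  free_aug a = 0 -> free_aug b = 0 -> free_aug (a - b) = 0.
Proof. by move=> ha hb; rewrite rmorphB /= ha hb subr0. Qed.
Lemma free_aug_kerZ c a : free_aug a = 0 -> free_aug (c *: a) = 0.
Proof. by move=> ha; rewrite /free_aug mcoeffZ [mcoeff _ _]ha mulr0. Qed.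
Lemma free_aug_ker_sum (r : seq nat) (F : nat -> free_alg) :
  (forall i, free_aug (F i) = 0) -> free_aug (\sum_(i <- r) F i) = 0.
Proof. by move=> hF; rewrite rmorph_sum big1. Qed.

End FreeAlgebra.

Local Open Scope complex_scope.

Section QuantumVectorSpace.
Variables (R : realType) (q : R) (N : nat).
Local Notation C := R[i].
Local Notation n := (N./2).

(* Indices are natural numbers running from 1 to N. *)

(* The involution j' = N - j + 1. *)
Definition opi (j : nat) : nat := (N - j + 1)%N.

(* rho_i = -rho_(opi i); the middle value for odd N, and the two middle values
   for even N, are 0. *)
Definition rho (i : nat) : R :=
  if (i <= n)%N then N%:R / 2 - i%:R
  else if (opi n <= i)%N then N%:R / 2 + 1 - i%:R
  else 0.

Definition qnum (a : R) : R := (1 - q `^ a) / (1 - q).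
Definition qnum_sym (a : R) : R := (q `^ a - q `^ (- a)) / (q - q^-1).
Definition qpoch (a p : R) (s : nat) : R := \prod_(i < s) (1 - a * p ^+ i).

(* The value outside 1..N is junk. *)
Definition fx (j : nat) : free_alg C 'I_N :=
  if j is i.+1 then oapp (@free_gen C 'I_N) 0 (insub i) else 0.

Inductive relator : free_alg C 'I_N -> Prop :=
| rel_qcomm i j of (0 < i)%N & (i < j)%N & (j <= N)%N & i <> opi j :
    relator (fx i * fx j - q%:C *: (fx j * fx i))
| rel_cross i of (0 < i)%N & (i < n)%N :
    relator (fx (opi i) * fx i - fx i * fx (opi i)
      - ((q - q^-1) / (q `^ (rho i - 1) + q `^ (- rho i + 1)))%:C *:
        \sum_(i.+1 <= j < (opi i.+1).+1)
          (q `^ rho (opi j))%:C *: (fx j * fx (opi j)))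
| rel_mid_odd of odd N :
    relator (fx (opi n) * fx n - fx n * fx (opi n)
      - (q `^ (2^-1) - q `^ (- 2^-1))%:C *: (fx n.+1 ^+ 2))
| rel_mid_even of ~~ odd N :
    relator (fx (opi n) * fx n - fx n * fx (opi n)).

Definition vec_alg : Type := quot_alg relator.
HB.instance Definition _ := GRing.Lmodule.on vec_alg.
HB.instance Definition _ := GRing.PzRing.on vec_alg.

Let fx_aug j : free_aug (fx j) = 0.
Proof.
case: j => [|i] /=; first exact: free_aug0.
by case: insubP => [u _ _|_] /=; [exact: free_aug_gen|exact: free_aug0].
Qed.

Let fxx_aug i j : free_aug (fx i * fx j) = 0.
Proof. by rewrite free_augM fx_aug mul0r. Qed.

Let relator_aug a : relator a -> free_aug a = 0.
Proof.
case=> [i j _ _ _ _|i _ _|_|_].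
- by apply: free_aug_kerB; [|apply: free_aug_kerZ]; apply: fxx_aug.
- apply: free_aug_kerB; first by apply: free_aug_kerB; apply: fxx_aug.
  apply: free_aug_kerZ; apply: free_aug_ker_sum => j.
  by apply: free_aug_kerZ; apply: fxx_aug.
- apply: free_aug_kerB; first by apply: free_aug_kerB; apply: fxx_aug.
  by apply: free_aug_kerZ; apply: fxx_aug.
- by apply: free_aug_kerB; apply: fxx_aug.
Qed.

HB.instance Definition _ := GRing.PzSemiRing_isNonZero.Build vec_alg
  (quot_oner_neq0 relator_aug).
HB.instance Definition _ := GRing.Lmodule_isLalgebra.Build C vec_alg
  (@quot_scalerAl _ _ relator).
HB.instance Definition _ := GRing.Lalgebra_isAlgebra.Build C vec_alg
  (@quot_scalerAr _ _ relator).

Definition xgen (j : nat) : vec_alg := quot_pi relator (fx j).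

(* Exponents are functions on nat of which only the values at 1..N matter. *)
Definition mdegree (nu : nat -> nat) : nat := (\sum_(1 <= i < N.+1) nu i)%N.
Definition mono (nu : nat -> nat) : vec_alg :=
  \prod_(1 <= i < N.+1) xgen i ^+ nu i.

Definition homog (m : nat) : vec_alg -> Prop :=
  lin_span (fun nu => mdegree nu = m) mono.

Definition Qform (j : nat) : vec_alg :=
  \sum_(j <= i < (opi j).+1) (q `^ rho (opi i))%:C *: (xgen i * xgen (opi i)).

(* nu - eps_i - eps_j, truncated at 0; wherever truncation occurs below, the
   monomial has coefficient 0. *)
Definition lower2 (nu : nat -> nat) (i j : nat) : nat -> nat :=
  fun k => (nu k - (k == i) - (k == j))%N.

Definition dsum (nu : nat -> nat) (j : nat) : nat :=
  (\sum_(1 <= i < j) (nu i + nu (opi i)))%N.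

Definition laplace_mono (nu : nat -> nat) : vec_alg :=
  ((1 + q `^ (N%:R - 2)) * q `^ ((mdegree nu)%:R - 1))%:C *:
  (\sum_(1 <= j < n.+1)
     (qnum_sym (nu j)%:R * qnum_sym (nu (opi j))%:R
        * q `^ (- rho j + (dsum nu j)%:R))%:C *: mono (lower2 nu j (opi j))
   + if odd N then
       (qnum ((nu n.+1)%:R - 1) * qnum (nu n.+1)%:R
          * (q `^ ((mdegree nu)%:R - 2 * (nu n.+1)%:R + 2) / (1 + q)))%:C *:
       mono (lower2 nu n.+1 n.+1)
     else 0).

Definition is_qlaplace (Delta : {linear vec_alg -> vec_alg}) : Prop :=
  forall nu, Delta (mono nu) = laplace_mono nu.

Definition harmonic (Delta : {linear vec_alg -> vec_alg}) (m : nat) :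
    vec_alg -> Prop :=
  fun p => homog m p /\ Delta p = 0.

Definition eps : R := if odd N then 2^-1 else 1.

(* [tpoly j a b s] is the polynomial t_(a,b)^(M,s), M = N - 2j + 2, for the
   subalgebra generated by x_j, ..., x_(j'). *)
Definition tpoly (j a b s : nat) : vec_alg :=
  let M : R := N%:R - 2 * j%:R + 2 in
  let l : R := s%:R - a%:R - b%:R in
  \sum_(k < (minn a b).+1)
    (qpoch (q `^ (- 2 * a%:R)) (q ^+ 2) k * qpoch (q `^ (- 2 * b%:R)) (q ^+ 2) k
     / (qpoch (q ^+ 2) (q ^+ 2) k * qpoch (q `^ (- M - 2 * s%:R + 4)) (q ^+ 2) k)
     * (q `^ ((- (n%:R - j%:R + 1) + eps - 2 * l + 2) * k%:R)
        / (1 + q `^ (M - 2)) ^+ k))%:C *: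
    (Qform j ^+ k * xgen j ^+ (a - k) * xgen (opi j) ^+ (b - k)).

Definition t2poly (k : int) : vec_alg :=
  match k with
  | Posz k' => xgen n ^+ k'
  | Negz k' => xgen (opi n) ^+ k'.+1
  end.

(* For lists a = (m_1, m_2, ...) and b = (m'_1, m'_2, ...), [rest m a b j] is
   s_(j+1), where s_1 = m and s_(j+1) = s_j - m_j - m'_j; on the index sets
   below the subtraction is never truncated. *)
Fixpoint rest (m : nat) (a b : seq nat) (j : nat) : nat :=
  if j is j'.+1 then (rest m a b j' - nth 0 a j' - nth 0 b j')%N else m.

Definition tprod (m J : nat) (a b : seq nat) : vec_alg :=
  \prod_(j < J) tpoly j.+1 (nth 0%N a j) (nth 0%N b j) (rest m a b j).

Definition idx_even : Type := ((n.-1).-tuple nat * (n.-1).-tuple nat * int)%type.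
Definition idx_even_ok (m : nat) (t : idx_even) : Prop :=
  let: (a, b, k) := t in (sumn a + sumn b + `|k|)%N = m.
Definition Xi_even (m : nat) (t : idx_even) : vec_alg :=
  let: (a, b, k) := t in tprod m n.-1 a b * t2poly k.

(* sigma in {0, 1} is a boolean. *)
Definition idx_odd : Type := (n.-tuple nat * n.-tuple nat * bool)%type.
Definition idx_odd_ok (m : nat) (t : idx_odd) : Prop :=
  let: (a, b, sigma) := t in (sumn a + sumn b + sigma)%N = m.
Definition Xi_odd (m : nat) (t : idx_odd) : vec_alg :=
  let: (a, b, sigma) := t in tprod m n a b * xgen n.+1 ^+ sigma.

Definition is_star (st : vec_alg -> vec_alg) : Prop :=
  [/\ forall (c : C) (a b : vec_alg), st (c *: a + b) = c^* *: st a + st b,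
      forall a b, st (a * b) = st b * st a,
      involutive st
    & forall i, (1 <= i <= N)%N -> st (xgen i) = (q `^ rho (opi i))%:C *: xgen (opi i)].

Definition sphere : Type := quot_alg (fun a : vec_alg => a = Qform 1 - 1).
HB.instance Definition _ := GRing.Lmodule.on sphere.
HB.instance Definition _ := GRing.PzRing.on sphere.

Definition tau : vec_alg -> sphere := quot_pi (fun a => a = Qform 1 - 1).
HB.instance Definition _ := GRing.RMorphism.on tau.
HB.instance Definition _ := GRing.Linear.on tau.

Definition is_induced_star (st : vec_alg -> vec_alg) (stF : sphere -> sphere) : Prop :=
  forall a, stF (tau a) = tau (st a).

Definition invariant_support (nu : nat -> nat) : bool :=
  all (fun j => nu j == nu (opi j)) (iota 1 n) && (odd N ==> ~~ odd (nu n.+1)).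

Definition invariant_value (nu : nat -> nat) : R :=
  let r := if odd N then (nu n.+1)./2 else 0%N in
  let S := (\sum_(1 <= j < n.+1) nu j + r)%N in
  \prod_(1 <= j < n.+1) qpoch (q ^- 2) (q ^- 2) (nu j)
    * qpoch (q^-1) (q ^- 2) r * (1 + q) ^+ r
  / (q `^ (\sum_(1 <= j < n.+1) rho j * (nu j)%:R + r%:R)
     * (1 + q `^ (N%:R - 2)) ^+ S * qpoch (q `^ (- N%:R)) (q ^- 2) S).

Definition is_invariant_functional (h : {scalar sphere}) : Prop :=
  forall nu, h (tau (mono nu)) =
    if invariant_support nu then (invariant_value nu)%:C else 0.

Definition sprod (stF : sphere -> sphere) (h : {scalar sphere})
    (p1 p2 : vec_alg) : C :=
  h (stF (tau p1) * tau p2).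

End QuantumVectorSpace.

(* Main.v *)
Require Import Defs.
From HB Require Import structures.
From mathcomp Require Import all_boot all_order all_algebra.
From mathcomp Require Import ring lra zify.
From mathcomp Require Import boolp reals exp.
From mathcomp Require Import complex.

(* Adjoin the pairs [x_j, x_j'] one at a time, from the innermost one outwards,
   and put [y_j = Q_j / (q^rho_j + q^-rho_j)].  The relations become
     [x_j x_j' = y_j - q y_(j+1)],   [x_j' x_j = y_j - q^-1 y_(j+1)],
   where [y_j] is central in the algebra of the pairs j, ..., n, and the outer
   generators q-commute with the inner algebra.  Both [Delta_q] and the
   functional [phi p = h (tau p)] satisfy one-step recursions on the words
   [x_j^a g x_j'^b] with [g] in the inner algebra.

   Harmonicity: [Delta (y_j p) - q^2 y_j (Delta p)] is a multiple of [p], which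
   turns [Delta (t f) = 0] into the two-term recursion of the coefficients of
   [t].  Orthogonality: [phi (y_j g)] and [phi (y_(j+1) g)] are multiples of
   [phi g], so pairing [t_(a,b) f] with [y_(j+1)^k w f], where
   [w = x_j^(a-c) x_j'^(b-c)] and [c = min(a,b)], is a terminating 2phi1; the
   q-Chu-Vandermonde formula shows that it is 0 for [k < c] but not for [k = c].
   Spanning: the products [y_1^k Xi] span the algebra, and
   [Delta (y_1^k f) = c_k y_1^(k-1) f] with [c_k <> 0] for harmonic [f] kills all
   terms with [k > 0] in a harmonic element.  Freeness follows from orthogonality
   and the nonvanishing of the norms, so that the linear independence of the
   ordered monomials is never needed. *)

Set Implicit Arguments.
Unset Strict Implicit.
Unset Printing Implicit Defensive.

Import Order.TTheory GRing.Theory Num.Theory.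
Local Open Scope ring_scope.
Local Open Scope complex_scope.

(** Pairing two products [t f] directly would give a double sum. Instead the left factor is expanded
    in the elements $y_j^{c-t}y_{j+1}^t w$ with $0\le t\le c$: by $x_jx_j'=y_j-qy_{j+1}$ the
    coefficient of $y_{j+1}^c w$ is nonzero, and since $y_j$ is central and self-adjoint at its
    level, its powers leave [phi] as scalars. What remains are the test pairings with $y_{j+1}^t w
    f$, and this triangular shape serves orthogonality and norms at once.

    The star places powers of $x_j'$ to the left of the inner element, where the recursion of [phi]
    says nothing; the modular identity [phi_cyclic] carries them to the right end.

    For even $N$ the induction starts one pair further out: at the innermost level $y$ is 0 and the
    factor $1-q^{-(2i+o+d)}$ vanishes for $i=o=d=0$, so norms cannot be propagated through it. The
    commuting pair $x_n,x_{n'}$ then provides the bottom family. *)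

Section LinearClosure.
Variables (F : nzRingType) (V : lmodType F).

(** Inductive, so that membership proofs can follow how an element was built instead of handling the
    explicit sums of [lin_span]; [lspan_lin_span] converts at the end. *)
Inductive lspan (S : V -> Prop) : V -> Prop :=
| lspan_mem p of S p : lspan S p
| lspan0 : lspan S 0
| lspanD p r of lspan S p & lspan S r : lspan S (p + r)
| lspanZ c p of lspan S p : lspan S (c *: p).

Lemma lspan_sum S (I : Type) (r : seq I) (P : pred I) (f : I -> V) :
  (forall i, P i -> lspan S (f i)) -> lspan S (\sum_(i <- r | P i) f i).
Proof.
move=> Sf; elim/big_ind: _ => // [|p p' Sp Sp']; first exact: lspan0.
exact: lspanD.
Qed.

Lemma lspan_subset S S' (p : V) :
  (forall p, S p -> lspan S' p) -> lspan S p -> lspan S' p.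
Proof.
move=> SS'; elim=> {p} [p /SS'//||p r _ Sp _ Sr|c p _ Sp].
- exact: lspan0.
- exact: lspanD.
- exact: lspanZ.
Qed.

End LinearClosure.

(** * The q-Chu-Vandermonde sum *)

Section QVandermonde.
Variables (F : fieldType) (u : F).

(* [(-1)^k u^(k(k-1)/2)] times the Gaussian binomial coefficient. *)
Fixpoint sbin c k : F :=
  if c is c'.+1 then
    if k is k'.+1 then sbin c' k - u ^+ c' * sbin c' k' else 1
  else (k == 0)%:R.

Lemma sbin0 c : sbin c 0 = 1. Proof. by case: c. Qed.

Lemma sbin_gt c k : (c < k)%N -> sbin c k = 0.
Proof.
elim: c k => [|c IHc] [|k] //= ck.
by rewrite !IHc ?mulr0 ?subr0//; lia.
Qed.

Lemma sbin_ratio c k : sbin c k.+1 * (1 - u ^+ k.+1) = sbin c k * (u ^+ c - u ^+ k).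
Proof.
elim: c k => [|c IHc] k.
  by case: k => [|k] /=; rewrite !(mul0r, mul1r, subrr).
rewrite [sbin c.+1 k.+1]/= mulrBl IHc; case: k => [|k].
  by rewrite !sbin0 !expr0 !exprS; ring.
have := IHc k => /= IHk; rewrite [in RHS]mulrBl.
have -> : u ^+ c * sbin c k * (u ^+ c.+1 - u ^+ k.+1) =
    u ^+ c * u * (sbin c k * (u ^+ c - u ^+ k)) by rewrite !exprS; ring.
by rewrite -IHk !exprS; ring.
Qed.

(** The q-Chu-Vandermonde formula with denominators cleared, which allows an induction on [c] with
    [B] free. *)
Lemma qVandermonde_poly B Z c :
  \sum_(k < c.+1) sbin c k * Z ^+ k * \prod_(t < k) (1 - B * u ^+ t)
    * \prod_(k <= t < c) (1 - B * Z * u ^+ t) = \prod_(t < c) (1 - Z * u ^+ t).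
Proof.
elim: c B => [|c IHc] B.
  by rewrite big_ord_recr !big_ord0 /= big_geq// add0r !mulr1.
pose P b k := \prod_(t < k) (1 - b * u ^+ t).
pose Q b k m := \prod_(k <= t < m) (1 - b * Z * u ^+ t).
(* The Pascal rule in [sbin] splits the sum into one for [c] and [B], with an extra factor
   $1-BZu^c$, and one for [c] and $Bu$. The claim then rests on $(1-BZu^c)-u^cZ(1-B)=1-Zu^c$. *)
have step : \sum_(k < c.+2) sbin c.+1 k * Z ^+ k * P B k * Q B k c.+1 =
   \sum_(k < c.+1) sbin c k * Z ^+ k * P B k * Q B k c.+1
   - u ^+ c * Z * (1 - B) * \sum_(k < c.+1) sbin c k * Z ^+ k * P (B * u) k * Q (B * u) k c.
  rewrite big_ord_recl [X in X - _]big_ord_recl -addrA; congr (_ + _).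
    by rewrite !sbin0.
  have -> : \sum_(k < c) sbin c (lift ord0 k) * Z ^+ lift ord0 k * P B (lift ord0 k)
       * Q B (lift ord0 k) c.+1 =
     \sum_(k < c.+1) sbin c k.+1 * Z ^+ k.+1 * P B k.+1 * Q B k.+1 c.+1.
    by rewrite big_ord_recr /= sbin_gt// !mul0r addr0; apply: eq_bigr.
  rewrite mulr_sumr -sumrB; apply: eq_bigr => k _; rewrite lift0 [sbin _ _]/=.
  have -> : P B k.+1 = (1 - B) * P (B * u) k.
    rewrite /P big_ord_recl expr0 mulr1; congr (_ * _); apply: eq_bigr => t _.
    by rewrite lift0 exprS mulrA.
  have -> : Q B k.+1 c.+1 = Q (B * u) k c.
    by rewrite /Q big_add1 /=; apply: eq_bigr => t _; rewrite exprS; ring.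
  by rewrite exprS; ring.
rewrite [LHS]step [\sum_(k < c.+1) _ * P (B * u) k * _]IHc [RHS]big_ord_recr /= -(IHc B).
rewrite mulr_suml mulr_sumr -sumrB; apply: eq_bigr => k _.
have kc : (k <= c)%N by rewrite -ltnS.
by rewrite /P /Q big_nat_recr//=; ring.
Qed.

(** In standard notation ${}_2\phi_1(u^{-c},B;BZ;u,Zu^c)=(Z;u)_c/(BZ;u)_c$. The summands are
    products of term ratios so that they can be compared with [tcoef] factor by factor. *)
Lemma qVandermonde B Z c : (forall k, u ^+ k.+1 != 1) ->
  (forall t, (t < c)%N -> 1 - B * Z * u ^+ t != 0) ->
  (\sum_(k < c.+1) \prod_(t < k) ((u ^+ c - u ^+ t) * (1 - B * u ^+ t)
       / ((1 - u ^+ t.+1) * (1 - B * Z * u ^+ t)) * Z))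
    * \prod_(t < c) (1 - B * Z * u ^+ t) = \prod_(t < c) (1 - Z * u ^+ t).
Proof.
move=> uX_neq1 BZ_neq0; rewrite -[RHS](qVandermonde_poly B) mulr_suml.
apply: eq_bigr => k _.
have kc : (k <= c)%N by rewrite -ltnS.
rewrite -(big_mkord xpredT (fun t => 1 - B * Z * u ^+ t)) (big_cat_nat (leq0n _) kc) /= mulrA.
congr (_ * _); rewrite big_mkord -big_split /=.
elim: {k}(k : nat) kc => [|k IHk] kc.
  by rewrite !big_ord0 sbin0 !mulr1.
rewrite !big_ord_recr /= IHk; last by lia.
have := uX_neq1 k; rewrite eq_sym -subr_eq0 => D_neq0.
have -> : sbin c k.+1 = sbin c k * (u ^+ c - u ^+ k) / (1 - u ^+ k.+1).
  by rewrite -sbin_ratio mulfK.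
rewrite (exprSr Z); have := BZ_neq0 _ kc; move: D_neq0.
move: (1 - u ^+ k.+1) (1 - B * Z * u ^+ k) => D1 D2 D1_neq0 D2_neq0.
by field; rewrite D1_neq0 D2_neq0.
Qed.

End QVandermonde.

(** * The abstract quantum vector space *)

Section QuantumAlgebra.
(* Pairs are counted from the inside: [X i, X' i] stand for [x_j, x_j'] with
   [j = n - i], and [Xm] for [x_(n+1)].  For even N put [Xm = 0], so that the
   innermost algebra is the field of scalars and both parities are uniform. *)
Variables (F : fieldType) (L : algType F) (q : F) (n : nat).
Variables (X X' : nat -> L) (Xm : L) (c0 : F).

(* [Y i] is [y_j] for [j = n - i + 1], an element of the algebra of the pairs
   below [i]; [graded i d] is the degree d part of that algebra. *)
Fixpoint Y i : L := if i is k.+1 then X k * X' k + q *: Y k else c0 *: Xm ^+ 2.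

Fixpoint graded i d : L -> Prop :=
  if i is k.+1 then
    lspan (fun p => exists a b e g,
      [/\ d = (a + b + e)%N, graded k e g & p = X k ^+ a * g * X' k ^+ b])
  else fun p => exists c, p = c *: Xm ^+ d.

Hypothesis q_neq0 : q != 0.
Hypothesis XX : forall i k, (i < k < n)%N -> X k * X i = q *: (X i * X k).
Hypothesis XX' : forall i k, (i < k < n)%N -> X k * X' i = q *: (X' i * X k).
Hypothesis X'X : forall i k, (i < k < n)%N -> X i * X' k = q *: (X' k * X i).
Hypothesis X'X' : forall i k, (i < k < n)%N -> X' i * X' k = q *: (X' k * X' i).
Hypothesis XXm : forall k, (k < n)%N -> X k * Xm = q *: (Xm * X k).
Hypothesis XmX' : forall k, (k < n)%N -> Xm * X' k = q *: (X' k * Xm).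
Hypothesis X'Xcomm : forall i, (i < n)%N ->
  X' i * X i = X i * X' i + (q - q^-1) *: Y i.

Lemma graded0 i d : graded i d 0.
Proof. by case: i => [|i] /=; [exists 0; rewrite scale0r|apply: lspan0]. Qed.

Lemma gradedD i d g g' : graded i d g -> graded i d g' -> graded i d (g + g').
Proof.
case: i => [|i] /=; last exact: lspanD.
by move=> [c ->] [c' ->]; exists (c + c'); rewrite scalerDl.
Qed.

Lemma gradedZ i d c g : graded i d g -> graded i d (c *: g).
Proof.
case: i => [|i] /=; last exact: lspanZ.
by move=> [c' ->]; exists (c * c'); rewrite scalerA.
Qed.

Lemma graded_mono i a b e g : graded i e g -> graded i.+1 (a + b + e) (X i ^+ a * g * X' i ^+ b).
Proof. by move=> gB; apply: lspan_mem; exists a, b, e, g. Qed.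

Lemma graded_ind i d (P : L -> Prop) :
  P 0 -> (forall p r, P p -> P r -> P (p + r)) -> (forall c p, P p -> P (c *: p)) ->
  (forall a b e g, d = (a + b + e)%N -> graded i e g -> P (X i ^+ a * g * X' i ^+ b)) ->
  forall p, graded i.+1 d p -> P p.
Proof.
move=> P0 PD PZ Pm p; elim=> {p} [p [a [b [e [g [de gB ->]]]]]||p r _ ? _ ?|c p _ ?].
- exact: Pm de gB.
- exact: P0.
- exact: PD.
- exact: PZ.
Qed.

Lemma graded_up i d g : graded i d g -> graded i.+1 d g.
Proof.
by move=> /(graded_mono 0 0); rewrite !expr0 mul1r mulr1.
Qed.

Lemma graded1 i : graded i 0 1.
Proof.
elim: i => [|i /graded_up//]; by exists 1; rewrite scale1r expr0.
Qed.

Lemma exp_comm_scale (u v : L) (c : F) a b :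
  u * v = c *: (v * u) -> u ^+ a * v ^+ b = c ^+ (a * b) *: (v ^+ b * u ^+ a).
Proof.
move=> uv.
have uvb : u * v ^+ b = c ^+ b *: (v ^+ b * u).
  elim: b => [|b IHb]; first by rewrite !expr0 mulr1 mul1r scale1r.
  rewrite [in LHS]exprS mulrA uv -scalerAl -[v * u * _]mulrA IHb -scalerAr scalerA.
  by rewrite mulrA -!exprS.
elim: a => [|a IHa]; first by rewrite !expr0 mulr1 mul1r scale1r.
rewrite exprS -mulrA IHa -scalerAr [u * (_ * _)]mulrA uvb -scalerAl scalerA.
by rewrite -[_ * u * _]mulrA -exprS -exprD mulSn addnC.
Qed.

(** Every inner generator, of either kind, passes an outer generator with the same factor [q], so
    only the degree is seen. *)
Lemma graded_comm i d g : graded i d g -> forall k, (i <= k < n)%N ->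
  X k * g = q ^+ d *: (g * X k) /\ g * X' k = q ^+ d *: (X' k * g).
Proof.
elim: i d g => [|i IHi] d g.
  move=> [c ->] k /andP[_ kn]; split.
    rewrite -scalerAr -[X k]expr1 (exp_comm_scale _ _ (XXm kn)) mul1n.
    by rewrite -scalerAl !scalerA mulrC.
  rewrite -scalerAl -[X' k]expr1 (exp_comm_scale _ _ (XmX' kn)) muln1.
  by rewrite -scalerAr !scalerA mulrC.
move=> gB k ikn; elim/graded_ind: gB => {g}.
- by rewrite !mul0r !mulr0 scaler0.
- by move=> p r [p1 p2] [r1 r2]; rewrite !mulrDr !mulrDl p1 p2 r1 r2 !scalerDr.
- move=> c p [p1 p2]; rewrite -!scalerAr -!scalerAl p1 p2 !scalerA.
  by split; rewrite (mulrC c).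
move=> a b e g -> gB.
have ikn' : (i <= k < n)%N by lia.
have [g1 g2] := IHi _ _ gB _ ikn'; split.
- rewrite 2!mulrA -{1}[X k]expr1 (exp_comm_scale _ _ (XX ikn)) mul1n expr1.
  rewrite -2!scalerAl -[X i ^+ a * X k * g]mulrA g1 -scalerAr -scalerAl scalerA.
  have := exp_comm_scale 1 b (XX' ikn); rewrite mul1n expr1 => Xkb.
  rewrite -[X i ^+ a * (g * X k) * _]mulrA -[g * X k * _]mulrA Xkb -!scalerAr scalerA -!mulrA.
  by rewrite -!exprD; congr (q ^+ _ *: _); lia.
- have := exp_comm_scale b 1 (X'X' ikn); rewrite muln1 expr1 => Xkb.
  rewrite -mulrA Xkb -scalerAr [X i ^+ a * g * (_ * _)]mulrA -[X i ^+ a * g * _]mulrA g2.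
  have := exp_comm_scale a 1 (X'X ikn); rewrite muln1 expr1 => Xka.
  rewrite -scalerAr -scalerAl scalerA [X i ^+ a * (_ * g)]mulrA Xka -!scalerAl scalerA -!mulrA.
  by rewrite -!exprD; congr (q ^+ _ *: _); lia.
Qed.

Lemma graded_commX i d g a : (i < n)%N -> graded i d g ->
  X i ^+ a * g = q ^+ (d * a) *: (g * X i ^+ a).
Proof.
move=> i_n gB; have [|gX _] := graded_comm gB (k := i); first by rewrite leqnn.
have := exp_comm_scale a 1 gX; rewrite !expr1 => ->.
by rewrite muln1 -exprM.
Qed.

Lemma graded_commX' i d g b : (i < n)%N -> graded i d g ->
  g * X' i ^+ b = q ^+ (d * b) *: (X' i ^+ b * g).
Proof.
move=> i_n gB; have [|_ gX] := graded_comm gB (k := i); first by rewrite leqnn.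
have := exp_comm_scale 1 b gX; rewrite !expr1 => ->.
by rewrite mul1n -exprM.
Qed.

Lemma Y_graded i : graded i 2 (Y i).
Proof.
elim: i => [|i IHi]; first by exists c0.
apply: gradedD; last by apply: gradedZ; apply: graded_up.
by have := graded_mono 1 1 (graded1 i); rewrite mulr1 !expr1 addn0.
Qed.

Lemma YX i : (i < n)%N -> X i * Y i = q ^+ 2 *: (Y i * X i).
Proof. by move=> i_n; have := graded_commX 1 i_n (Y_graded i); rewrite expr1 muln1. Qed.

Lemma YX' i : (i < n)%N -> Y i * X' i = q ^+ 2 *: (X' i * Y i).
Proof. by move=> i_n; have := graded_commX' 1 i_n (Y_graded i); rewrite expr1 muln1. Qed.

Lemma XX'_comm i d g : (i < n)%N -> graded i d g -> GRing.comm (X i * X' i) g.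
Proof.
move=> i_n gB; rewrite /GRing.comm mulrA.
have := graded_commX' 1 i_n gB; rewrite expr1 muln1 => gX'.
have := graded_commX 1 i_n gB; rewrite expr1 muln1 => gX.
apply: (scalerI (expf_neq0 d q_neq0)).
by rewrite -[_ * _ * g]mulrA scalerAr -gX' mulrA gX -scalerAl.
Qed.

(** The weight [q] of [Y i] inside [Y i.+1] is what makes this work: after $xy=q^2yx$ it comes down
    to $(q-q^{-1})q^2+q=q^3$. *)
Lemma YS_commX i : (i < n)%N -> GRing.comm (Y i.+1) (X i).
Proof.
move=> i_n; rewrite /GRing.comm /= mulrDl mulrDr -mulrA X'Xcomm// mulrDr -addrA.
congr (_ + _); rewrite -!scalerAl -!scalerAr YX// !scalerA -scalerDl.
by congr (_ *: _); field.
Qed.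

Lemma YS_commX' i : (i < n)%N -> GRing.comm (Y i.+1) (X' i).
Proof.
move=> i_n; rewrite /GRing.comm /= mulrDl mulrDr [in RHS]mulrA X'Xcomm// mulrDl -[in RHS]addrA.
congr (_ + _); rewrite -!scalerAl -!scalerAr YX'// !scalerA -scalerDl.
by congr (_ *: _); field.
Qed.

Lemma Y_comm i d g : (i <= n)%N -> graded i d g -> GRing.comm (Y i) g.
Proof.
elim: i d g => [|i IHi] d g i_n.
  move=> [c ->]; rewrite /= /GRing.comm.
  by rewrite -!scalerAl -!scalerAr !scalerA mulrC -!exprD addnC.
elim/graded_ind => {g}.
- exact: commr0.
- by move=> p r; exact: commrD.
- by move=> c p pc; rewrite /GRing.comm -scalerAl -scalerAr pc.
move=> a b e g _ gB; apply: commrM; [apply: commrM|]; last first.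
- by apply: commrX; exact: YS_commX'.
- apply: commr_sym; rewrite /=; apply: commrD; first by apply: commr_sym; exact: (XX'_comm i_n gB).
  rewrite /GRing.comm -scalerAl -scalerAr; congr (_ *: _); apply: esym.
  by apply: IHi gB; lia.
- by apply: commrX; exact: YS_commX.
Qed.

(** The coefficient is the geometric sum $(q-q^{-1})\sum_{s\le a}q^{-2s}$, with one term for each
    [X i] that [X' i] passes. *)
Lemma X'Xexp i a : (i < n)%N ->
  X' i * X i ^+ a.+1 =
  X i ^+ a.+1 * X' i + (q * (1 - (q ^+ 2) ^- a.+1)) *: (X i ^+ a * Y i).
Proof.
move=> i_n; elim: a => [|a IHa].
  rewrite expr0 !expr1 mul1r X'Xcomm//; congr (_ + _ *: _).
  by field.
rewrite exprSr mulrA IHa mulrDl -mulrA X'Xcomm// mulrDr mulrA -exprSr -addrA; congr (_ + _).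
have YXi : Y i * X i = q ^- 2 *: (X i * Y i).
  by rewrite YX// scalerA mulVf ?expf_neq0// scale1r.
rewrite -scalerAl -[X i ^+ a * _ * _]mulrA YXi.
rewrite -!scalerAr mulrA -exprSr scalerA -scalerDl; congr (_ *: _).
rewrite (exprS _ a.+1) !invfM; field.
by rewrite q_neq0 expf_neq0 ?expf_neq0.
Qed.

(** A product of two words has to be brought back to the shape $X^agX'^b$. The left word is
    multiplied on letter by letter; only [X' i] passing a power of [X i] creates a new term, and its
    [Y i] is absorbed into the inner element. *)
Lemma gradedM i d e g g' : (i <= n)%N -> graded i d g -> graded i e g' -> graded i (d + e) (g * g').
Proof.
elim: i d e g g' => [|i IHi] d e g g' i_n.
  move=> [c ->] [c' ->]; exists (c * c').
  by rewrite -scalerAl -scalerAr scalerA exprD.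
have MX p k : graded i.+1 k p -> graded i.+1 k.+1 (X i * p).
  elim/graded_ind => {p} [|p r Hp Hr|c p Hp|a b f p -> Hp].
  - by rewrite mulr0; apply: graded0.
  - by rewrite mulrDr; apply: gradedD.
  - by rewrite -scalerAr; apply: gradedZ.
  - by rewrite !mulrA -exprS -!addSn; apply: graded_mono.
have MX' p k : graded i.+1 k p -> graded i.+1 k.+1 (X' i * p).
  elim/graded_ind => {p} [|p r Hp Hr|c p Hp|a b f p -> Hp].
  - by rewrite mulr0; apply: graded0.
  - by rewrite mulrDr; apply: gradedD.
  - by rewrite -scalerAr; apply: gradedZ.
  have pX' : X' i * p = q ^- f *: (p * X' i).
    have := graded_commX' 1 i_n Hp; rewrite expr1 muln1 => ->.
    by rewrite scalerA mulVf ?expf_neq0// scale1r.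
  case: a => [|a].
    rewrite expr0 mul1r add0n mulrA pX' -scalerAl; apply: gradedZ; rewrite -mulrA -exprS.
    by have := graded_mono 0 b.+1 Hp; rewrite expr0 mul1r add0n.
  rewrite 2!mulrA X'Xexp// 2!mulrDl; apply: gradedD.
    rewrite -[_ * X' i * p]mulrA pX' -scalerAr -scalerAl; apply: gradedZ; rewrite -2!mulrA -exprS.
    have -> : (a.+1 + b + f).+1 = (a.+1 + b.+1 + f)%N by lia.
    by rewrite mulrA; apply: graded_mono.
  rewrite -2!scalerAl; apply: gradedZ; rewrite -(mulrA _ (Y i)).
  have -> : (a.+1 + b + f).+1 = (a + b + (2 + f))%N by lia.
  by apply: graded_mono; apply: IHi => //; [lia|exact: Y_graded].
have Mh h l : graded i l h -> forall p k, graded i.+1 k p -> graded i.+1 (l + k) (h * p).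
  move=> Hh p k; elim/graded_ind => {p} [|p r Hp Hr|c p Hp|a b f p -> Hp].
  - by rewrite mulr0; apply: graded0.
  - by rewrite mulrDr; apply: gradedD.
  - by rewrite -scalerAr; apply: gradedZ.
  rewrite 2!mulrA.
  have -> : h * X i ^+ a = q ^- (l * a) *: (X i ^+ a * h).
    by rewrite (graded_commX _ i_n Hh) scalerA mulVf ?expf_neq0// scale1r.
  rewrite -2!scalerAl; apply: gradedZ; rewrite -(mulrA _ h).
  have -> : (l + (a + b + f) = a + b + (l + f))%N by lia.
  by apply: graded_mono; apply: IHi => //; lia.
move=> Hg Hg'; elim/graded_ind: Hg => {g} [|p r Hp Hr|c p Hp|a b f p -> Hp].
- by rewrite mul0r; apply: graded0.
- by rewrite mulrDl; apply: gradedD.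
- by rewrite -scalerAl; apply: gradedZ.
rewrite -2!mulrA.
have -> : (a + b + f + e = a + (f + (b + e)))%N by lia.
elim: a => [|a IHa]; last by rewrite exprS -mulrA addSn; apply: MX.
rewrite expr0 mul1r add0n; apply: Mh => //.
elim: b => [|b IHb]; last by rewrite exprS -mulrA addSn; apply: MX'.
by rewrite expr0 mul1r.
Qed.

Ltac expq := rewrite ?mul2n -?addnn ?(exprD, exprS, expr0).
Arguments graded : simpl never.
Arguments Y : simpl never.

(** * The q-Laplace operator *)

(* [N = 2 n + o], [G i = q^rho_(n-i)] and [K = 1 + q^(N-2)]. *)
Variables (o : nat) (G : nat -> F) (K : F).
Hypothesis qX_neq1 : forall k, q ^+ k.+1 != 1.
Hypothesis G_neq0 : forall i, G i != 0.
Hypothesis GS : forall i, G i.+1 = q * G i.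
Hypothesis G2 : forall i, G i ^+ 2 = q ^+ (2 * i + o).
Hypothesis K_neq0 : K != 0.

Lemma q2_neq1 : q - q^-1 != 0.
Proof.
have := qX_neq1 1; apply: contra => /eqP qq; apply/eqP.
by rewrite -(mulfV q_neq0) expr2; congr (_ * _); apply/eqP; rewrite -subr_eq0 qq.
Qed.

Lemma qq1_neq0 : q * q - 1 != 0.
Proof. by rewrite subr_eq0; exact: (qX_neq1 1). Qed.

Lemma qnX_neq1 k : (0 < k)%N -> q ^+ k - 1 != 0.
Proof. by case: k => // k _; rewrite subr_eq0. Qed.

Ltac nz := rewrite ?(q_neq0, G_neq0, K_neq0, qq1_neq0, expf_neq0)//.

Definition qint a : F := (q ^+ a - q ^- a) / (q - q^-1).

Lemma qint0 : qint 0 = 0. Proof. by rewrite /qint expr0 invr1 subrr mul0r. Qed.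

Variables (Delta : {linear L -> L}) (kappa : nat -> F).
Hypothesis DeltaX : forall i a b d g, (i < n)%N -> graded i d g ->
  Delta (X i ^+ a * g * X' i ^+ b) =
    (K * q ^+ (a + b + d) / q / G i * qint a * qint b) *: (X i ^+ a.-1 * g * X' i ^+ b.-1)
    + q ^+ (2 * (a + b)) *: (X i ^+ a * Delta g * X' i ^+ b).

Definition Delta_Y_coef i d : F := K * q / G i * (q ^+ (2 * i + o + 2 * d) - 1) / (q - q^-1).

Hypothesis DeltaXm : forall d, Delta (Xm ^+ d) = kappa d *: Xm ^+ (d - 2).
Hypothesis kappa_lt2 : forall d, (d < 2)%N -> kappa d = 0.
Hypothesis DeltaY0 : forall d, Delta (Y 0 * Xm ^+ d) =
  q ^+ 2 *: (Y 0 * Delta (Xm ^+ d)) + Delta_Y_coef 0 d *: Xm ^+ d.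

(** The second part compensates for the truncation in [d - 2]: in degree below 2 the image is 0, not
    merely an element of degree 0. *)
Lemma Delta_graded i d g : (i <= n)%N -> graded i d g ->
  graded i (d - 2) (Delta g) /\ ((d < 2)%N -> Delta g = 0).
Proof.
elim: i d g => [|i IHi] d g i_n.
  move=> [c ->]; rewrite linearZ /= DeltaXm scalerA; split; first by exists (c * kappa d).
  by move=> /kappa_lt2 ->; rewrite mulr0 scale0r.
elim/graded_ind => {g} [|p r [p1 p2] [r1 r2]|c p [p1 p2]|a b e p -> Hp].
- by rewrite linear0; split=> //; apply: graded0.
- rewrite linearD; split; first exact: gradedD.
  by move=> d2; rewrite p2// r2// addr0.
- rewrite linearZ /=; split; first exact: gradedZ.
  by move=> d2; rewrite p2// scaler0.
have [p1 p2] := IHi _ _ (ltnW i_n) Hp; rewrite (DeltaX _ _ i_n Hp).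
split.
  apply: gradedD.
    case: a => [|a]; first by rewrite qint0 mulr0 mul0r scale0r; apply: graded0.
    case: b => [|b]; first by rewrite qint0 mulr0 scale0r; apply: graded0.
    apply: gradedZ => /=; have -> : (a.+1 + b.+1 + e - 2 = a + b + e)%N by lia.
    exact: graded_mono.
  apply: gradedZ; case: (ltnP e 2) => e2; first by rewrite p2// mulr0 mul0r; apply: graded0.
  by rewrite -addnBA//; apply: graded_mono.
move=> d2; rewrite p2; last by lia.
rewrite mulr0 mul0r scaler0 addr0.
case: a d2 => [|a] d2; first by rewrite qint0 mulr0 mul0r scale0r.
by case: b d2 => [|b] d2; [rewrite qint0 mulr0 scale0r|lia].
Qed.

Lemma X'_graded i d g : (i < n)%N -> graded i d g -> X' i * g = q ^- d *: (g * X' i).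
Proof.
move=> i_n gB; have := graded_commX' 1 i_n gB; rewrite expr1 muln1 => ->.
by rewrite scalerA mulVf ?expf_neq0// scale1r.
Qed.

(** The commutation factor [e] is a parameter because [h] will also be [Delta p]: for [p] of degree
    [d] the factor $q^{2-d}$ remains valid when $d<2$ and [Delta p] is 0. *)
Lemma YS_word i a b e h : (i < n)%N -> X' i * h = e *: (h * X' i) ->
  Y i.+1 * (X i ^+ a * h * X' i ^+ b) =
  e *: (X i ^+ a.+1 * h * X' i ^+ b.+1) + q *: (X i ^+ a * (Y i * h) * X' i ^+ b).
Proof.
move=> i_n X'h.
rewrite mulrA mulrA (commrX a (YS_commX i_n)) -[X i ^+ a * _ * h]mulrA [Y i.+1]/=.
rewrite [(_ + _) * h]mulrDl mulrDr mulrDl; congr (_ + _); last first.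
  by rewrite -scalerAl -scalerAr -scalerAl.
rewrite -[X i * _ * h]mulrA X'h -!scalerAr -scalerAl; congr (_ *: _).
by rewrite exprSr exprS !mulrA.
Qed.

Lemma Delta_Y i d p : (i <= n)%N -> graded i d p ->
  Delta (Y i * p) = q ^+ 2 *: (Y i * Delta p) + Delta_Y_coef i d *: p.
Proof.
elim: i d p => [|i IHi] d p i_n.
  move=> [c ->]; rewrite -scalerAr !linearZ /= DeltaY0 scalerDr.
  by rewrite -!scalerAr !scalerA mulrC; congr (_ + _ *: _); rewrite mulrC.
elim/graded_ind => {p} [|p r Hp Hr|c p Hp|a b e p -> Hp].
- by rewrite !(linear0, mulr0, scaler0) addr0.
- by rewrite !(linearD, mulrDr, scalerDr) /= Hp Hr addrACA.
- rewrite linearZ -!scalerAr linearZ /= Hp scalerDr !scalerA.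
  by rewrite mulrC; congr (_ + _ *: _); rewrite mulrC.
have i_n' := ltnW i_n.
have HBYp := gradedM i_n' (Y_graded i) Hp.
have [HDpB Dp0] := Delta_graded i_n' Hp.
have X'D : X' i * Delta p = (q ^+ 2 / q ^+ e) *: (Delta p * X' i).
  case: (ltnP e 2) => e2; first by rewrite Dp0// mulr0 mul0r scaler0.
  rewrite (X'_graded i_n HDpB) -{2}(subnK e2) exprD; congr (_ *: _).
  by rewrite invfM mulrCA mulfV ?expf_neq0// mulr1.
rewrite (YS_word _ _ i_n (X'_graded i_n Hp)) linearD !linearZ /=.
rewrite (DeltaX _ _ i_n Hp) (DeltaX _ _ i_n HBYp) (DeltaX _ _ i_n Hp) (IHi _ _ i_n' Hp).
rewrite [Y i.+1 * _]mulrDr -!scalerAr (YS_word _ _ i_n X'D).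
(* The predecessors [a.-1] and [b.-1] are truncated only where [qint a] or [qint b] is 0. *)
have YSm c : (c * qint a * qint b) *: (Y i.+1 * (X i ^+ a.-1 * p * X' i ^+ b.-1)) =
    (c * qint a * qint b / q ^+ e) *: (X i ^+ a * p * X' i ^+ b)
    + (c * qint a * qint b * q) *: (X i ^+ a.-1 * (Y i * p) * X' i ^+ b.-1).
  case: a => [|a]; first by rewrite qint0 mulr0 !mul0r !scale0r addr0.
  case: b => [|b]; first by rewrite qint0 mulr0 !mul0r !scale0r addr0.
  by rewrite (YS_word _ _ i_n (X'_graded i_n Hp)) scalerDr !scalerA.
rewrite YSm /=.
rewrite !(mulrDr, mulrDl) -!(scalerAr, scalerAl) !(scalerDr, scalerA).
set w1 := X i ^+ a * p * _; set w2 := X i ^+ a.+1 * Delta p * _.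
set w3 := X i ^+ a.-1 * _ * _; set w4 := X i ^+ a * _ * _.
rewrite !addrA [LHS](ACl ((1 * 5) * 2 * 3 * 4)) [RHS](ACl ((1 * 5) * 3 * 2 * 4)) /=.
rewrite -!scalerDl; do 3?congr (_ + _); congr (_ *: _).
- by rewrite /Delta_Y_coef /qint GS; expq; field; nz.
- by expq; field; nz.
- by expq; field; nz.
- by expq; ring.
Qed.

Lemma graded_YX i d g k : (i <= n)%N -> graded i d g -> graded i (2 * k + d) (Y i ^+ k * g).
Proof.
move=> i_n Hg; elim: k => [|k IHk]; first by rewrite expr0 mul1r.
by rewrite exprS -mulrA mulnS -addnA; apply: gradedM => //; exact: Y_graded.
Qed.

(** Closed form of the sum over [t <= k] of [q ^+ (2 * t) * Delta_Y_coef i (d + 2 * (k - t))],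
    collected from [k.+1] uses of [Delta_Y]. The factored form shows when it is nonzero. *)
Definition Delta_YX_coef i k d : F :=
  K * q / G i / (q - q^-1) * (q ^+ (2 * k.+1) - 1) / (q * q - 1)
  * (q ^+ (2 * i + o + 2 * d + 2 * k) - 1).

Lemma Delta_YX_coef_neq0 i k d : (0 < 2 * i + o + 2 * d + 2 * k)%N -> Delta_YX_coef i k d != 0.
Proof.
move=> pos; rewrite /Delta_YX_coef !mulf_neq0 ?invr_neq0 ?K_neq0 ?q2_neq1 ?qq1_neq0 ?G_neq0//.
  exact: qnX_neq1.
exact: qnX_neq1.
Qed.

Lemma Delta_YX i d p k : (i <= n)%N -> graded i d p ->
  Delta (Y i ^+ k.+1 * p) =
  q ^+ (2 * k.+1) *: (Y i ^+ k.+1 * Delta p) + Delta_YX_coef i k d *: (Y i ^+ k * p).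
Proof.
move=> i_n Hp; elim: k => [|k IHk].
  rewrite !expr1 expr0 mul1r muln1 (Delta_Y i_n Hp); congr (_ + _ *: _).
  by rewrite /Delta_YX_coef /Delta_Y_coef; expq; field; nz.
rewrite exprS -mulrA (Delta_Y i_n (graded_YX k.+1 i_n Hp)) IHk mulrDr scalerDr.
rewrite -!scalerAr !scalerA !mulrA -!exprS -addrA -scalerDl; congr (_ *: _ + _ *: _).
  by expq; ring.
by rewrite /Delta_YX_coef /Delta_Y_coef; expq; field; nz.
Qed.

(* Ratio of consecutive coefficients of [t_(a,b;a+b+l)] written in powers of
   [Y i.+1] instead of [Q_j]. *)
Definition tcoef_ratio i a b l t : F :=
  q ^+ 2 / q ^+ (2 * l + 2 * i + o) * (1 - q ^+ (2 * t) / q ^+ (2 * a))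
  * (1 - q ^+ (2 * t) / q ^+ (2 * b))
  / ((1 - q ^+ (2 * t.+1)) * (1 - q ^+ (2 * t.+1) / q ^+ (2 * i + o + 2 * (a + b + l)))).

Definition tcoef i a b l k : F := \prod_(t < k) tcoef_ratio i a b l t.

Definition tpol i a b l : L :=
  \sum_(k < (minn a b).+1) tcoef i a b l k *:
    (Y i.+1 ^+ k * X i ^+ (a - k) * X' i ^+ (b - k)).

Lemma X'exp_graded i d f b : (i < n)%N -> graded i d f ->
  X' i ^+ b * f = q ^- (d * b) *: (f * X' i ^+ b).
Proof.
move=> i_n Hf; rewrite (graded_commX' _ i_n Hf) scalerA mulVf ?expf_neq0//.
by rewrite scale1r.
Qed.

Lemma XXf_graded i l f a b : (i < n)%N -> graded i l f -> graded i.+1 (a + b + l) (X i ^+ a * X' i ^+ b * f).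
Proof.
move=> i_n Hf; rewrite -mulrA (X'exp_graded _ i_n Hf) -scalerAr mulrA.
exact/gradedZ/graded_mono.
Qed.

Lemma Delta_XXf i l f a b : (i < n)%N -> graded i l f -> Delta f = 0 ->
  Delta (X i ^+ a * X' i ^+ b * f) =
  (K * q ^+ (a + b) / q / G i * qint a * qint b) *: (X i ^+ a.-1 * X' i ^+ b.-1 * f).
Proof.
move=> i_n Hf Df; rewrite -(mulrA (X i ^+ a)) -(mulrA (X i ^+ a.-1)) !(X'exp_graded _ i_n Hf) -!scalerAr linearZ /= (mulrA (X i ^+ a)) (mulrA (X i ^+ a.-1)).
rewrite (DeltaX _ _ i_n Hf) Df mulr0 mul0r scaler0 addr0 !scalerA.
case: b => [|b]; first by rewrite qint0 !mulr0 mul0r !scale0r.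
congr (_ *: _); rewrite /= mulnS; expq; field; nz.
Qed.

(** The [k]-th term yields a multiple of $Y^kw_{k+1}$ and one of $Y^{k-1}w_k$. The ratio
    [tcoef_ratio] is the one for which the first cancels the second of the next term ([D0]); at
    [k = m] the first is absent because a power of [X i] or [X' i] is used up ([cm]). *)
Lemma Delta_tpol i l f a b : (i < n)%N -> graded i l f -> Delta f = 0 -> Delta (tpol i a b l * f) = 0.
Proof.
move=> i_n Hf Df; set m := minn a b; pose c k := K * q ^+ (a - k + (b - k)) / q / G i * qint (a - k) * qint (b - k).
pose w k := X i ^+ (a - k) * X' i ^+ (b - k) * f.
pose tcoef' := tcoef i a b l; pose d k := (a - k + (b - k) + l)%N.
have -> : tpol i a b l * f = \sum_(k < m.+1) tcoef' k *: (Y i.+1 ^+ k * w k).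
  by rewrite mulr_suml; apply: eq_bigr => k _; rewrite -scalerAl /w !mulrA.
rewrite linear_sum /=; under eq_bigr => k _ do rewrite linearZ /=.
have Dw k : Delta (w k) = c k *: w k.+1 by rewrite (Delta_XXf _ _ i_n Hf Df) -!subnS.
have cm : c m = 0.
  rewrite /c; have [->|->] : (a - m = 0 \/ b - m = 0)%N by rewrite /m; lia.
    by rewrite qint0 mulr0 mul0r.
  by rewrite qint0 mulr0.
have D0 k : (k < m)%N -> tcoef' k * (q ^+ (2 * k) * c k) + tcoef' k.+1 * Delta_YX_coef i.+1 k (d k.+1) = 0.
  move=> km; rewrite /tcoef' /tcoef big_ord_recr /= -/(tcoef i a b l k) -mulrA -mulrDr.
  suff -> : q ^+ (2 * k) * c k + tcoef_ratio i a b l k * Delta_YX_coef i.+1 k (d k.+1) = 0 by rewrite mulr0.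
  rewrite /c /d /tcoef_ratio /Delta_YX_coef GS.
  have [[A aE] [B bE]] : (exists A, a = A.+1 + k)%N /\ (exists B, b = B.+1 + k)%N.
    by split; [exists (a - k.+1)%N|exists (b - k.+1)%N]; rewrite /m in km; lia.
  have -> : (a - k.+1 = A)%N by lia.
  have -> : (b - k.+1 = B)%N by lia.
  have -> : (a - k = A.+1)%N by lia.
  have -> : (b - k = B.+1)%N by lia.
  (* This factor of the denominator of [tcoef_ratio] is, up to a power of [q], also the last factor
     of [Delta_YX_coef]. It is nonzero because $k<\min(a,b)$. *)
  set D := 1 - q ^+ (2 * k.+1) / q ^+ (2 * i + o + _).
  have D_neq0 : D != 0.
    have : q ^+ (2 * i + o + 2 * (a + b + l) - 2 * k.+1) - 1 != 0 by apply: qnX_neq1; lia.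
    apply: contra => /eqP D0; apply/eqP.
    apply: (mulIf (expf_neq0 (2 * k.+1) q_neq0)); rewrite mul0r mulrBl mul1r -exprD.
    rewrite subnK; last by lia.
    apply: (mulIf (invr_neq0 (expf_neq0 (2 * i + o + 2 * (a + b + l)) q_neq0))).
    by rewrite mul0r mulrBl mulfV ?expf_neq0.
  have -> : q ^+ (2 * i.+1 + o + 2 * (A + B + l) + 2 * k) - 1 =
      D * (q ^+ (2 * i + o + 2 * (a + b + l)) / q ^+ (2 * k.+1)).
    by rewrite /D aE bE; expq; field; nz.
  have : 1 - q ^+ (2 * k.+1) != 0 by rewrite -opprB oppr_eq0; apply: qnX_neq1.
  rewrite -(opprB 1 (q ^+ (2 * k.+1))); set D1 := 1 - q ^+ _ => D1_neq0.
  rewrite aE bE /qint; clearbody D D1.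
  by expq; field; nz; rewrite D_neq0 D1_neq0.
have dw k : graded i.+1 (d k) (w k) by apply: XXf_graded.
pose r j := if j is j'.+1 then tcoef' j *: (Delta_YX_coef i.+1 j' (d j) *: (Y i.+1 ^+ j' * w j)) else 0.
have DY j : tcoef' j *: Delta (Y i.+1 ^+ j * w j) =
    (tcoef' j * (q ^+ (2 * j) * c j)) *: (Y i.+1 ^+ j * w j.+1) + r j.
  case: j => [|j]; first by rewrite /r muln0 !expr0 !mul1r addr0 Dw scalerA.
  by rewrite (Delta_YX _ i_n (dw j.+1)) Dw scalerDr -!scalerAr !scalerA /r scalerA mulrA.
have head j : (j <= m)%N -> \sum_(k < j) tcoef' k *: Delta (Y i.+1 ^+ k * w k) = - r j.
  elim: j => [|j IHj] jm; first by rewrite big_ord0 oppr0.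
  rewrite big_ord_recr /= IHj; last by lia.
  rewrite DY addrCA addNr addr0 /r scalerA; apply/eqP; rewrite -subr_eq0 opprK -scalerDl.
  by rewrite D0// scale0r.
rewrite big_ord_recr /= [X in X + _](head m (leqnn m)).
by rewrite [X in _ + X](DY m) cm !mulr0 scale0r add0r addNr.
Qed.

Lemma Ginv i : (G i)^-1 = G i / q ^+ (2 * i + o).
Proof. by rewrite -G2; field; nz. Qed.

Lemma qVX_neq1 k : (0 < k)%N -> 1 - q ^- k != 0.
Proof.
move=> k_gt0; apply: contra (qnX_neq1 k_gt0) => /eqP qk; apply/eqP.
rewrite -[q ^+ k]mulr1 -[X in _ * X](subrK (q ^- k)) qk add0r mulfV ?subrr//.
by rewrite expf_neq0.
Qed.

(** * The invariant functional *)

Hypothesis n_gt0 : (0 < n)%N.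
Variable phi : {scalar L}.

Definition phi_ratio i a d : F :=
  (1 - q ^- (2 * a.+1)) / (G i * K * (1 - q ^- (2 * n + o + d + 2 * a))).
Definition phi_Y_coef i d : F :=
  G i / q * (1 - q ^- (2 * i + o + d)) / (K * (1 - q ^- (2 * n + o + d))).

Hypothesis phiX : forall i a d g, (i < n)%N -> graded i d g ->
  phi (X i ^+ a.+1 * g * X' i ^+ a.+1) = phi_ratio i a d * phi (X i ^+ a * g * X' i ^+ a).
Hypothesis phiX0 : forall i a b d g, (i < n)%N -> graded i d g -> a <> b ->
  phi (X i ^+ a * g * X' i ^+ b) = 0.
Hypothesis phiYn : forall p, phi (Y n * p) = G n / q / K * phi p.

(** Induction from the outermost level inwards. In $Y_{i+1}g=q^{-d}XgX'+qY_ig$ the value of [phi] is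
    known on the left from level $i+1$ and on the first term on the right from [phiX], so the
    equation determines it on $Y_ig$. *)
Lemma phi_Y i d g : (i <= n)%N -> graded i d g -> phi (Y i * g) = phi_Y_coef i d * phi g.
Proof.
move=> i_n; rewrite -(subKn i_n); move: (n - i)%N (leq_subr i n) => k {i i_n}.
elim: k d g => [|k IHk] d g k_n Hg.
  rewrite subn0 phiYn /phi_Y_coef; congr (_ * _).
  have : 1 - q ^- (2 * n + o + d) != 0 by apply: qVX_neq1; lia.
  by move: (1 - _) => D D_neq0; field; nz; rewrite D_neq0.
set i := (n - k.+1)%N in Hg *; have i_n : (i < n)%N by lia.
have iS : (n - k = i.+1)%N by lia.
have := IHk d g (ltnW k_n); rewrite iS => /(_ (graded_up Hg)).
have := YS_word 0 0 i_n (X'_graded i_n Hg); rewrite !expr0 !mul1r !mulr1 => ->.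
rewrite linearD !linearZ /=.
have := phiX 0 i_n Hg; rewrite !expr0 mul1r mulr1 => -> phiYS.
apply: (mulfI q_neq0); apply: (addrI (q ^- d * (phi_ratio i 0 d * phi g))).
rewrite phiYS mulrA [q * _]mulrA -mulrDl; congr (_ * _).
rewrite /phi_Y_coef /phi_ratio GS !invfM Ginv muln0 addn0.
have : 1 - q ^- (2 * n + o + d) != 0 by apply: qVX_neq1; lia.
move: (1 - q ^- (2 * n + o + d)) => D D_neq0.
by expq; field; nz; rewrite D_neq0.
Qed.

Lemma qN_neq0 d : 1 - q ^- (2 * n + o + d) != 0.
Proof. by apply: qVX_neq1; lia. Qed.

Lemma phi_Y_coef_neq0 i d : (0 < 2 * i + o + d)%N -> phi_Y_coef i d != 0.
Proof.
move=> pos; rewrite /phi_Y_coef !mulf_neq0 ?invr_neq0 ?mulf_neq0//; last exact: qN_neq0.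
exact: qVX_neq1.
Qed.

Lemma phi_ratio_neq0 i a d : phi_ratio i a d != 0.
Proof.
rewrite /phi_ratio !mulf_neq0 ?invr_neq0 ?mulf_neq0//; last by rewrite -addnA; exact: qN_neq0.
exact: qVX_neq1.
Qed.

Lemma phi_YX i d g k : (i <= n)%N -> graded i d g ->
  phi (Y i ^+ k * g) = (\prod_(t < k) phi_Y_coef i (2 * t + d)) * phi g.
Proof.
move=> i_n Hg; elim: k => [|k IHk]; first by rewrite expr0 !mul1r big_ord0 mul1r.
rewrite exprS -mulrA (phi_Y i_n (graded_YX k i_n Hg)) IHk big_ord_recr /=.
by rewrite mulrA [X in X * _]mulrC.
Qed.

(* The modular property of the invariant functional. *)
Lemma phi_cyclic i d p : (i < n)%N -> graded i.+1 d p ->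
  phi (X' i * p) = q ^+ (2 * i + o) * phi (p * X' i).
Proof.
move=> i_n; elim/graded_ind => {p} [|p r Hp Hr|c p Hp|a b e g _ Hg].
- by rewrite mulr0 mul0r linear0 mulr0.
- by rewrite mulrDr mulrDl !linearD Hp Hr mulrDr.
- by rewrite -scalerAr -scalerAl !linearZ /= Hp mulrCA.
have X'g := X'_graded i_n Hg.
rewrite -[_ * X' i]mulrA -exprSr.
case: a => [|a].
  rewrite expr0 mul1r mulrA X'g -scalerAl -mulrA -exprS linearZ /=.
  by have := phiX0 i_n Hg (_ : 0%N <> b.+1); rewrite expr0 mul1r => -> //; rewrite !mulr0.
have HBYg := gradedM (ltnW i_n) (Y_graded i) Hg.
rewrite mulrA mulrA X'Xexp// !mulrDl -!scalerAl linearD !linearZ /=.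
rewrite -[_ * X' i * g]mulrA X'g -scalerAr -scalerAl linearZ /= -[_ * _ * X' i ^+ b]mulrA -[g * _ * _]mulrA -exprS.
rewrite [X i ^+ a.+1 * (g * _)]mulrA -(mulrA _ (Y i)).
have [<-|/eqP ab] := eqVneq a b; last first.
  by rewrite (phiX0 i_n Hg) ?(phiX0 i_n HBYg)//; [rewrite !mulr0 addr0|lia].
(* [phi_Y] does not apply to [Y i] enclosed by outer letters; the value is extracted from the action
   of the central [Y i.+1] on the whole word. *)
have phiYg : q * phi (X i ^+ a * (Y i * g) * X' i ^+ a) =
    (phi_Y_coef i.+1 (a + a + e) - q ^- e * phi_ratio i a e) * phi (X i ^+ a * g * X' i ^+ a).
  apply: (addrI (q ^- e * (phi (X i ^+ a.+1 * g * X' i ^+ a.+1)))).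
  have := congr1 phi (YS_word a a i_n X'g); rewrite linearD !linearZ /= => <-.
  by rewrite (phi_Y _ (graded_mono a a Hg))// (phiX _ i_n Hg) mulrA -mulrDl addrC subrK.
rewrite (mulrAC q) phiYg (phiX _ i_n Hg) (mulrAC _ (phi _)) !mulrA -mulrDl; congr (_ * _).
rewrite /phi_Y_coef /phi_ratio GS !invfM Ginv -?exprM.
have -> : (2 * n + o + (a + a + e) = 2 * n + o + e + 2 * a)%N by lia.
have := qN_neq0 (e + 2 * a); rewrite addnA.
move: (1 - q ^- (2 * n + _ + _ + _)) => D D_neq0.
by expq; field; nz; rewrite D_neq0.
Qed.

(** * The star and its compatibility with the functional *)

Variables (cj : {rmorphism F -> F}) (st : L -> L).
Hypothesis cjq : cj q = q.
Hypothesis cjG : forall i, cj (G i) = G i.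
Hypothesis cjK : cj K = K.
Hypothesis cjc0 : cj c0 = c0.
Hypothesis stD : forall c a b, st (c *: a + b) = cj c *: st a + st b.
Hypothesis stM : forall a b, st (a * b) = st b * st a.
Hypothesis stinv : involutive st.
Hypothesis st1 : st 1 = 1.
Hypothesis stX : forall i, (i < n)%N -> st (X i) = (G i)^-1 *: X' i.
Hypothesis stX' : forall i, (i < n)%N -> st (X' i) = G i *: X i.
Hypothesis stXm : st Xm = Xm.
Hypothesis phiXm_real : forall d, cj (phi (Xm ^+ d)) = phi (Xm ^+ d).

Lemma st0 : st 0 = 0.
Proof.
have := stD 1 0 0; rewrite rmorph1 !scale1r add0r => /eqP.
by rewrite -subr_eq0 opprD addrA subrr sub0r oppr_eq0 => /eqP.
Qed.

Lemma stZ c a : st (c *: a) = cj c *: st a.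
Proof. by rewrite -[c *: a]addr0 stD st0 addr0. Qed.

Lemma stA a b : st (a + b) = st a + st b.
Proof. by rewrite -[a]scale1r stD rmorph1 !scale1r. Qed.

Lemma st_exp a k : st (a ^+ k) = st a ^+ k.
Proof. by elim: k => [|k IHk]; rewrite ?expr0// exprS stM IHk -exprSr. Qed.

Lemma stY i : (i <= n)%N -> st (Y i) = Y i.
Proof.
elim: i => [|i IHi] i_n; first by rewrite /Y stZ cjc0 st_exp stXm.
rewrite [Y i.+1]/= stA stM stX// stX'// -scalerAl -scalerAr scalerA mulfV//.
by rewrite scale1r stZ cjq IHi// ltnW.
Qed.

Lemma st_mono i a b g : (i < n)%N ->
  st (X i ^+ a * g * X' i ^+ b) = (G i ^+ b / G i ^+ a) *: (X i ^+ b * st g * X' i ^+ a).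
Proof.
move=> i_n; rewrite !stM !st_exp stX// stX'// !exprZn -!scalerAl -!scalerAr scalerA.
by rewrite exprVn mulrA.
Qed.

Lemma st_graded i d g : (i <= n)%N -> graded i d g -> graded i d (st g).
Proof.
elim: i d g => [|i IHi] d g i_n.
  by move=> [c ->]; exists (cj c); rewrite stZ st_exp stXm.
elim/graded_ind => {g} [|p r Hp Hr|c p Hp|a b e g -> Hg].
- by rewrite st0; apply: graded0.
- by rewrite stA; apply: gradedD.
- by rewrite stZ; apply: gradedZ.
rewrite st_mono//; apply: gradedZ; rewrite (addnC a); apply: graded_mono.
by apply: IHi => //; apply: ltnW.
Qed.

Lemma cj_phi_ratio i a d : cj (phi_ratio i a d) = phi_ratio i a d.
Proof.
by rewrite /phi_ratio !(rmorphM, rmorphB, rmorph1, fmorphV, rmorphXn) /= cjq cjG cjK.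
Qed.

(** The star swaps the two outer exponents, so only words with equal exponents matter. For these the
    scalar of [st_mono] is 1, and [cj] fixes the coefficients of the recursion. *)
Lemma phi_st i d p : (i <= n)%N -> graded i d p -> phi (st p) = cj (phi p).
Proof.
elim: i d p => [|i IHi] d p i_n.
  by move=> [c ->]; rewrite stZ st_exp stXm !linearZ /= rmorphM phiXm_real.
elim/graded_ind => {p} [|p r Hp Hr|c p Hp|a b e g _ Hg].
- by rewrite st0 linear0 rmorph0.
- by rewrite stA !linearD rmorphD /= Hp Hr.
- by rewrite stZ !linearZ rmorphM /= Hp.
have stHg := st_graded (ltnW i_n) Hg.
rewrite st_mono// linearZ /=.
have [<-|/eqP ab] := eqVneq a b; last first.
  rewrite (phiX0 i_n Hg)// (phiX0 i_n stHg) ?mulr0 ?rmorph0//; exact: nesym.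
rewrite mulfV ?expf_neq0// mul1r.
elim: a => [|a IHa].
  by rewrite !expr0 !mul1r !mulr1; apply: IHi Hg; apply: ltnW.
by rewrite (phiX _ i_n Hg) (phiX _ i_n stHg) rmorphM cj_phi_ratio IHa.
Qed.

(** * Values of the functional on words and test products *)

Lemma phi_XX_eq0 i e h a b : (i < n)%N -> graded i e h -> phi h = 0 ->
  phi (X i ^+ a * h * X' i ^+ b) = 0.
Proof.
move=> i_n Hh h0; have [<-|/eqP ab] := eqVneq a b; last exact: (phiX0 i_n Hh).
elim: a => [|a IHa]; first by rewrite !expr0 mul1r mulr1.
by rewrite (phiX _ i_n Hh) IHa mulr0.
Qed.

Lemma phi_YXX_eq0 i e h a b k : (i < n)%N -> graded i e h -> a <> b \/ phi h = 0 ->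
  phi (Y i.+1 ^+ k * (X i ^+ a * h * X' i ^+ b)) = 0.
Proof.
move=> i_n Hh ab; rewrite (phi_YX _ _ (graded_mono a b Hh))//.
by case: ab => [ab|h0]; rewrite ?(phiX0 i_n Hh ab) ?(phi_XX_eq0 _ _ i_n Hh h0) mulr0.
Qed.

Lemma phi_YXX_neq0 i e h a : (i < n)%N -> graded i e h -> phi h != 0 ->
  phi (X i ^+ a * h * X' i ^+ a) != 0.
Proof.
move=> i_n Hh h0; elim: a => [|a IHa]; first by rewrite !expr0 mul1r mulr1.
by rewrite (phiX _ i_n Hh) mulf_neq0// phi_ratio_neq0.
Qed.

(** Trades one [Y i.+1] for a pair [X i], [X' i]. In the quotient of [phi_Y_coef] by [phi_ratio]
    everything involving [n] and [K] cancels, and $G_i^2$ leaves $q^{2i+o}$. *)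
Lemma phi_YXX_shift i e h a k : (i < n)%N -> graded i e h ->
  phi (Y i.+1 ^+ k.+1 * (X i ^+ a * h * X' i ^+ a)) =
  q ^+ (2 * i + o) * (1 - q ^- (2 * i.+1 + o + e + 2 * a)) / (1 - q ^- (2 * a.+1)) *
  phi (Y i.+1 ^+ k * (X i ^+ a.+1 * h * X' i ^+ a.+1)).
Proof.
move=> i_n Hh; elim: k => [|k IHk].
  rewrite expr1 expr0 mul1r (phi_Y _ (graded_mono a a Hh))// (phiX _ i_n Hh).
  rewrite mulrA; congr (_ * _); rewrite /phi_Y_coef /phi_ratio GS !invfM Ginv.
  have := qN_neq0 (e + 2 * a); rewrite addnA.
  have -> : (2 * n + o + (a + a + e) = 2 * n + o + e + 2 * a)%N by lia.
  have -> : (2 * i.+1 + o + (a + a + e) = 2 * i.+1 + o + e + 2 * a)%N by lia.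
  have : 1 - q ^- (2 * a.+1) != 0 by apply: qVX_neq1.
  move: (1 - q ^- (2 * n + _ + _ + _)) (1 - q ^- (2 * i.+1 + _ + _ + _)) (1 - q ^- (2 * a.+1)).
  by move=> D D1 D2 D2_neq0 D_neq0; field; nz; rewrite D_neq0 D2_neq0.
rewrite (exprS _ k.+1) -mulrA (phi_Y _ (graded_YX k.+1 _ (graded_mono a a Hh)))// IHk.
rewrite (exprS (Y i.+1) k) -(mulrA (Y i.+1)) (phi_Y _ (graded_YX k _ (graded_mono a.+1 a.+1 Hh)))//.
by rewrite mulrCA; congr (_ * (phi_Y_coef _ _ * _)); lia.
Qed.

Lemma exprB_div m M : (m <= M)%N -> q ^+ m / q ^+ M = q ^- (M - m).
Proof. by move=> mM; rewrite -{1}(subnK mM) exprD invfM mulrCA mulfV ?expf_neq0// mulr1. Qed.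

Lemma phi_YXX_shifts i e h a k : (i < n)%N -> graded i e h -> (k <= a)%N ->
  phi (Y i.+1 ^+ k * (X i ^+ (a - k) * h * X' i ^+ (a - k))) =
  \prod_(s < k) (q ^+ (2 * i + o) * (1 - q ^+ (2 * s) / q ^+ (2 * i + o + e + 2 * a))
                / (1 - q ^+ (2 * s) / q ^+ (2 * a))) *
  phi (X i ^+ a * h * X' i ^+ a).
Proof.
move=> i_n Hh; suff shift j : (k <= a)%N ->
  phi (Y i.+1 ^+ (k + j) * (X i ^+ (a - k) * h * X' i ^+ (a - k))) =
  \prod_(s < k) (q ^+ (2 * i + o) * (1 - q ^+ (2 * s) / q ^+ (2 * i + o + e + 2 * a))
                / (1 - q ^+ (2 * s) / q ^+ (2 * a))) *
  phi (Y i.+1 ^+ j * (X i ^+ a * h * X' i ^+ a)).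
  by move=> /(shift 0); rewrite addn0 expr0 mul1r.
elim: k j => [|k IHk] j k_a; first by rewrite big_ord0 mul1r subn0.
rewrite addSn (phi_YXX_shift _ _ i_n Hh) -subSn// subSS IHk; last by lia.
rewrite big_ord_recr /= mulrA; congr (_ * _); rewrite mulrC; congr (_ * (_ * _ / _)).
  by rewrite exprB_div; [congr (1 - q ^- _)|]; lia.
by rewrite exprB_div; [congr (1 - q ^- _)|]; lia.
Qed.

Lemma graded_XX i d1 d2 f1 f2 a b : (i < n)%N -> graded i d1 f1 -> graded i d2 f2 ->
  f1 * (X i ^+ a * X' i ^+ b) * f2 =
  (q ^- (d1 * a) * q ^- (d2 * b)) *: (X i ^+ a * (f1 * f2) * X' i ^+ b).
Proof.
move=> i_n Hf1 Hf2.
have f1X : f1 * X i ^+ a = q ^- (d1 * a) *: (X i ^+ a * f1).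
  by rewrite (graded_commX _ i_n Hf1) scalerA mulVf ?expf_neq0// scale1r.
rewrite mulrA f1X -!scalerAl -[_ * _ * f2]mulrA (X'exp_graded _ i_n Hf2) -scalerAr scalerA.
by rewrite !mulrA.
Qed.

Lemma phi_cyclicX i d p a : (i < n)%N -> graded i.+1 d p ->
  phi (X' i ^+ a * p) = q ^+ ((2 * i + o) * a) * phi (p * X' i ^+ a).
Proof.
move=> i_n; elim: a d p => [|a IHa] d p Hp; first by rewrite muln0 !expr0 !mul1r mulr1.
have HX' : graded i.+1 1 (X' i).
  by have := graded_mono 0 1 (graded1 i); rewrite expr0 expr1 !mul1r.
rewrite exprSr -mulrA (IHa _ _ (gradedM i_n HX' Hp)).
have HX'a : graded i.+1 (0 + a + 0) (X' i ^+ a).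
  by have := graded_mono 0 a (graded1 i); rewrite expr0 !mul1r.
rewrite -mulrA (phi_cyclic i_n (gradedM i_n Hp HX'a)) mulrA -exprD -mulrA -exprSr.
by rewrite mulnS addnC.
Qed.

(** Brings a test product into the shape on which [phi] is known. As [A] or [B] is 0, a single power
    has to be moved: [X i ^+ B] to the left past [f1], or [X' i ^+ A] to the left past [f1] and then
    cyclically to the right end. *)
Lemma phi_test i l1 l2 f1 f2 A B a b t k : (i < n)%N -> graded i l1 f1 -> graded i l2 f2 ->
  A = 0%N \/ B = 0%N ->
  phi (f1 * (X i ^+ B * X' i ^+ A) * Y i ^+ t * (Y i.+1 ^+ k * X i ^+ a * X' i ^+ b * f2)) =
  q ^+ ((l1 + (2 * i + o)) * A) * q ^- (l1 * B) * q ^- ((l1 + 2 * t) * a) * q ^- (l2 * b)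
  * phi (Y i.+1 ^+ k * (X i ^+ (a + B) * (f1 * Y i ^+ t * f2) * X' i ^+ (b + A))).
Proof.
move=> i_n Hf1 Hf2 AB; have i_n' := ltnW i_n.
have HYt : graded i (2 * t) (Y i ^+ t) by have := graded_YX t i_n' (graded1 i); rewrite mulr1 addn0.
have Hf1Y := gradedM i_n' Hf1 HYt.
have Ycomm d p : graded i.+1 d p -> p * Y i.+1 ^+ k = Y i.+1 ^+ k * p.
  by move=> Hp; apply/commrX/commr_sym/(Y_comm _ Hp).
have HfXX : graded i.+1 (l1 + (B + A + 0)) (f1 * (X i ^+ B * X' i ^+ A)).
  apply: gradedM => //; first exact: graded_up.
  by have := graded_mono B A (graded1 i); rewrite mulr1.
have -> : f1 * (X i ^+ B * X' i ^+ A) * Y i ^+ t * (Y i.+1 ^+ k * X i ^+ a * X' i ^+ b * f2) =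
    Y i.+1 ^+ k * (f1 * (X i ^+ B * X' i ^+ A) * Y i ^+ t * (X i ^+ a * X' i ^+ b) * f2).
  by rewrite 2!mulrA mulrA (Ycomm _ _ (gradedM i_n HfXX (graded_up HYt))) !mulrA.
case: AB => [A0|B0]; [rewrite {}A0|rewrite {}B0].
  have f1X : f1 * X i ^+ B = q ^- (l1 * B) *: (X i ^+ B * f1).
    by rewrite (graded_commX _ i_n Hf1) scalerA mulVf ?expf_neq0// scale1r.
  rewrite muln0 !expr0 mul1r mulr1 addn0 f1X -!scalerAl -!scalerAr linearZ /= -!mulrA.
  congr (_ * _); rewrite !mulrA.
  have -> : Y i.+1 ^+ k * X i ^+ B * f1 * Y i ^+ t * X i ^+ a * X' i ^+ b * f2 =
      Y i.+1 ^+ k * (X i ^+ B * (f1 * Y i ^+ t * (X i ^+ a * X' i ^+ b) * f2)).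
    by rewrite !mulrA.
  rewrite (graded_XX a b i_n Hf1Y Hf2) -!scalerAr linearZ /=; congr (_ * phi _).
  by rewrite addnC exprD !mulrA.
rewrite muln0 !expr0 invr1 mul1r mulr1 addn0 (graded_commX' A i_n Hf1) -!scalerAl -scalerAr linearZ /=.
have -> : Y i.+1 ^+ k * (X' i ^+ A * f1 * Y i ^+ t * (X i ^+ a * X' i ^+ b) * f2) =
    Y i.+1 ^+ k * X' i ^+ A * (f1 * Y i ^+ t * (X i ^+ a * X' i ^+ b) * f2).
  by rewrite !mulrA.
rewrite (graded_XX a b i_n Hf1Y Hf2) -scalerAr linearZ /=.
set W := X i ^+ a * _ * _.
have HW : graded i.+1 (a + b + (l1 + 2 * t + l2)) W by apply/graded_mono/gradedM.
have -> : Y i.+1 ^+ k * X' i ^+ A * W = X' i ^+ A * (Y i.+1 ^+ k * W).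
  by rewrite mulrA; congr (_ * _); apply/commr_sym/commrX/commr_sym/commrX/YS_commX'.
rewrite (phi_cyclicX _ i_n (graded_YX k i_n HW)).
have -> : Y i.+1 ^+ k * W * X' i ^+ A = Y i.+1 ^+ k * (X i ^+ a * (f1 * Y i ^+ t * f2) * X' i ^+ (b + A)).
  by rewrite /W exprD !mulrA.
by rewrite [((l1 + _) * A)%N]mulnDl (exprD q (l1 * A)); ring.
Qed.

Lemma phi_fYf i l1 l2 f1 f2 t : (i < n)%N -> graded i l1 f1 -> graded i l2 f2 ->
  phi (f1 * Y i ^+ t * f2) = (\prod_(s < t) phi_Y_coef i (2 * s + (l1 + l2))) * phi (f1 * f2).
Proof.
move=> i_n Hf1 Hf2; have i_n' := ltnW i_n.
have -> : f1 * Y i ^+ t = Y i ^+ t * f1 by apply/commrX/commr_sym/(Y_comm i_n' Hf1).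
by rewrite -mulrA (phi_YX _ i_n' (gradedM i_n' Hf1 Hf2)).
Qed.

Lemma fYf_graded i l1 l2 f1 f2 t : (i < n)%N -> graded i l1 f1 -> graded i l2 f2 ->
  graded i (l1 + 2 * t + l2) (f1 * Y i ^+ t * f2).
Proof.
move=> i_n Hf1 Hf2; have i_n' := ltnW i_n.
have HYt : graded i (2 * t) (Y i ^+ t) by have := graded_YX t i_n' (graded1 i); rewrite mulr1 addn0.
by do 2?apply: gradedM.
Qed.

Lemma phi_testT i l1 l2 l f1 f2 A B a b t : (i < n)%N -> graded i l1 f1 -> graded i l2 f2 ->
  A = 0%N \/ B = 0%N ->
  phi (f1 * (X i ^+ B * X' i ^+ A) * Y i ^+ t * (tpol i a b l * f2)) =
  \sum_(k < (minn a b).+1) tcoef i a b l k *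
  (q ^+ ((l1 + (2 * i + o)) * A) * q ^- (l1 * B) * q ^- ((l1 + 2 * t) * (a - k)) * q ^- (l2 * (b - k))
  * phi (Y i.+1 ^+ k * (X i ^+ (a - k + B) * (f1 * Y i ^+ t * f2) * X' i ^+ (b - k + A)))).
Proof.
move=> i_n Hf1 Hf2 AB; rewrite mulr_suml mulr_sumr linear_sum /=; apply: eq_bigr => k _.
by rewrite -scalerAl -scalerAr linearZ /= (phi_test _ _ _ _ i_n Hf1 Hf2 AB).
Qed.

Lemma phi_testT_eq0 i l1 l2 l f1 f2 A B a b t : (i < n)%N -> graded i l1 f1 -> graded i l2 f2 ->
  A = 0%N \/ B = 0%N -> (a + B <> b + A)%N \/ phi (f1 * f2) = 0 ->
  phi (f1 * (X i ^+ B * X' i ^+ A) * Y i ^+ t * (tpol i a b l * f2)) = 0.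
Proof.
move=> i_n Hf1 Hf2 AB ab; rewrite (phi_testT l a b t i_n Hf1 Hf2 AB) big1// => k _.
rewrite (phi_YXX_eq0 k i_n (fYf_graded t i_n Hf1 Hf2)) ?mulr0//.
case: ab => [ab|f0]; [left|right].
  by have := ltn_ord k; lia.
by rewrite (phi_fYf t i_n Hf1 Hf2) f0 mulr0.
Qed.

Lemma qq_neq0 m M : (m < M)%N -> 1 - q ^+ m / q ^+ M != 0.
Proof. by move=> mM; rewrite (exprB_div (ltnW mM)); apply: qVX_neq1; rewrite subn_gt0. Qed.

Lemma min_max_mul (g : nat -> F) a b : g a * g b = g (minn a b) * g (maxn a b).
Proof. by case: (leqP a b) => // _; rewrite mulrC. Qed.

(* The sum over the terms of [t] is a terminating 2phi1 of base q^2 with argument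
   [q^(2t+2)]; the factor with [t + 1 + s = c] on the right is 0 when [t < c]. *)
Lemma phi_testT_val i l f1 f2 a b t (c := minn a b) : (i < n)%N -> graded i l f1 -> graded i l f2 ->
  phi (f1 * (X i ^+ (b - c) * X' i ^+ (a - c)) * Y i ^+ t * (tpol i a b l * f2))
    * \prod_(s < c) (1 - q ^+ (2 * s.+1) / q ^+ (2 * i + o + 2 * (a + b + l))) =
  q ^+ ((l + (2 * i + o)) * (a - c)) * q ^- (l * (b - c)) * q ^- ((l + 2 * t) * a) * q ^- (l * b)
  * phi (X i ^+ maxn a b * (f1 * Y i ^+ t * f2) * X' i ^+ maxn a b)
  * \prod_(s < c) (1 - q ^+ (2 * (t.+1 + s)) / q ^+ (2 * c)).
Proof.
move=> i_n Hf1 Hf2; rewrite (phi_testT l a b t i_n Hf1 Hf2); last by rewrite /c; lia.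
have HfYfB := fYf_graded t i_n Hf1 Hf2.
set M := maxn a b.
(* [B0] is read off from the numerators in [phi_YXX_shifts]; the lower parameter [B0 * Z] then has
   to give the last denominator of [tcoef_ratio] ([BZ]), which fixes [Z]. *)
pose u := q ^+ 2; pose B0 := q ^- (2 * i + o + 2 * l + 2 * t + 2 * M).
have [Z ZE] : exists Z, Z = q ^+ (2 * t.+1) / q ^+ (2 * c) by eexists.
have uE s : u ^+ s = q ^+ (2 * s) by rewrite exprM.
have uX_neq1 k : u ^+ k.+1 != 1 by rewrite uE mulnS; exact: qX_neq1.
have BZ s : 1 - B0 * Z * u ^+ s = 1 - q ^+ (2 * s.+1) / q ^+ (2 * i + o + 2 * (a + b + l)).
  have -> : (a + b = M + c)%N by rewrite /M /c; lia.
  by rewrite /B0 ZE uE; congr (1 - _); expq; field; nz.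
have BZ_neq0 s : (s < c)%N -> 1 - B0 * Z * u ^+ s != 0.
  by move=> sc; rewrite BZ qq_neq0//; rewrite /c in sc; lia.
have -> : \prod_(s < c) (1 - q ^+ (2 * s.+1) / q ^+ (2 * i + o + 2 * (a + b + l))) =
    \prod_(s < c) (1 - B0 * Z * u ^+ s) by apply: eq_bigr => s _; rewrite BZ.
have -> : \prod_(s < c) (1 - q ^+ (2 * (t.+1 + s)) / q ^+ (2 * c)) =
    \prod_(s < c) (1 - Z * u ^+ s).
  by apply: eq_bigr => s _; rewrite uE ZE mulnDr exprD mulrAC.
rewrite -(qVandermonde uX_neq1 BZ_neq0) mulrA; congr (_ * _).
rewrite mulr_sumr; apply: eq_bigr => k _.
have kc : (k <= c)%N by rewrite -ltnS.
have kM : (k <= M)%N by rewrite /M; rewrite /c in kc; lia.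
have -> : (a - k + (b - c) = M - k)%N by rewrite /M; rewrite /c in kc *; lia.
have -> : (b - k + (a - c) = M - k)%N by rewrite /M; rewrite /c in kc *; lia.
rewrite (phi_YXX_shifts i_n HfYfB kM) !mulrA [RHS]mulrAC; congr (_ * _).
have -> : q ^- ((l + 2 * t) * a) = q ^- ((l + 2 * t) * (a - k)) * q ^- ((l + 2 * t) * k).
  by rewrite -invfM -exprD -mulnDr subnK//; rewrite /c in kc; lia.
have -> : q ^- (l * b) = q ^- (l * (b - k)) * q ^- (l * k).
  by rewrite -invfM -exprD -mulnDr subnK//; rewrite /c in kc; lia.
set x1 := q ^+ (_ * (a - c)); set x2 := q ^- (l * (b - c)).
set x3 := q ^- (_ * (a - k)); set x4 := q ^- (_ * (b - k)).

suff E : tcoef i a b l k * \prod_(s < k) (q ^+ (2 * i + o) * (1 - q ^+ (2 * s) / q ^+ (2 * i + o + (l + 2 * t + l) + 2 * M))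
                / (1 - q ^+ (2 * s) / q ^+ (2 * M))) = 
   q ^- ((l + 2 * t) * k) * q ^- (l * k) * \prod_(s < k) ((u ^+ c - u ^+ s) * (1 - B0 * u ^+ s)
       / ((1 - u ^+ s.+1) * (1 - B0 * Z * u ^+ s)) * Z).
  transitivity (x1 * x2 * x3 * x4 * (q ^- ((l + 2 * t) * k) * q ^- (l * k) * \prod_(s < k) ((u ^+ c - u ^+ s) * (1 - B0 * u ^+ s)
       / ((1 - u ^+ s.+1) * (1 - B0 * Z * u ^+ s)) * Z))); last by ring.
  by rewrite -E; ring.
have -> : q ^- ((l + 2 * t) * k) * q ^- (l * k) = \prod_(s < k) (q ^- (l + 2 * t) * q ^- l).
  by rewrite prodr_const card_ord exprMn !exprVn -!exprM.
rewrite /tcoef -!big_split /=; apply: eq_bigr => s _; rewrite /tcoef_ratio BZ uE.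
have sc : (s < c)%N by have := ltn_ord s; lia.
have sM : 1 - q ^+ (2 * s) / q ^+ (2 * M) != 0.
  by apply: qq_neq0; rewrite /M; rewrite /c in sc; lia.
(* Of the factors for [a] and [b], the one at the maximum [M] cancels the denominator from
   [phi_YXX_shifts], and the one at the minimum [c] is the terminating factor of the sum. *)
have : (1 - q ^+ (2 * s) / q ^+ (2 * a)) * (1 - q ^+ (2 * s) / q ^+ (2 * b)) =
   (1 - q ^+ (2 * s) / q ^+ (2 * c)) * (1 - q ^+ (2 * s) / q ^+ (2 * M)).
  exact: (min_max_mul (fun m => 1 - q ^+ (2 * s) / q ^+ (2 * m))).
rewrite -[_ / _ * (1 - _ / q ^+ (2 * a)) * _]mulrA => ->.
have : 1 - q ^+ (2 * s.+1) != 0 by rewrite -opprB oppr_eq0; apply: qnX_neq1.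
have := BZ_neq0 s sc; rewrite BZ !uE.
move: (1 - _ / q ^+ (2 * i + o + 2 * (a + b + l))) (1 - q ^+ (2 * s.+1)) sM.
move: (1 - _ / q ^+ (2 * M)) => d0 d1 d2 d0_neq0 d1_neq0 d2_neq0.
have -> : 1 - q ^+ (2 * s) / q ^+ (2 * i + o + (l + 2 * t + l) + 2 * M) = 1 - B0 * q ^+ (2 * s).
  by rewrite /B0 mulrC; congr (1 - q ^- _ * _); lia.
move: (1 - B0 * _) => d3; rewrite ZE.
by expq; field; nz; rewrite d0_neq0 d1_neq0 d2_neq0.
Qed.

Lemma phi_testT_lt i l f1 f2 a b t (c := minn a b) : (i < n)%N -> graded i l f1 -> graded i l f2 ->
  (t < c)%N ->
  phi (f1 * (X i ^+ (b - c) * X' i ^+ (a - c)) * Y i ^+ t * (tpol i a b l * f2)) = 0.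
Proof.
move=> i_n Hf1 Hf2 tc; have := phi_testT_val a b t i_n Hf1 Hf2; rewrite -/c.
have ct : (c - t.+1 < c)%N by lia.
rewrite [X in _ = _ * X](bigD1 (Ordinal ct))//= (_ : t.+1 + (c - t.+1) = c)%N; last by lia.
rewrite mulfV ?expf_neq0// subrr mul0r mulr0 => /eqP.
rewrite mulf_eq0 => /orP[/eqP //|]; rewrite prodf_seq_eq0 => /hasP[s _ /=].
by apply: contraTeq => _; apply: qq_neq0; have := ltn_ord s; lia.
Qed.

(** For [t = c] the product in [phi_testT_val] has the nonzero factors $1-q^{2(s+1)}$. The condition
    [0 < 2 * i + o] keeps [phi_Y_coef] from vanishing in degree 0. *)
Lemma phi_testT_neq0 i l f1 f2 a b (c := minn a b) : (0 < 2 * i + o)%N ->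
  (i < n)%N -> graded i l f1 -> graded i l f2 -> phi (f1 * f2) != 0 ->
  phi (f1 * (X i ^+ (b - c) * X' i ^+ (a - c)) * Y i ^+ c * (tpol i a b l * f2)) != 0.
Proof.
move=> io i_n Hf1 Hf2 f_neq0; have := phi_testT_val a b c i_n Hf1 Hf2; rewrite -/c => Teq.
apply/eqP => T0; move/esym/eqP: Teq; rewrite T0 mul0r; apply/negP.
rewrite mulf_neq0//; last first.
  apply/prodf_neq0 => s _; rewrite addSn -addnS mulnDr exprD mulrAC mulfV ?expf_neq0// mul1r.
  by rewrite -opprB oppr_eq0; apply: qnX_neq1.
rewrite !mulf_neq0 ?invr_neq0 ?expf_neq0//.
apply: (phi_YXX_neq0 _ i_n (fYf_graded c i_n Hf1 Hf2)).
rewrite (phi_fYf c i_n Hf1 Hf2) mulf_neq0//; apply/prodf_neq0 => s _.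
by apply: phi_Y_coef_neq0; lia.
Qed.

(** * Orthogonality at one level *)

(* Terms of degree less than [c] in [Y i]. *)
Definition lower i c w : L -> Prop :=
  lspan (fun p => exists2 t, (t < c)%N & p = Y i.+1 ^+ (c - t) * Y i ^+ t * w).

Lemma lower_YS i c w p : lower i c w p -> lower i c.+1 w (Y i.+1 * p).
Proof.
elim=> {p} [p [t tc ->]||p r _ Hp _ Hr|x p _ Hp].
- by apply: lspan_mem; exists t; [lia|rewrite !mulrA -exprS subSn// ltnW].
- by rewrite mulr0; apply: lspan0.
- by rewrite mulrDr; apply: lspanD.
- by rewrite -scalerAr; apply: lspanZ.
Qed.

Lemma lower_YSX i c w p m : lower i c w p -> lower i (m + c) w (Y i.+1 ^+ m * p).
Proof.
move=> Hp; elim: m => [|m IHm]; first by rewrite expr0 mul1r.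
by rewrite exprS -mulrA addSn; apply: lower_YS.
Qed.

Lemma YY_comm i : (i < n)%N -> GRing.comm (Y i.+1) (Y i).
Proof. by move=> i_n; apply: (Y_comm i_n (graded_up (Y_graded i))). Qed.

Lemma lower_Y i c w p : (i < n)%N -> lower i c w p -> lower i c.+1 w (Y i * p).
Proof.
move=> i_n; elim=> {p} [p [t tc ->]||p r _ Hp _ Hr|x p _ Hp].
- apply: lspan_mem; exists t.+1; rewrite // subSS exprS !mulrA; congr (_ * _ * _).
  exact/commrX/commr_sym/YY_comm.
- by rewrite mulr0; apply: lspan0.
- by rewrite mulrDr; apply: lspanD.
- by rewrite -scalerAr; apply: lspanZ.
Qed.

(** Each adjacent [X i * X' i] is [Y i.+1 - q *: Y i]. Taking the second term every time gives the
    only multiple of [Y i ^+ s], and its coefficient is a power of [q] up to sign. *)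
Lemma XX_lead i A B s : (i < n)%N -> exists2 k, k != 0 &
  lower i s (X i ^+ A * X' i ^+ B)
    (X i ^+ (A + s) * X' i ^+ (B + s) - k *: (Y i ^+ s * (X i ^+ A * X' i ^+ B))).
Proof.
move=> i_n; elim: s => [|s [k k_neq0 IHs]].
  exists 1; rewrite ?oner_neq0// !addn0 expr0 mul1r scale1r subrr; exact: lspan0.
set w := X i ^+ A * X' i ^+ B in IHs *; set W := X i ^+ (A + s) * X' i ^+ (B + s) in IHs.
(* The power $q^{2(A+s)}$ comes from moving [Y i] to the left past [X i ^+ (A + s)]. *)
pose e := q * q ^+ (2 * (A + s)); exists (- e * k).
  by rewrite mulf_neq0// oppr_eq0 mulf_neq0// expf_neq0.
have -> : X i ^+ (A + s.+1) * X' i ^+ (B + s.+1) = Y i.+1 * W - e *: (Y i * W).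
  rewrite !addnS exprSr exprS mulrA -[_ * X i * X' i]mulrA.
  have -> : X i * X' i = Y i.+1 - q *: Y i by rewrite [Y i.+1]/= addrK.
  rewrite mulrBr -scalerAr (graded_commX _ i_n (Y_graded i)) scalerA mulrBl -scalerAl -mulrA.
  by rewrite !mulrA; congr (_ * _ - _); apply/commr_sym/commrX/YS_commX.
set r := W - k *: (Y i ^+ s * w) in IHs.
have -> : W = r + k *: (Y i ^+ s * w) by rewrite subrK.
move: r IHs => r IHs.
rewrite !mulrDr scalerDr opprD -!scalerAr scalerA [Y i * (Y i ^+ s * w)]mulrA -exprS mulNr scaleNr opprK.
rewrite addrA subrK; apply: lspanD; last by rewrite -scaleNr; apply: lspanZ; exact: lower_Y.
apply: lspanD; first exact: lower_YS.
by apply: lspanZ; apply: lspan_mem; exists s; rewrite // subSnn expr1 mulrA.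
Qed.

(** Only the term [k = 0] of [tpol] contributes to the leading term: all others carry a factor
    [Y i.+1]. *)
Lemma tpol_lead i a b l (c := minn a b) : (i < n)%N -> exists2 k, k != 0 &
  lower i c (X i ^+ (a - c) * X' i ^+ (b - c))
    (tpol i a b l - k *: (Y i ^+ c * (X i ^+ (a - c) * X' i ^+ (b - c)))).
Proof.
move=> i_n; rewrite /tpol -/c big_ord_recl /= /tcoef big_ord0 scale1r expr0 mul1r !subn0.
have [k k_neq0 lead] := XX_lead (a - c) (b - c) c i_n.
exists k => //; rewrite addrAC; apply: lspanD.
  by rewrite !subnK in lead; rewrite /c; [exact: lead|lia|lia].
apply: lspan_sum => j _; apply: lspanZ.
have [k' _ lead'] := XX_lead (a - c) (b - c) (c - j.+1) i_n.
have jc : (j.+1 <= c)%N by have := ltn_ord j.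
rewrite /bump /= add1n -mulrA.
have <- : (a - c + (c - j.+1) = a - j.+1)%N by rewrite /c in jc *; lia.
have <- : (b - c + (c - j.+1) = b - j.+1)%N by rewrite /c in jc *; lia.
rewrite -[X i ^+ (_ + (c - j.+1)) * _](subrK (k' *: (Y i ^+ (c - j.+1) * (X i ^+ (a - c) * X' i ^+ (b - c))))).
rewrite mulrDr; apply: lspanD; last first.
  rewrite -scalerAr; apply: lspanZ; apply: lspan_mem; exists (c - j.+1)%N; first by lia.
  by rewrite subKn// !mulrA.
by have := lower_YSX j.+1 lead'; rewrite subnKC.
Qed.

Lemma phi_stC i l1 l2 p r : (i <= n)%N -> graded i l1 p -> graded i l2 r ->
  phi (st p * r) = cj (phi (st r * p)).
Proof.
move=> i_n Hp Hr; have stK : st (st p) = p by exact: stinv.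
by rewrite -(phi_st i_n (gradedM i_n (st_graded i_n Hr) Hp)) stM stinv.
Qed.

Lemma XX_graded i a b : graded i.+1 (a + b) (X i ^+ a * X' i ^+ b).
Proof. by have := graded_mono a b (graded1 i); rewrite mulr1 addn0. Qed.

Lemma tpol_graded i l a b : (i < n)%N -> graded i.+1 (a + b) (tpol i a b l).
Proof.
move=> i_n; rewrite /tpol; elim/big_ind: _ => [|p r|k _]; [exact: graded0|exact: gradedD|].
apply: gradedZ; rewrite -mulrA.
have -> : (a + b = 2 * k + (a - k + (b - k)))%N by have := ltn_ord k; lia.
by apply: graded_YX => //; apply: XX_graded.
Qed.

(** Powers of the self-adjoint central [Y i.+1] are scalars under [phi], by [phi_YX]; without them
    each lower term is one of the tests with [t < c]. *)
Lemma phi_lower0 i l1 l2 f1 v c A B p : (i < n)%N -> graded i l1 f1 -> graded i.+1 l2 v ->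
  (forall t, (t < c)%N -> phi (st f1 * (X i ^+ B * X' i ^+ A) * Y i ^+ t * v) = 0) ->
  lower i c (X i ^+ A * X' i ^+ B) p -> phi (st (p * f1) * v) = 0.
Proof.
move=> i_n Hf1 Hv test0; have stHf1 := st_graded (ltnW i_n) Hf1.
elim=> {p} [p [t tc ->]||p r _ Hp _ Hr|x p _ Hp].
- have HYt : graded i (2 * t) (Y i ^+ t) by have := graded_YX t (ltnW i_n) (graded1 i); rewrite mulr1 addn0.
  have HU' : graded i.+1 (l1 + (B + A) + 2 * t) (st f1 * (X i ^+ B * X' i ^+ A) * Y i ^+ t).
    apply: gradedM => //; last exact: graded_up.
    by apply: gradedM => //; [exact: graded_up|exact: XX_graded].
  have HU := gradedM i_n HU' Hv.
  rewrite -[_ * f1]mulrA -[_ * (_ * f1)]mulrA stM [st (Y i.+1 ^+ _)]st_exp stY//.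
  have -> : st (Y i ^+ t * (X i ^+ A * X' i ^+ B * f1)) =
      (G i ^+ B / G i ^+ A) *: (st f1 * (X i ^+ B * X' i ^+ A) * Y i ^+ t).
    have := st_mono A B 1 i_n; rewrite st1 !mulr1 => stXX.
    by rewrite stM stM stXX st_exp (stY (ltnW i_n)) -scalerAr -scalerAl.
  rewrite -!scalerAl linearZ /=.
  set U := _ * Y i ^+ t in HU' HU *.
  have -> : U * Y i.+1 ^+ (c - t) = Y i.+1 ^+ (c - t) * U.
    by apply/commrX/commr_sym/(Y_comm i_n HU').
  by rewrite -[Y i.+1 ^+ _ * U * v]mulrA (phi_YX _ i_n HU) test0// !mulr0.
- by rewrite mul0r st0 mul0r linear0.
- by rewrite mulrDl stA mulrDl linearD Hp Hr addr0.
- by rewrite -scalerAl stZ -scalerAl linearZ /= Hp mulr0.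
Qed.

Section Level.
Variables (i l1 l2 a1 b1 a2 b2 : nat) (f1 f2 : L).
Hypotheses (i_n : (i < n)%N) (Hf1 : graded i l1 f1) (Hf2 : graded i l2 f2).
Local Notation T1 := (tpol i a1 b1 l1 * f1).
Local Notation T2 := (tpol i a2 b2 l2 * f2).

Lemma tpol_mul_graded a b l d f : graded i d f -> graded i.+1 (a + b + d) (tpol i a b l * f).
Proof. by move=> Hf; apply: gradedM => //; [exact: tpol_graded|exact: graded_up]. Qed.

Lemma phi_TT_lead (c := minn a1 b1) : exists2 k, k != 0 & 
  (forall t, (t < c)%N ->
    phi (st f1 * (X i ^+ (b1 - c) * X' i ^+ (a1 - c)) * Y i ^+ t * T2) = 0) ->
  phi (st T1 * T2) =
  k * phi (st f1 * (X i ^+ (b1 - c) * X' i ^+ (a1 - c)) * Y i ^+ c * T2).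
Proof.
have [k k_neq0 lead] := tpol_lead a1 b1 l1 i_n; rewrite -/c in lead.
have HT2 := tpol_mul_graded a2 b2 l2 Hf2.
exists (cj k * (G i ^+ (b1 - c) / G i ^+ (a1 - c))).
  by rewrite !mulf_neq0 ?invr_neq0 ?expf_neq0// fmorph_eq0.
move=> test0; have := phi_lower0 i_n Hf1 HT2 test0 lead.
have := st_mono (a1 - c) (b1 - c) 1 i_n; rewrite st1 !mulr1 => stXX.
rewrite mulrBl stA mulrDl linearD /= -scalerAl -scaleNr stZ -scalerAl linearZ /=.
rewrite rmorphN mulNr => /eqP; rewrite subr_eq0 => /eqP ->.
rewrite stM stM stXX st_exp (stY (ltnW i_n)) -scalerAl -scalerAr -scalerAl linearZ /=.
by rewrite !mulrA.
Qed.

Lemma phi_TT_eq0 : phi (st f1 * f2) = 0 \/ (a1 + b2 <> a2 + b1)%N -> phi (st T1 * T2) = 0.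
Proof.
move=> f0; have [k _] := phi_TT_lead.
have test t : phi (st f1 * (X i ^+ (b1 - minn a1 b1) * X' i ^+ (a1 - minn a1 b1)) * Y i ^+ t * T2) = 0.
  apply: (phi_testT_eq0 _ _ i_n (st_graded (ltnW i_n) Hf1) Hf2); first by lia.
  by case: f0 => f0; [right|left; lia].
by rewrite test mulr0 => -> // t _; apply: test.
Qed.

End Level.

(** Both sides have the same [w], and $\min(a_1,b_1)<\min(a_2,b_2)$, so even the leading test of the
    left factor lies in the range where [phi_testT_lt] gives 0. *)
Lemma phi_TT_lt0 i l a1 b1 a2 b2 f : (i < n)%N -> graded i l f -> (a1 + b2 = a2 + b1)%N ->
  (a1 < a2)%N -> phi (st (tpol i a1 b1 l * f) * (tpol i a2 b2 l * f)) = 0.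
Proof.
move=> i_n Hf ab a12; have [k _] := phi_TT_lead a1 b1 a2 b2 i_n Hf Hf.
set c := minn a1 b1; have stHf := st_graded (ltnW i_n) Hf.
have -> : (a1 - c = a2 - minn a2 b2)%N by rewrite /c; lia.
have -> : (b1 - c = b2 - minn a2 b2)%N by rewrite /c; lia.
have test t : (t <= c)%N ->
    phi (st f * (X i ^+ (b2 - minn a2 b2) * X' i ^+ (a2 - minn a2 b2)) * Y i ^+ t * (tpol i a2 b2 l * f)) = 0.
  by move=> tc; apply: (phi_testT_lt i_n stHf Hf); rewrite /c in tc; lia.
by rewrite test// mulr0 => -> // t tc; rewrite test// ltnW.
Qed.

Lemma phi_TT_neq0 i l a b f : (0 < 2 * i + o)%N -> (i < n)%N -> graded i l f ->
  phi (st f * f) != 0 -> phi (st (tpol i a b l * f) * (tpol i a b l * f)) != 0.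
Proof.
move=> io i_n Hf f_neq0; have [k k_neq0] := phi_TT_lead a b a b i_n Hf Hf.
have stHf := st_graded (ltnW i_n) Hf.
move=> ->; first by rewrite mulf_neq0//; apply: (phi_testT_neq0 a b io i_n stHf Hf f_neq0).
by move=> t tc; apply: (phi_testT_lt i_n stHf Hf tc).
Qed.

(** When the differences of exponents agree, the hermitian symmetry [phi_stC] allows the smaller
    exponents to be put on the left. *)
Lemma phi_TT_diff i l a1 b1 a2 b2 f : (i < n)%N -> graded i l f -> (a1, b1) <> (a2, b2) ->
  phi (st (tpol i a1 b1 l * f) * (tpol i a2 b2 l * f)) = 0.
Proof.
move=> i_n Hf ab; have [abE|/eqP abN] := eqVneq (a1 + b2)%N (a2 + b1)%N; last first.
  by apply: (phi_TT_eq0 i_n Hf Hf); right.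
have [a12|a21|a12] := ltngtP a1 a2; first exact: phi_TT_lt0.
  have HT a b : graded i.+1 (a + b + l) (tpol i a b l * f) by apply: tpol_mul_graded.
  by rewrite (phi_stC i_n (HT _ _) (HT _ _)) phi_TT_lt0 ?rmorph0//; lia.
by case: ab; congr (_, _); lia.
Qed.

(** * The basis of harmonic elements *)

Section Families.
Variables (b : nat) (T0 : Type) (v0 : T0 -> L) (deg0 : T0 -> nat).
Hypothesis b_gt0 : (0 < 2 * b + o)%N.
Hypothesis v0_graded : forall z, graded b (deg0 z) (v0 z).
Hypothesis Delta_v0 : forall z, Delta (v0 z) = 0.
Hypothesis phi_v0_eq0 : forall z z', z <> z' -> phi (st (v0 z) * v0 z') = 0.
Hypothesis phi_v0_neq0 : forall z, phi (st (v0 z) * v0 z) != 0.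
Hypothesis v0_span : forall d p, graded b d p ->
  lspan (fun p => exists k z, d = (2 * k + deg0 z)%N /\ p = Y b ^+ k * v0 z) p.

Definition xi_degree (r : seq (nat * nat)) z : nat := (sumn [seq (x.1 + x.2)%N | x <- r] + deg0 z)%N.

(** The head of the list is the outermost pair, at level [b + size r']; the degree of the tail
    supplies the index [l] of [tpol]. The bottom level [b] will be 0 for odd and 1 for even [N]. *)
Fixpoint xi (r : seq (nat * nat)) z : L :=
  if r is (a, b') :: r' then tpol (b + size r') a b' (xi_degree r' z) * xi r' z else v0 z.

Lemma xi_degree_cons x r z : xi_degree (x :: r) z = (x.1 + x.2 + xi_degree r z)%N.
Proof. by rewrite /xi_degree /= addnA. Qed.

Lemma xi_graded r z : (b + size r <= n)%N -> graded (b + size r) (xi_degree r z) (xi r z).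
Proof.
elim: r => [|[a b'] r IHr] /=; first by rewrite addn0 => _; exact: v0_graded.
rewrite addnS => i_n; rewrite xi_degree_cons; apply: tpol_mul_graded => //.
by apply: IHr; exact: ltnW.
Qed.

Lemma Delta_xi r z : (b + size r <= n)%N -> Delta (xi r z) = 0.
Proof.
elim: r => [|[a b'] r IHr] /=; first by move=> _; exact: Delta_v0.
rewrite addnS => i_n; apply: Delta_tpol => //; last by apply: IHr; exact: ltnW.
by apply: xi_graded; exact: ltnW.
Qed.

Lemma phi_xi_eq0 r z r' z' : (b + size r <= n)%N -> size r = size r' ->
  (r, z) <> (r', z') -> phi (st (xi r z) * xi r' z') = 0.
Proof.
elim: r r' => [|[a1 b1] r IHr] [|[a2 b2] r'] //=.
  by move=> _ _ zz'; apply: phi_v0_eq0 => zE; apply: zz'; rewrite zE.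
rewrite addnS => i_n [sr] rz; rewrite -sr.
have Hr := xi_graded z (ltnW i_n).
have Hr' : graded (b + size r) (xi_degree r' z') (xi r' z') by rewrite sr in i_n *; apply/xi_graded/ltnW.
have [[rE zE]|rzN] := pselect ((r, z) = (r', z')); last first.
  by apply: (phi_TT_eq0 i_n Hr Hr'); left; apply: IHr => //; exact: ltnW.
rewrite -rE -zE; apply: phi_TT_diff => //.
by case=> aE bE; apply: rz; rewrite aE bE rE zE.
Qed.

Lemma phi_xi_neq0 r z : (b + size r <= n)%N -> phi (st (xi r z) * xi r z) != 0.
Proof.
elim: r => [|[a b'] r IHr] /=; first by move=> _; exact: phi_v0_neq0.
rewrite addnS => i_n; apply: phi_TT_neq0 => //; first by lia.
- by apply: xi_graded; exact: ltnW.
- by apply: IHr; exact: ltnW.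
Qed.

Definition YXi s d : L -> Prop :=
  lspan (fun p => exists k r z,
    [/\ size r = s, d = (2 * k + xi_degree r z)%N & p = Y (b + s) ^+ k * xi r z]).

Lemma YXi_Y s d p : YXi s d p -> YXi s (2 + d) (Y (b + s) * p).
Proof.
elim=> {p} [p [k [r [z [sr -> ->]]]]||p p' _ Hp _ Hp'|c p _ Hp].
- by apply: lspan_mem; exists k.+1, r, z; split=> //; [lia|rewrite exprS mulrA].
- by rewrite mulr0; apply: lspan0.
- by rewrite mulrDr; apply: lspanD.
- by rewrite -scalerAr; apply: lspanZ.
Qed.

Lemma YXi_YX s d p k : YXi s d p -> YXi s (2 * k + d) (Y (b + s) ^+ k * p).
Proof.
move=> Hp; elim: k => [|k IHk]; first by rewrite expr0 mul1r.
by rewrite exprS -mulrA mulnS -addnA; apply: YXi_Y.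
Qed.

(** The definition of [tpol] is solved for its term [k = 0]; the other terms have a smaller power of
    [X (b + s)] and a factor [Y (b + s).+1], which [YXi_YX] absorbs. *)
Lemma YXi_XX s r z a a' : (b + s < n)%N -> size r = s ->
  YXi s.+1 (a + a' + xi_degree r z) (X (b + s) ^+ a * X' (b + s) ^+ a' * xi r z).
Proof.
move=> i_n sr; move: {2}a (leqnn a) => m; elim: m a a' => [|m IHm] a a' am.
  apply: lspan_mem; exists 0%N, ((a, a') :: r), z.
  rewrite xi_degree_cons /= sr expr0 mul1r; split=> //.
  move: am; rewrite leqn0 => /eqP ->.
  by rewrite /tpol min0n big_ord1 /tcoef big_ord0 scale1r expr0 !subn0 !mul1r.
have -> : X (b + s) ^+ a * X' (b + s) ^+ a' =
  tpol (b + s) a a' (xi_degree r z) - \sum_(k < minn a a') tcoef (b + s) a a' (xi_degree r z) k.+1 *: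
     (Y (b + s).+1 ^+ k.+1 * X (b + s) ^+ (a - k.+1) * X' (b + s) ^+ (a' - k.+1)).
  by rewrite /tpol big_ord_recl /tcoef big_ord0 scale1r expr0 mul1r !subn0 addrK.
rewrite mulrBl -scaleN1r; apply: lspanD; last apply: lspanZ.
  apply: lspan_mem; exists 0%N, ((a, a') :: r), z.
  by rewrite xi_degree_cons /= sr expr0 mul1r.
rewrite mulr_suml; apply: lspan_sum => k _; rewrite -scalerAl; apply: lspanZ.
rewrite -!mulrA (mulrA (X _ ^+ _)) -addnS.
have -> : (a + a' + xi_degree r z = 2 * k.+1 + (a - k.+1 + (a' - k.+1) + xi_degree r z))%N.
  by have := ltn_ord k; lia.
by apply: YXi_YX; apply: IHm; have := ltn_ord k; lia.
Qed.

(** [YS_word], solved for its last term, trades an inner [Y (b + s)] for the central [Y (b + s).+1]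
    or for one more pair of outer letters. The outer exponents may grow, so the induction is on [k]
    with them free. *)
Lemma YXi_XYX s k r z a a' : (b + s < n)%N -> size r = s ->
  YXi s.+1 (a + a' + (2 * k + xi_degree r z))
    (X (b + s) ^+ a * (Y (b + s) ^+ k * xi r z) * X' (b + s) ^+ a').
Proof.
move=> i_n sr; have Hr := xi_graded z (_ : (b + size r <= n)%N).
have {}Hr : graded (b + s) (xi_degree r z) (xi r z) by rewrite -sr; apply: Hr; rewrite sr ltnW.
elim: k a a' => [|k IHk] a a'.
  rewrite expr0 mul1r -mulrA (graded_commX' _ i_n Hr) -scalerAr mulrA; apply: lspanZ.
  exact: YXi_XX.
set h := Y (b + s) ^+ k * xi r z in IHk.
have Hh : graded (b + s) (2 * k + xi_degree r z) h by apply: graded_YX => //; exact: ltnW.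
have := YS_word a a' i_n (X'_graded i_n Hh) => /(congr1 (fun p => q^-1 *: p)).
rewrite scalerDr !scalerA mulVf// scale1r => /esym/(canRL (addKr _)) XYhX.
rewrite (exprS _ k) -(mulrA (Y (b + s)) (Y (b + s) ^+ k)) -/h XYhX; apply: lspanD.
  rewrite -scaleN1r; do 2!apply: lspanZ.
  have -> : (a + a' + (2 * k.+1 + xi_degree r z) = a.+1 + a'.+1 + (2 * k + xi_degree r z))%N by lia.
  exact: IHk.
apply: lspanZ; rewrite -addnS.
have -> : (a + a' + (2 * k.+1 + xi_degree r z) = 2 + (a + a' + (2 * k + xi_degree r z)))%N by lia.
exact: YXi_Y.
Qed.

Lemma graded_YXi s d p : (b + s <= n)%N -> graded (b + s) d p -> YXi s d p.
Proof.
elim: s d p => [|s IHs] d p; rewrite ?addn0 ?addnS => i_n.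
  move=> /v0_span; apply: lspan_subset => {}p [k [z [-> ->]]].
  by apply: lspan_mem; exists k, [::], z; rewrite addn0.
elim/graded_ind => {p} [|p p' Hp Hp'|c p Hp|a a' e g -> Hg].
- exact: lspan0.
- exact: lspanD.
- exact: lspanZ.
have := IHs _ _ (ltnW i_n) Hg; elim=> {g Hg} [p [k [r [z [sr -> ->]]]]||p p' _ Hp _ Hp'|c p _ Hp].
- exact: YXi_XYX.
- by rewrite mulr0 mul0r; apply: lspan0.
- by rewrite mulrDr mulrDl; apply: lspanD.
- by rewrite -scalerAr -scalerAl; apply: lspanZ.
Qed.

(** Applying [Delta] gives a relation with one term fewer, whose entries are nonzero multiples of
    the [g k.+1] and hence again harmonic. *)
Lemma harmonic_free (g : nat -> L) (d : nat -> nat) m :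
  (forall k, graded n (d k) (g k) /\ Delta (g k) = 0) ->
  \sum_(k < m) Y n ^+ k * g k = 0 -> forall k, (k < m)%N -> g k = 0.
Proof.
elim: m g d => [//|m IHm] g d Hg gsum.
have gS k : (k < m)%N -> g k.+1 = 0.
  move=> km; have gF : Delta_YX_coef n k (d k.+1) *: g k.+1 = 0.
    apply: (IHm (fun k => Delta_YX_coef n k (d k.+1) *: g k.+1) (fun k => d k.+1)) => // [k'|].
      by have [gB Dg] := Hg k'.+1; rewrite linearZ /= Dg scaler0; split=> //; apply: gradedZ.
    have := congr1 Delta gsum; rewrite linear0 => Dsum; rewrite -[RHS]Dsum linear_sum /=.
    have [_ Dg0] := Hg 0%N; rewrite big_ord_recl expr0 mul1r [Delta (g _)]Dg0 add0r.
    apply: eq_bigr => k' _; rewrite lift0; have [gB Dg] := Hg k'.+1.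
    by rewrite (Delta_YX _ (leqnn n) gB) Dg mulr0 scaler0 add0r scalerAr.
  move/eqP: gF; rewrite scaler_eq0 => /orP[|/eqP //]; apply: contraTeq => _.
  by apply: Delta_YX_coef_neq0; lia.
case=> [_|k]; last exact: gS.
move: gsum; rewrite big_ord_recl expr0 mul1r big1 ?addr0// => k _.
by rewrite lift0 gS// mulr0.
Qed.

Lemma harmonic_span d p : (b <= n)%N -> graded n d p -> Delta p = 0 ->
  lspan (fun p => exists r z, [/\ (b + size r)%N = n, xi_degree r z = d & p = xi r z]) p.
Proof.
move=> b_n Hp Dp; have bn : (b + (n - b) = n)%N by exact: subnKC.
pose S k := lspan (fun p => exists r z,
  [/\ (b + size r)%N = n, (2 * k + xi_degree r z = d)%N & p = xi r z]).
have SH k g : S k g -> graded n (d - 2 * k) g /\ Delta g = 0.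
  elim=> {g} [g [r [z [rn dE ->]]]||g g' _ [HB HD] _ [HB' HD']|c g _ [HB HD]].
  - rewrite Delta_xi ?rn//; split=> //; have := xi_graded z (_ : (b + size r <= n)%N).
    by rewrite rn -dE addKn; apply.
  - by rewrite linear0; split=> //; apply: graded0.
  - by rewrite linearD HD HD' addr0; split=> //; apply: gradedD.
  - by rewrite linearZ /= HD scaler0; split=> //; apply: gradedZ.
(* The spanning set of [graded_YXi] is regrouped by the power of [Y n]; powers beyond [d] cannot
   occur because [2 * k <= d]. *)
have [g gS pE] : exists2 g, (forall k, S k (g k)) & p = \sum_(k < d.+1) Y n ^+ k * g k.
  have := @graded_YXi (n - b) d p; rewrite bn => /(_ (leqnn n) Hp).
  rewrite /YXi bn; elim=> {p Hp Dp} [p [k [r [z [rn dE ->]]]]||p p' _ [g gS ->] _ [g' gS' ->]|c p _ [g gS ->]].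
  - exists (fun j => if j == k then xi r z else 0) => [j|].
      case: eqP => [->|_]; last exact: lspan0.
      by apply: lspan_mem; exists r, z; split=> //; rewrite rn.
    have kd : (k < d.+1)%N by lia.
    rewrite (bigD1 (Ordinal kd))//= eqxx big1 ?addr0// => j /negbTE jk.
    by rewrite -val_eqE /= in jk; rewrite jk mulr0.
  - exists (fun=> 0) => [k|]; first exact: lspan0.
    by rewrite big1 => [|k _]; rewrite ?mulr0.
  - exists (fun k => g k + g' k) => [k|]; first by apply: lspanD; [exact: gS|exact: gS'].
    by rewrite -big_split; apply: eq_bigr => k _; rewrite mulrDr.
  - exists (fun k => c *: g k) => [k|]; first by apply: lspanZ; exact: gS.
    by rewrite scaler_sumr; apply: eq_bigr => k _; rewrite scalerAr.
have gH k := SH k _ (gS k).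
have gF : forall k, (k < d)%N -> Delta_YX_coef n k (d - 2 * k.+1) *: g k.+1 = 0.
  apply: (harmonic_free (d := fun k => (d - 2 * k.+1)%N)) => [k|].
    have [gB Dg] := gH k.+1; rewrite linearZ /= Dg scaler0; split=> //; exact: gradedZ.
  rewrite -[RHS]Dp pE linear_sum /= big_ord_recl expr0 mul1r.
  have [_ ->] := gH 0%N; rewrite add0r; apply: eq_bigr => k _; rewrite lift0.
  have [gB Dg] := gH k.+1.
  by rewrite (Delta_YX _ (leqnn n) gB) Dg mulr0 scaler0 add0r scalerAr.
have g0 k : (k < d)%N -> g k.+1 = 0.
  move=> /gF /eqP; rewrite scaler_eq0 => /orP[|/eqP //]; apply: contraTeq => _.
  by apply: Delta_YX_coef_neq0; lia.
rewrite pE big_ord_recl expr0 mul1r big1 ?addr0 => [|k _]; last by rewrite lift0 g0// mulr0.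
apply: lspan_subset (gS 0%N) => _ [r [z [rn dE ->]]].
by apply: lspan_mem; exists r, z; split=> //; rewrite -dE muln0.
Qed.

Definition xi_orthogonal_basis : Prop :=
  [/\ forall r z, (b + size r)%N = n -> graded n (xi_degree r z) (xi r z) /\ Delta (xi r z) = 0,
      forall d p, graded n d p -> Delta p = 0 ->
        lspan (fun p => exists r z, [/\ (b + size r)%N = n, xi_degree r z = d & p = xi r z]) p,
      forall r z r' z', (b + size r)%N = n -> (b + size r')%N = n -> (r, z) <> (r', z') ->
        phi (st (xi r z) * xi r' z') = 0
    & forall r z, (b + size r)%N = n -> phi (st (xi r z) * xi r z) != 0].

Lemma xi_basis : (b <= n)%N -> xi_orthogonal_basis.
Proof.
move=> b_n; split.
- move=> r z rn; rewrite Delta_xi ?rn//; split=> //.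
  by have := xi_graded z (_ : (b + size r <= n)%N); rewrite rn; apply.
- by move=> d p; exact: harmonic_span.
- by move=> r z r' z' rn rn'; apply: phi_xi_eq0; lia.
- by move=> r z rn; apply: phi_xi_neq0; rewrite rn.
Qed.

End Families.

Hypothesis phi1 : phi 1 != 0.

Section OddBottom.
Hypothesis oE : o = 1%N.
Hypothesis c0_neq0 : c0 != 0.
Hypothesis phiXm : phi Xm = 0.

(** [Y 0] is a nonzero multiple of [Xm ^+ 2], so the bottom algebra is reached from [1] and [Xm] by
    powers of [Y 0]. *)
Lemma odd_basis : xi_orthogonal_basis 0 (fun z : bool => Xm ^+ z) nat_of_bool.
Proof.
have Y0E : Y 0 = c0 *: Xm ^+ 2 by [].
have YX0 (k : nat) (z : bool) : Xm ^+ (2 * k + z) = c0 ^- k *: (Y 0 ^+ k * Xm ^+ z).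
  rewrite Y0E exprZn -scalerAl scalerA mulVf ?expf_neq0// scale1r.
  by rewrite -exprM -exprD.
have phi2 : phi (Xm ^+ 2) != 0.
  have /(congr1 phi) := YX0 1%N false; rewrite expr0 mulr1 !expr1 linearZ /= => ->.
  rewrite mulf_neq0 ?invr_neq0// -[Y 0]mulr1 (phi_Y _ (graded1 0))// mulf_neq0//.
  by apply: phi_Y_coef_neq0; rewrite oE.
apply: xi_basis; rewrite ?oE//.
- by move=> z; exists 1; rewrite scale1r.
- by move=> z; rewrite DeltaXm kappa_lt2 ?scale0r//; case: z.
- by move=> [] [] // _; rewrite st_exp stXm -exprD ?expr1.
- by move=> []; rewrite st_exp stXm -exprD// expr0.
move=> d p [c ->]; apply: lspanZ; rewrite -[d](odd_double_half d) addnC -mul2n YX0.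
by apply: lspanZ; apply: lspan_mem; exists d./2, (odd d).
Qed.

End OddBottom.

Section EvenBottom.
Hypothesis oE : o = 0%N.
Hypothesis XmE : Xm = 0.

(** With [zneg] this makes both cases of [t2poly] a single word, one of whose exponents is 0. *)
Definition zpos (z : int) : nat := if z is Posz k then k else 0.
Definition zneg (z : int) : nat := if z is Negz k then k.+1 else 0.

(** As [Y 0] is 0, [X 0] and [X' 0] commute and [Y 1] is their product; moving the common power into
    [Y 1] leaves a pure power of one of them. *)
Lemma even_basis :
  xi_orthogonal_basis 1 (fun z => X 0 ^+ zpos z * X' 0 ^+ zneg z) (fun z => `|z|%N).
Proof.
have Y00 : Y 0 = 0 by rewrite /Y XmE expr0n scaler0.
have XX'0 : GRing.comm (X 0) (X' 0).
  by rewrite /GRing.comm X'Xcomm// Y00 scaler0 addr0.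
have X'XE a c : X' 0 ^+ a * X 0 ^+ c = X 0 ^+ c * X' 0 ^+ a by apply/esym/commrX/commr_sym/commrX/commr_sym.
have degE z : `|z|%N = (zpos z + zneg z)%N by case: z => k //=; rewrite addn0.
have stv a c : st (X 0 ^+ a * X' 0 ^+ c) = (G 0 ^+ c / G 0 ^+ a) *: (X 0 ^+ c * X' 0 ^+ a).
  by have := st_mono a c 1 n_gt0; rewrite st1 !mulr1.
have mulXX a c a' c' : X 0 ^+ c * X' 0 ^+ a * (X 0 ^+ a' * X' 0 ^+ c') =
    X 0 ^+ (c + a') * 1 * X' 0 ^+ (a + c').
  rewrite mulr1 !exprD !mulrA; congr (_ * _).
  by rewrite -2!mulrA X'XE.
apply: xi_basis => //.
- by move=> z; rewrite degE; apply: XX_graded.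
- move=> z; have := DeltaX (zpos z) (zneg z) n_gt0 (graded1 0); rewrite !mulr1 => ->.
  have -> : Delta 1 = 0 by have := DeltaXm 0; rewrite expr0 kappa_lt2// scale0r.
  rewrite mulr0 mul0r scaler0 addr0.
  by case: z => k /=; rewrite qint0 ?mulr0 ?mul0r scale0r.
- move=> z z' zz'; rewrite stv -scalerAl mulXX linearZ /= (phiX0 n_gt0 (graded1 0)) ?mulr0//.
  by case: z zz' => k; case: z' => k' /= zz' kk'; apply: zz'; [congr Posz|..|congr Negz]; lia.
- move=> z; rewrite stv -scalerAl mulXX linearZ /= addnC mulf_neq0 ?mulf_neq0 ?invr_neq0 ?expf_neq0//.
  exact: (phi_YXX_neq0 _ n_gt0 (graded1 0)).
move=> d; apply: graded_ind => [|p r Hp Hr|c p Hp|a a' e g -> [c ->]].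
- exact: lspan0.
- exact: lspanD.
- exact: lspanZ.
rewrite -scalerAr -scalerAl; apply: lspanZ; rewrite XmE expr0n.
case: e => [|e] /=; last by rewrite mulr0 mul0r; exact: lspan0.
have YX1 s A B : X 0 ^+ (A + s) * X' 0 ^+ (B + s) = Y 1 ^+ s * (X 0 ^+ A * X' 0 ^+ B).
  have -> : Y 1 = X 0 * X' 0 by rewrite -[RHS]addr0 -(scaler0 _ q) -Y00.
  rewrite exprMn_comm// (addnC A) (addnC B) !exprD -!mulrA; congr (_ * _).
  by rewrite !mulrA X'XE.
rewrite mulr1 addn0; case: (leqP a a') => aa'.
  have -> : X 0 ^+ a * X' 0 ^+ a' = Y 1 ^+ a * (X 0 ^+ 0 * X' 0 ^+ (a' - a)).
    by rewrite -YX1 subnK.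
  apply: lspan_mem; exists a.
  case: (posnP (a' - a)) => [aE|aE]; first by exists 0; rewrite /= aE; split=> //; lia.
  by exists (Negz (a' - a).-1); rewrite /= prednK//; split=> //; lia.
have -> : X 0 ^+ a * X' 0 ^+ a' = Y 1 ^+ a' * (X 0 ^+ (a - a') * X' 0 ^+ 0).
  by rewrite -YX1 subnK// ltnW.
by apply: lspan_mem; exists a', (Posz (a - a')); split=> //=; lia.
Qed.

End EvenBottom.
End QuantumAlgebra.

(** * The concrete quantum vector space *)

Section QuantumVectorSpace.
Variables (R : realType) (q : R) (N : nat).
Hypothesis N_ge3 : (3 <= N)%N.
Hypothesis q_gt0 : 0 < q.
Hypothesis q_neq1 : q != 1.

Local Notation n := (N./2).
Local Notation L := (vec_alg q N).
Local Notation x := (xgen q N).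

Lemma N_decomp : N = (2 * n + odd N)%N.
Proof. by rewrite -[LHS]odd_double_half addnC mul2n. Qed.

Lemma qpD (a b : R) : q `^ (a + b) = q `^ a * q `^ b.
Proof. by rewrite powRD// lt0r_neq0// implybT. Qed.

Lemma qpn k : q `^ k%:R = q ^+ k.
Proof. by rewrite powR_mulrn// ltW. Qed.

Lemma qp_neq0 a : q `^ a != 0.
Proof. by rewrite lt0r_neq0// powR_gt0. Qed.

Lemma qX_neq1 k : q ^+ k.+1 != 1.
Proof. by rewrite pexpr_eq1// ltW. Qed.

(** This is $q^{\rho_{n-i}}$, continued beyond [i < n]: the value at [n] enters [Qc n] and
    [phi_Yn]. *)
Definition qrho i : R := q `^ (i%:R + (odd N)%:R / 2).
Definition Kreal : R := 1 + q `^ (N%:R - 2).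
(** The constant for which [Y 0] fits both the commutator of the innermost pair ([half_diff]) and
    $Q_{n+1}=x_{n+1}^2$ ([Qc_c0real]) when [N] is odd. *)
Definition c0real : R := (q `^ (2^-1) + q `^ (- 2^-1))^-1.

Lemma qrhoS i : qrho i.+1 = q * qrho i.
Proof. by rewrite /qrho -natr1 addrAC addrC qpD powRr1// ltW. Qed.

Lemma qrho_gt0 i : 0 < qrho i. Proof. exact: powR_gt0. Qed.

Lemma qrho2 i : qrho i ^+ 2 = q ^+ (2 * i + odd N).
Proof.
rewrite /qrho expr2 -qpD -qpn natrD natrM; congr (q `^ _); lra.
Qed.

Lemma Kreal_gt0 : 0 < Kreal. Proof. by rewrite addr_gt0// powR_gt0. Qed.
Lemma c0real_gt0 : 0 < c0real. Proof. by rewrite invr_gt0 addr_gt0// powR_gt0. Qed.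

Lemma rho_lo i : (i < n)%N -> q `^ rho R N (n - i) = qrho i.
Proof.
move=> i_n; rewrite /rho leq_subr /qrho; congr (q `^ _).
have : N%:R = 2 * n%:R + (odd N)%:R :> R by rewrite {1}N_decomp natrD natrM.
by rewrite natrB ?(ltnW i_n)// => ->; field.
Qed.

Lemma rho_hi i : (i < n)%N -> q `^ rho R N (opi N (n - i)) = (qrho i)^-1.
Proof.
move=> i_n; rewrite /rho /opi; have N_decomp' := N_decomp.
rewrite (_ : (N - (n - i) + 1 <= n)%N = false); last by lia.
rewrite (_ : (N - n + 1 <= N - (n - i) + 1)%N = true); last by lia.
rewrite /qrho -powRN; congr (q `^ _).
have : N%:R = 2 * n%:R + (odd N)%:R :> R by rewrite {1}N_decomp natrD natrM.
by rewrite natrD !natrB ?(ltnW i_n)//; [move=> ->; field|lia].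
Qed.

Lemma opiK j : (1 <= j <= N)%N -> opi N (opi N j) = j.
Proof. by rewrite /opi; lia. Qed.

(** * Generators, relations and quadratic forms *)

Definition X i : L := x (n - i).
Definition X' i : L := x (opi N (n - i)).
Definition Xm : L := if odd N then x n.+1 else 0.

Lemma x_comm i j : (0 < i)%N -> (i < j)%N -> (j <= N)%N -> i <> opi N j ->
  x i * x j = q%:C *: (x j * x i).
Proof.
move=> i0 ij jN ij'; apply/eqP; rewrite -subr_eq0; apply/eqP.
rewrite -!quot_piM -quot_piZ -raddfB -(raddf0 (quot_pi (relator q (N:=N)))).
apply/quot_piP; rewrite subr0.
exact/ideal_gen_mem/rel_qcomm.
Qed.

Lemma XX i k : (i < k < n)%N -> X k * X i = q%:C *: (X i * X k).
Proof. by move=> ik; have N_decomp' := N_decomp; apply: x_comm; rewrite /opi; lia. Qed.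
Lemma XX' i k : (i < k < n)%N -> X k * X' i = q%:C *: (X' i * X k).
Proof. by move=> ik; have N_decomp' := N_decomp; apply: x_comm; rewrite /opi; lia. Qed.
Lemma X'X i k : (i < k < n)%N -> X i * X' k = q%:C *: (X' k * X i).
Proof. by move=> ik; have N_decomp' := N_decomp; apply: x_comm; rewrite /opi; lia. Qed.
Lemma X'X' i k : (i < k < n)%N -> X' i * X' k = q%:C *: (X' k * X' i).
Proof. by move=> ik; have N_decomp' := N_decomp; apply: x_comm; rewrite /opi; lia. Qed.
Lemma XXm k : (k < n)%N -> X k * Xm = q%:C *: (Xm * X k).
Proof.
rewrite /Xm => kn; case: ifP => oN; last by rewrite mulr0 mul0r scaler0.
by have N_decomp' := N_decomp; apply: x_comm; rewrite /opi; lia.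
Qed.
Lemma XmX' k : (k < n)%N -> Xm * X' k = q%:C *: (X' k * Xm).
Proof.
rewrite /Xm => kn; case: ifP => oN; last by rewrite mulr0 mul0r scaler0.
by have N_decomp' := N_decomp; apply: x_comm; rewrite /opi; lia.
Qed.

Local Notation Y := (Y q%:C X X' Xm c0real%:C).

Lemma x_cross j : (0 < j)%N -> (j < n)%N ->
  x (opi N j) * x j = x j * x (opi N j) +
  ((q - q^-1) / (q `^ (rho R N j - 1) + q `^ (- rho R N j + 1)))%:C *: Qform q N j.+1.
Proof.
move=> j0 jn; apply/eqP; rewrite -subr_eq0 opprD addrA; apply/eqP.
rewrite -!quot_piM /Qform.
under eq_bigr do rewrite -quot_piM -quot_piZ.
rewrite -raddf_sum -quot_piZ -!raddfB -(raddf0 (quot_pi (relator q (N:=N)))).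
by apply/quot_piP; rewrite subr0; apply/ideal_gen_mem/rel_cross.
Qed.

Lemma x_mid : x (opi N n) * x n = x n * x (opi N n) +
  if odd N then (q `^ (2^-1) - q `^ (- 2^-1))%:C *: (x n.+1 ^+ 2) else 0.
Proof.
apply/eqP; rewrite -subr_eq0 opprD addrA; apply/eqP.
case: ifP => oN; rewrite ?subr0 -?quot_piM ?expr2 -?quot_piM -?quot_piZ -!raddfB -(raddf0 (quot_pi (relator q (N:=N)))).
  by apply/quot_piP; rewrite subr0; apply/ideal_gen_mem/rel_mid_odd.
by apply/quot_piP; rewrite subr0; apply/ideal_gen_mem/rel_mid_even; rewrite oN.
Qed.

Lemma qrho_neq0 i : qrho i != 0. Proof. by rewrite lt0r_neq0// qrho_gt0. Qed.
Lemma Kreal_neq0 : Kreal != 0. Proof. by rewrite lt0r_neq0// Kreal_gt0. Qed.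
Lemma q_neq0 : q != 0. Proof. by rewrite lt0r_neq0. Qed.

Lemma Y0E : Y 0 = c0real%:C *: Xm ^+ 2. Proof. by []. Qed.
Lemma YSE i : Y i.+1 = X i * X' i + q%:C *: Y i. Proof. by []. Qed.

Lemma qrho0_odd : odd N -> qrho 0 = q `^ 2^-1.
Proof. by move=> oN; rewrite /qrho oN add0r mul1r. Qed.

Lemma Qform_split j : (0 < j)%N -> (j <= n)%N ->
  Qform q N j = (q `^ rho R N (opi N j))%:C *: (x j * x (opi N j)) + Qform q N j.+1
    + (q `^ rho R N j)%:C *: (x (opi N j) * x j).
Proof.
move=> j0 jn; have N_decomp' := N_decomp.
have jj : (j.+1 <= opi N j)%N by rewrite /opi; lia.
rewrite /Qform big_ltn; last by rewrite ltnS ltnW.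
rewrite big_nat_recr//= opiK; last by lia.
by rewrite addrA; congr (_ + _ + _); congr bigop; congr index_iota; rewrite /opi; lia.
Qed.

(* The scalar relating [Q_j] to [y_j] for [j = n - i + 1]: since
   [N/2 - j = rho_(j-1) - 1], it is [q^r + q^-r] with [r = N/2 - j], also for [j = n + 1]. *)
Definition Qc i : R := qrho i / q + q / qrho i.

Lemma Qc_gt0 i : 0 < Qc i.
Proof. by rewrite addr_gt0// divr_gt0// qrho_gt0. Qed.

Lemma sqr_half : (q `^ 2^-1) ^+ 2 = q.
Proof. by rewrite expr2 -qpD -[RHS]powRr1 ?ltW//; congr (_ `^ _); lra. Qed.

Lemma half_pos (h := q `^ 2^-1) : h * h + 1 != 0.
Proof. by rewrite lt0r_neq0// addr_gt0// mulr_gt0// powR_gt0. Qed.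

Lemma half_diff : q `^ (2^-1) - q `^ (- 2^-1) = (q - q^-1) * c0real.
Proof.
have := qp_neq0 2^-1; have := half_pos; have := sqr_half; rewrite /c0real powRN.
by move: (q `^ 2^-1) => h <- hh h0; field; rewrite h0.
Qed.

Lemma Qc_c0real : odd N -> Qc 0 * c0real = 1.
Proof.
move=> oN; rewrite /Qc qrho0_odd// /c0real powRN.
have := qp_neq0 2^-1; have := half_pos; have := sqr_half.
by move: (q `^ 2^-1) => h <- hh h0; field; rewrite h0.
Qed.

(** The relation for $x_j$ needs $Q_{j+1}$, and computing $Q_j$ needs this relation; the conditional
    form lets the induction in [Qform_Y] use it. *)
Lemma X'X_of_Qform i : (i < n)%N -> Qform q N (n - i).+1 = (Qc i)%:C *: Y i ->
  X' i * X i = X i * X' i + (q%:C - q%:C^-1) *: Y i.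
Proof.
move=> i_n QY; have qC : q%:C - q%:C^-1 = (q - q^-1)%:C by rewrite rmorphB /= fmorphV.
case: i i_n QY => [|i] i_n QY.
  rewrite /X' /X subn0 x_mid; congr (_ + _); rewrite qC.
  rewrite Y0E /Xm; case: ifP => oN; last by rewrite expr0n /= !scaler0.
  rewrite scalerA -rmorphM; congr (_%:C *: _).
  by rewrite half_diff.
rewrite /X' /X x_cross ?QY//; [|lia|lia]; congr (_ + _).
rewrite scalerA qC -rmorphM; congr (_%:C *: _).
rewrite qpD [q `^ (- _ + 1)]qpD !powRN rho_lo// powRr1 ?ltW// /Qc [_^-1 * q]mulrC.
by rewrite -mulrA mulVf ?mulr1// lt0r_neq0// Qc_gt0.
Qed.

Lemma Qform_Y i : (i <= n)%N -> Qform q N (n - i).+1 = (Qc i)%:C *: Y i.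
Proof.
elim: i => [|i IHi] i_n.
  rewrite subn0 Y0E /Xm scalerA.
  have N_decomp' := N_decomp; rewrite /Qform; case: ifP => oN; rewrite oN in N_decomp'.
    have oE : opi N n.+1 = n.+1 by rewrite /opi; lia.
    rewrite oE big_nat1 oE /rho ltnn ifF; last by rewrite /opi; lia.
    by rewrite powRr0 rmorph1 !scale1r expr2 -(rmorphM (real_complex R)) Qc_c0real// rmorph1 scale1r.
  by rewrite expr0n /= !scaler0 big_geq//; rewrite /opi; lia.
have QY := IHi (ltnW i_n).
rewrite -subSn// subSS Qform_split; [|lia|lia].
rewrite rho_hi// rho_lo// QY -/(X i) -/(X' i) (X'X_of_Qform i_n QY).
rewrite YSE !scalerDr !scalerA addrACA -!scalerDl.
rewrite -!(rmorphM, rmorphD, rmorphB, fmorphV) /=; congr (_%:C *: _ + _%:C *: _).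
  by rewrite /Qc qrhoS; field; rewrite q_neq0 qrho_neq0.
by rewrite /Qc qrhoS; field; rewrite q_neq0 qrho_neq0.
Qed.

Lemma X'X_comm i : (i < n)%N -> X' i * X i = X i * X' i + (q%:C - q%:C^-1) *: Y i.
Proof. by move=> i_n; apply: X'X_of_Qform (Qform_Y (ltnW i_n)). Qed.

Local Notation graded := (graded X X' Xm).

(** * Ordered monomials layer by layer *)

Definition inner_mono i (nu : nat -> nat) : L :=
  \prod_((n - i).+1 <= k < (N - (n - i)).+1) x k ^+ nu k.
Definition inner_degree i (nu : nat -> nat) : nat :=
  (\sum_((n - i).+1 <= k < (N - (n - i)).+1) nu k)%N.
(* [inner i] selects the indices of the pairs below [i] and of the middle
   generator. *)
Definition inner i k : bool := (n - i < k <= N - (n - i))%N.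
(** Inner monomials are represented by exponents on all indices that vanish outside the layer,
    because the formulas for [Delta] and [h] are given on full monomials. *)
Definition vanish i (nu : nat -> nat) : Prop := forall k, ~~ inner i k -> nu k = 0%N.
Definition cut i (nu : nat -> nat) : nat -> nat := fun k => if inner i k then nu k else 0%N.
Definition set_pair i a b (nu : nat -> nat) : nat -> nat :=
  fun k => if k == (n - i)%N then a else if k == opi N (n - i) then b else nu k.

Lemma inner_monoS i nu : (i < n)%N ->
  inner_mono i.+1 nu = X i ^+ nu (n - i)%N * inner_mono i nu * X' i ^+ nu (opi N (n - i)).
Proof.
move=> i_n; have N_decomp' := N_decomp; rewrite /inner_mono.
have -> : ((n - i.+1).+1 = n - i)%N by lia.
have -> : (N - (n - i.+1) = opi N (n - i))%N by rewrite /opi; lia.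
rewrite big_ltn; last by rewrite /opi; lia.
rewrite big_nat_recr/=; last by rewrite /opi; lia.
by rewrite mulrA; congr (_ * _ * _); congr bigop; congr index_iota; rewrite /opi; lia.
Qed.

Lemma inner_degreeS i nu : (i < n)%N ->
  inner_degree i.+1 nu = (nu (n - i) + nu (opi N (n - i)) + inner_degree i nu)%N.
Proof.
move=> i_n; have N_decomp' := N_decomp; rewrite /inner_degree.
have -> : ((n - i.+1).+1 = n - i)%N by lia.
have -> : (N - (n - i.+1) = opi N (n - i))%N by rewrite /opi; lia.
rewrite big_ltn; last by rewrite /opi; lia.
rewrite big_nat_recr/=; last by rewrite /opi; lia.
rewrite addnA addnAC; congr (_ + _ + _)%N; congr bigop; congr index_iota; rewrite /opi; lia.
Qed.

Lemma inner_mono_n nu : inner_mono n nu = mono q N nu. Proof. by rewrite /inner_mono subnn subn0. Qed.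
Lemma inner_degree_n nu : inner_degree n nu = mdegree N nu. Proof. by rewrite /inner_degree subnn subn0. Qed.

Lemma inner_outer i : (i < n)%N -> ~~ inner i (n - i) /\ ~~ inner i (opi N (n - i)).
Proof. by have := N_decomp; rewrite /inner /opi; lia. Qed.

Lemma innerS i k : (i < n)%N ->
  inner i.+1 k = [|| inner i k, k == (n - i)%N | k == opi N (n - i)].
Proof. by have := N_decomp; rewrite /inner /opi; lia. Qed.

Lemma vanishS i nu : (i < n)%N -> vanish i nu -> vanish i.+1 nu.
Proof. by move=> i_n nu0 k; rewrite innerS// negb_or => /andP[/nu0]. Qed.

Lemma vanish_mono i nu : (i <= n)%N -> vanish i nu ->
  mono q N nu = inner_mono i nu /\ mdegree N nu = inner_degree i nu.
Proof.
move=> i_n; rewrite -(subKn i_n); move: (n - i)%N (leq_subr i n) => {i i_n}.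
elim=> [|k IHk] k_n; first by rewrite subn0 -inner_mono_n -inner_degree_n.
have i_n : (n - k.+1 < n)%N by lia.
have iS : ((n - k.+1).+1 = n - k)%N by lia.
move=> nu0; have nuS : vanish (n - k) nu by rewrite -iS; exact: vanishS.
have [-> ->] := IHk (ltnW k_n) nuS.
have [/nu0 e1 /nu0 e2] := inner_outer i_n.
by rewrite -iS inner_monoS// inner_degreeS// e1 e2 !expr0 mul1r mulr1.
Qed.

Lemma cut_vanish i nu : vanish i (cut i nu).
Proof. by move=> k /negbTE; rewrite /cut => ->. Qed.

Lemma eq_inner_mono i nu mu : (forall k, inner i k -> nu k = mu k) -> inner_mono i nu = inner_mono i mu.
Proof. by move=> e; apply: eq_big_nat => k k_in; rewrite e// /inner; lia. Qed.

Lemma eq_inner_degree i nu mu : (forall k, inner i k -> nu k = mu k) -> inner_degree i nu = inner_degree i mu.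
Proof. by move=> e; apply: eq_big_nat => k k_in; rewrite e// /inner; lia. Qed.

Lemma set_pair_inner i a b nu k : (i < n)%N -> inner i k -> set_pair i a b nu k = nu k.
Proof. by have := N_decomp; rewrite /inner /set_pair /opi => *; do 2?case: eqP => ?; lia. Qed.

Lemma set_pair_lo i a b nu : set_pair i a b nu (n - i) = a.
Proof. by rewrite /set_pair eqxx. Qed.

Lemma set_pair_hi i a b nu : (i < n)%N -> set_pair i a b nu (opi N (n - i)) = b.
Proof. by have := N_decomp; rewrite /set_pair eqxx /opi => *; case: eqP => // ?; lia. Qed.

Lemma set_pair_vanish i a b nu : (i < n)%N -> vanish i nu -> vanish i.+1 (set_pair i a b nu).
Proof.
move=> i_n nu0 k; rewrite innerS// !negb_or /set_pair => /and3P[/nu0 e /negbTE -> /negbTE ->].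
exact: e.
Qed.

Lemma mono_set_pair i a b nu : (i < n)%N -> vanish i nu ->
  mono q N (set_pair i a b nu) = X i ^+ a * mono q N nu * X' i ^+ b.
Proof.
move=> i_n nu0; have [-> _] := vanish_mono i_n (set_pair_vanish a b i_n nu0).
have [-> _] := vanish_mono (ltnW i_n) nu0; rewrite inner_monoS// set_pair_lo set_pair_hi//.
by congr (_ * _ * _); apply: eq_inner_mono => k; apply: set_pair_inner.
Qed.

Lemma mdegree_set_pair i a b nu : (i < n)%N -> vanish i nu ->
  mdegree N (set_pair i a b nu) = (a + b + mdegree N nu)%N.
Proof.
move=> i_n nu0; have [_ ->] := vanish_mono i_n (set_pair_vanish a b i_n nu0).
have [_ ->] := vanish_mono (ltnW i_n) nu0; rewrite inner_degreeS// set_pair_lo set_pair_hi//.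
by congr (_ + _)%N; apply: eq_inner_degree => k; apply: set_pair_inner.
Qed.

Lemma inner_mono0 nu : inner_mono 0 nu = if odd N then x n.+1 ^+ nu n.+1 else 1.
Proof.
have N_decomp' := N_decomp; rewrite /inner_mono subn0; case: ifP N_decomp' => oN N_decomp'.
  have -> : (N - n = n.+1)%N by lia.
  by rewrite big_nat1.
by rewrite big_geq//; lia.
Qed.

Lemma inner_degree0 nu : inner_degree 0 nu = if odd N then nu n.+1 else 0%N.
Proof.
have N_decomp' := N_decomp; rewrite /inner_degree subn0; case: ifP N_decomp' => oN N_decomp'.
  have -> : (N - n = n.+1)%N by lia.
  by rewrite big_nat1.
by rewrite big_geq//; lia.
Qed.

Lemma graded_span i d p : (i <= n)%N -> graded i d p ->
  lspan (fun p => exists nu, [/\ vanish i nu, mdegree N nu = d & p = mono q N nu]) p.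
Proof.
elim: i d p => [|i IHi] d p i_n.
  move=> [c ->]; apply: lspanZ.
  have [nu nuE] : exists nu, nu = cut 0 (fun=> d) by eexists.
  have [mE dE] := vanish_mono (leq0n n) (@cut_vanish 0%N (fun=> d)).
  have n1 : odd N -> inner 0 n.+1 by have := N_decomp; rewrite /inner; lia.
  rewrite /Xm; case: ifP => oN.
    apply: lspan_mem; exists nu; rewrite nuE; split; first exact: cut_vanish.
      by rewrite dE inner_degree0 oN /cut n1.
    by rewrite mE inner_mono0 oN /cut n1.
  case: d nuE mE dE => [|d] nuE mE dE; last by rewrite expr0n; exact: lspan0.
  apply: lspan_mem; exists nu; rewrite nuE; split; first exact: cut_vanish.
    by rewrite dE inner_degree0 oN.
  by rewrite mE inner_mono0 oN.
elim/graded_ind => {p} [|p r Hp Hr|c p Hp|a b e g -> Hg].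
- exact: lspan0.
- exact: lspanD.
- exact: lspanZ.
have := IHi _ _ (ltnW i_n) Hg; elim=> {g Hg} [_ [nu [nu0 <- ->]]||p r _ Hp _ Hr|c p _ Hp].
- apply: lspan_mem; exists (set_pair i a b nu); split; first exact: set_pair_vanish.
    exact: mdegree_set_pair.
  by rewrite mono_set_pair.
- by rewrite mulr0 mul0r; apply: lspan0.
- by rewrite mulrDr mulrDl; apply: lspanD.
- by rewrite -scalerAr -scalerAl; apply: lspanZ.
Qed.

Lemma inner_mono_graded i nu : (i <= n)%N -> graded i (inner_degree i nu) (inner_mono i nu).
Proof.
elim: i => [|i IHi] i_n.
  exists 1; rewrite scale1r inner_mono0 inner_degree0 /Xm; case: ifP => // _.
by rewrite inner_monoS// inner_degreeS//; apply: graded_mono; apply: IHi; exact: ltnW.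
Qed.

Lemma homog_graded m p : homog m p -> graded n m p.
Proof.
move=> [k [t [c [tm ->]]]]; elim/big_ind: _ => [|p1 p2|i _]; [exact: graded0|exact: gradedD|].
by apply: gradedZ; rewrite -(tm i) -inner_mono_n -inner_degree_n; apply: inner_mono_graded.
Qed.

(** * The q-Laplace operator on ordered monomials *)

Definition lterm (nu : nat -> nat) k : L :=
  (qnum_sym q (nu k)%:R * qnum_sym q (nu (opi N k))%:R
     * q `^ (- rho R N k + (dsum N nu k)%:R))%:C *: mono q N (lower2 nu k (opi N k)).
Definition lmid (nu : nat -> nat) : L :=
  if odd N then
    (qnum q ((nu n.+1)%:R - 1) * qnum q (nu n.+1)%:R
       * (q `^ ((mdegree N nu)%:R - 2 * (nu n.+1)%:R + 2) / (1 + q)))%:C *: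
    mono q N (lower2 nu n.+1 n.+1)
  else 0.

Lemma laplace_monoE nu : laplace_mono q N nu =
  (Kreal * q `^ ((mdegree N nu)%:R - 1))%:C *: (\sum_(1 <= k < n.+1) lterm nu k + lmid nu).
Proof. by []. Qed.

Lemma eq_mono nu mu : nu =1 mu -> mono q N nu = mono q N mu.
Proof. by move=> e; apply: eq_bigr => k _; rewrite e. Qed.

Lemma qnum_sym0 : qnum_sym q 0 = 0.
Proof. by rewrite /qnum_sym oppr0 subrr mul0r. Qed.

Lemma lterm0 i nu k : (i < n)%N -> vanish i nu -> (0 < k)%N -> (k <= n - i)%N -> lterm nu k = 0.
Proof.
move=> i_n nu0 k0 ki; rewrite /lterm (nu0 k) ?qnum_sym0 ?mul0r ?rmorph0 ?scale0r//.
by rewrite /inner; lia.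
Qed.

Lemma lterm0S i nu k : (i < n)%N -> vanish i.+1 nu -> (0 < k)%N -> (k < n - i)%N -> lterm nu k = 0.
Proof.
move=> i_n nu0 k0 ki; rewrite /lterm (nu0 k) ?qnum_sym0 ?mul0r ?rmorph0 ?scale0r//.
by rewrite /inner; lia.
Qed.

Lemma lterm_set_pairE i a b nu : (i < n)%N -> vanish i nu ->
  lterm (set_pair i a b nu) (n - i) =
  (qnum_sym q a%:R * qnum_sym q b%:R / qrho i)%:C *: (X i ^+ a.-1 * mono q N nu * X' i ^+ b.-1).
Proof.
move=> i_n nu0; rewrite /lterm set_pair_lo set_pair_hi//.
have -> : dsum N (set_pair i a b nu) (n - i) = 0%N.
  rewrite /dsum big_nat_cond big1// => j; rewrite andbT => j_in; have N_decomp' := N_decomp.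
  by rewrite !(set_pair_vanish a b i_n nu0)// /inner /opi; lia.
rewrite addr0 powRN rho_lo// -mono_set_pair//; congr (_ *: _); apply: eq_mono => k.
rewrite /lower2 /set_pair; have [->|_] := eqVneq k (n - i)%N.
  have -> : (n - i == opi N (n - i))%N = false by have := N_decomp; rewrite /opi; lia.
  by rewrite subn1 subn0.
by case: eqVneq => _; rewrite subn0 ?subn1 ?subn0.
Qed.

Lemma lower2_set_pair i a b nu k k' : ~~ (k \in [:: n - i; opi N (n - i)]%N) ->
  ~~ (k' \in [:: n - i; opi N (n - i)]%N) ->
  lower2 (set_pair i a b nu) k k' =1 set_pair i a b (lower2 nu k k').
Proof.
rewrite !inE !negb_or => /andP[k1 k2] /andP[k1' k2'] j; rewrite /lower2 /set_pair.
case: eqVneq => [->|_].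
  by rewrite eq_sym (negbTE k1) eq_sym (negbTE k1') !subn0.
by case: eqVneq => [->|_] //; rewrite eq_sym (negbTE k2) eq_sym (negbTE k2') !subn0.
Qed.

Lemma lower2_vanish i nu k k' : vanish i nu -> vanish i (lower2 nu k k').
Proof. by move=> nu0 j /nu0; rewrite /lower2 => ->. Qed.

Lemma dsum_set_pair i a b nu k : (i < n)%N -> vanish i nu -> (n - i < k)%N -> (k <= n)%N ->
  dsum N (set_pair i a b nu) k = (a + b + dsum N nu k)%N.
Proof.
move=> i_n nu0 ik kn; have N_decomp' := N_decomp; rewrite /dsum.
have split mu : (\sum_(1 <= j < k) (mu j + mu (opi N j)) =
    \sum_(1 <= j < n - i) (mu j + mu (opi N j)) + (mu (n - i) + mu (opi N (n - i)))
    + \sum_((n - i).+1 <= j < k) (mu j + mu (opi N j)))%N.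
  by rewrite (@big_cat_nat _ _ _ (n - i))//=; [rewrite [X in (_ + X)%N]big_ltn// addnA|lia|lia].
rewrite !split set_pair_lo set_pair_hi//.
have z mu : vanish i.+1 mu -> (\sum_(1 <= j < n - i) (mu j + mu (opi N j)) = 0)%N.
  move=> mu0; rewrite big_nat_cond big1// => j; rewrite andbT => j_in.
  by rewrite !mu0// /inner /opi; lia.
rewrite !z; [|exact: vanishS|exact: set_pair_vanish].
have [/nu0 -> /nu0 ->] := inner_outer i_n; rewrite !add0n; congr (_ + _)%N.
by apply: eq_big_nat => j j_in; rewrite !set_pair_inner// /inner /opi; lia.
Qed.

(** In the coefficient, the outer pair is felt only through [dsum], which contributes $q^{a+b}$. *)
Lemma lterm_set_pairN i a b nu k : (i < n)%N -> vanish i nu -> (n - i < k)%N -> (k <= n)%N ->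
  lterm (set_pair i a b nu) k = (q ^+ (a + b))%:C *: (X i ^+ a * lterm nu k * X' i ^+ b).
Proof.
move=> i_n nu0 ik kn; have N_decomp' := N_decomp.
rewrite /lterm dsum_set_pair// !set_pair_inner//; [|rewrite /inner /opi; lia|rewrite /inner /opi; lia].
rewrite (eq_mono (lower2_set_pair _ _ _ _ _)); [|rewrite !inE /opi; lia|rewrite !inE /opi; lia].
rewrite mono_set_pair//; last exact: lower2_vanish.
rewrite -!(scalerAr, scalerAl) !scalerA -(rmorphM (real_complex R)); congr (_%:C *: _).
by rewrite natrD addrCA qpD qpn mulrCA.
Qed.

Lemma lmid_set_pair i a b nu : (i < n)%N -> vanish i nu ->
  lmid (set_pair i a b nu) = (q ^+ (a + b))%:C *: (X i ^+ a * lmid nu * X' i ^+ b).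
Proof.
move=> i_n nu0; rewrite /lmid; case: ifP => oN; last by rewrite mulr0 mul0r scaler0.
have N_decomp' := N_decomp; rewrite oN in N_decomp'.
rewrite mdegree_set_pair// set_pair_inner//; last by rewrite /inner; lia.
rewrite (eq_mono (lower2_set_pair _ _ _ _ _)); [|rewrite !inE /opi; lia|rewrite !inE /opi; lia].
rewrite mono_set_pair//; last exact: lower2_vanish.
rewrite -!(scalerAr, scalerAl) !scalerA -(rmorphM (real_complex R)); congr (_%:C *: _).
by rewrite natrD -!addrA qpD qpn; ring.
Qed.

Variable Delta : {linear L -> L}.
Hypothesis Delta_qlaplace : is_qlaplace Delta.

Lemma qint_qnum a : qint q%:C a = (qnum_sym q a%:R)%:C.
Proof.
by rewrite /qint /qnum_sym powRN qpn !(rmorphM, rmorphB, fmorphV, rmorphXn).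
Qed.

(** The factor $q^{2(a+b)}$ has two sources: the prefactor $q^{|\nu|-1}$, and the $q^{a+b}$ from
    [lterm_set_pairN] and [lmid_set_pair]. *)
Lemma Delta_X i a b d g : (i < n)%N -> graded i d g ->
  Delta (X i ^+ a * g * X' i ^+ b) =
    (Kreal%:C * q%:C ^+ (a + b + d) / q%:C / (qrho i)%:C * qint q%:C a * qint q%:C b) *:
      (X i ^+ a.-1 * g * X' i ^+ b.-1)
    + q%:C ^+ (2 * (a + b)) *: (X i ^+ a * Delta g * X' i ^+ b).
Proof.
move=> i_n /(graded_span (ltnW i_n)); elim=> {g} [_ [nu [nu0 <- ->]]||p r _ Hp _ Hr|c p _ Hp].
- rewrite -mono_set_pair// !Delta_qlaplace !laplace_monoE mdegree_set_pair//.
  have qd k : q `^ (k%:R - 1) = q ^+ k / q by rewrite qpD powRN powRr1 ?ltW// qpn.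
  have cat mu : \sum_(1 <= k < n.+1) lterm mu k =
      \sum_(1 <= k < n - i) lterm mu k + lterm mu (n - i) + \sum_((n - i).+1 <= k < n.+1) lterm mu k.
    by rewrite (@big_cat_nat _ _ _ (n - i))//=; [rewrite [X in _ + X]big_ltn ?addrA//|..]; lia.
  rewrite !cat (lterm0 (k := (n - i)%N) i_n nu0)//; last by lia.
  have z mu : vanish i.+1 mu -> \sum_(1 <= k < n - i) lterm mu k = 0.
    move=> mu0; rewrite big_nat_cond big1// => k; rewrite andbT => k_in.
    by apply: (lterm0S i_n mu0); lia.
  rewrite !z; [|exact: vanishS|exact: set_pair_vanish].
  rewrite !add0r lterm_set_pairE// lmid_set_pair//.
  have -> : \sum_((n - i).+1 <= k < n.+1) lterm (set_pair i a b nu) k =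
     (q ^+ (a + b))%:C *: (X i ^+ a * (\sum_((n - i).+1 <= k < n.+1) lterm nu k) * X' i ^+ b).
    rewrite mulr_sumr mulr_suml scaler_sumr; apply: eq_big_nat => k k_in.
    by rewrite lterm_set_pairN//; lia.
  have -> : Kreal%:C * q%:C ^+ (a + b + mdegree N nu) / q%:C / (qrho i)%:C * qint q%:C a * qint q%:C b =
      (Kreal * q ^+ (a + b + mdegree N nu) / q / qrho i * qnum_sym q a%:R * qnum_sym q b%:R)%:C.
    by rewrite !qint_qnum !(rmorphM, fmorphV, rmorphXn).
  have -> : q%:C ^+ (2 * (a + b)) = (q ^+ (2 * (a + b)))%:C by rewrite rmorphXn.
  rewrite -addrA -scalerDr -mulrDl -mulrDr scalerDr -scalerAr -scalerAl !scalerA.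
  rewrite -!(rmorphM (real_complex R)) !qd; congr (_%:C *: _ + _%:C *: _); first by ring.
  by rewrite mul2n -addnn !exprD; ring.
- by rewrite !(mulr0, mul0r, linear0, scaler0) addr0.
- rewrite (linearD Delta p r) !(mulrDr (X i ^+ _)) !(mulrDl _ _ (X' i ^+ _)) linearD Hp Hr.
  by rewrite 2!scalerDr addrACA.
- rewrite (linearZ_LR Delta c p) -!(scalerAr c) -!(scalerAl c) linearZ_LR Hp /= scalerDr !scalerA.
  by rewrite (mulrC c) (mulrC c).
Qed.

Definition kappa_real d : R :=
  if odd N then Kreal * q * qnum q (d%:R - 1) * qnum q d%:R / (1 + q) else 0.

Lemma n_gt0 : (0 < n)%N. Proof. by have := N_decomp; lia. Qed.

Lemma Xm_monomial d (nu := cut 0 (fun=> d)) : odd N ->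
  [/\ vanish 0 nu, nu n.+1 = d, mdegree N nu = d & mono q N nu = Xm ^+ d].
Proof.
move=> oN; have nu0 : vanish 0 nu by exact: cut_vanish.
have nuE : nu n.+1 = d by rewrite /nu /cut /inner; case: ifP => //; have := N_decomp; lia.
have [mE dE] := vanish_mono (leq0n n) nu0.
by split; rewrite // ?dE ?mE ?inner_degree0 ?inner_mono0 /Xm oN nuE.
Qed.

Lemma Delta_vanish0 nu : vanish 0 nu ->
  Delta (mono q N nu) = (Kreal * q `^ ((mdegree N nu)%:R - 1))%:C *: lmid nu.
Proof.
move=> nu0; rewrite Delta_qlaplace laplace_monoE big_nat_cond big1 ?add0r// => k.
by rewrite andbT => k_in; apply: (lterm0 n_gt0 nu0); lia.
Qed.

Lemma Delta_Xm d : Delta (Xm ^+ d) = (kappa_real d)%:C *: Xm ^+ (d - 2).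
Proof.
rewrite /kappa_real; case: ifP => oN.
  have [nu0 nuE dE mE] := Xm_monomial d oN.
  have l0 : vanish 0 (lower2 (cut 0 (fun=> d)) n.+1 n.+1) by exact: lower2_vanish.
  rewrite -mE Delta_vanish0// dE /lmid oN nuE scalerA -(rmorphM (real_complex R)).
  have [-> _] := vanish_mono (leq0n n) l0; rewrite inner_mono0 oN /lower2 nuE eqxx.
  rewrite dE /Xm oN -subnDA; congr (_%:C *: _).
  rewrite -[X in _ = _ * X * _ * _ / _]powRr1 ?ltW//.
  have <- : q `^ (d%:R - 1) * q `^ (d%:R - 2 * d%:R + 2) = q `^ 1.
    by rewrite -qpD; congr (_ `^ _); ring.
  by ring.
rewrite rmorph0 scale0r /Xm oN; case: d => [|d]; last by rewrite expr0n linear0.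
have [mE dE] := vanish_mono (leq0n n) (@cut_vanish 0%N (fun=> 0%N)).
rewrite expr0; have <- : mono q N (cut 0 (fun=> 0%N)) = 1 by rewrite mE inner_mono0 oN.
by rewrite Delta_vanish0 ?/lmid ?oN ?scaler0//; exact: cut_vanish.
Qed.

Lemma qnum0 : qnum q 0 = 0. Proof. by rewrite /qnum powRr0 subrr mul0r. Qed.

Lemma kappa_real_lt2 d : (d < 2)%N -> (kappa_real d)%:C = 0.
Proof.
rewrite /kappa_real; case: ifP => // _; case: d => [|[|//]] _.
  by rewrite qnum0 mulr0 mul0r.
by rewrite subrr qnum0 mulr0 !mul0r.
Qed.

Definition Delta_Y_coef_real d : R := Kreal * q / qrho 0 * (q ^+ (odd N + 2 * d) - 1) / (q - q^-1).

Lemma Delta_Y_coef0 d : Delta_Y_coef q%:C (odd N) (fun i => (qrho i)%:C) Kreal%:C 0 d = (Delta_Y_coef_real d)%:C.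
Proof. by rewrite /Delta_Y_coef /Delta_Y_coef_real muln0 add0n !(rmorphM, fmorphV, rmorphB, rmorphXn, rmorph1). Qed.

Lemma Delta_Y0 d : Delta (Y 0 * Xm ^+ d) = q%:C ^+ 2 *: (Y 0 * Delta (Xm ^+ d)) +
  Delta_Y_coef q%:C (odd N) (fun i => (qrho i)%:C) Kreal%:C 0 d *: Xm ^+ d.
Proof.
(* For even [N] both sides are 0: [Xm] is 0, and in the remaining case [d = 0] the coefficient
   contains $q^0-1$. *)
rewrite Delta_Y_coef0 /Delta_Y_coef_real; have [oN|oN] := boolP (odd N); last first.
  rewrite Y0E /Xm (negbTE oN) !expr0n /= scaler0 !mul0r linear0 scaler0 add0r add0n.
  by case: d => [|d]; rewrite ?scaler0// muln0 expr0 subrr mulr0 !mul0r rmorph0 scale0r.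
rewrite Y0E -scalerAl -exprD linearZ_LR Delta_Xm Delta_Xm.
have -> : (2 + d - 2 = d)%N by lia.
have XmE : (kappa_real d)%:C *: Xm ^+ (2 + (d - 2)) = (kappa_real d)%:C *: Xm ^+ d.
  by have [d2|d2] := ltnP d 2; [rewrite kappa_real_lt2// !scale0r|rewrite subnKC].
have -> : c0real%:C *: Xm ^+ 2 * ((kappa_real d)%:C *: Xm ^+ (d - 2)) = (c0real%:C * (kappa_real d)%:C) *: Xm ^+ d.
  by rewrite -scalerAl -scalerAr -exprD XmE scalerA.
rewrite !scalerA -scalerDl; congr (_ *: _).
rewrite -(rmorphXn (real_complex R)) -!(rmorphM (real_complex R)) -(rmorphD (real_complex R)).
congr (_%:C); rewrite /kappa_real oN.
have qd k : q `^ (k%:R - 1) = q ^+ k / q by rewrite qpD powRN powRr1 ?ltW// qpn.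
rewrite /qnum !qd !qpn qrho0_odd// /c0real powRN addSn.
have := qp_neq0 2^-1; have := half_pos; have := sqr_half.
have : 1 - q != 0 by rewrite subr_eq0 eq_sym.
have : 1 + q != 0 by rewrite lt0r_neq0// addr_gt0.
rewrite ?mul2n -?addnn ?(exprD, exprS, expr0).
move: (q ^+ d) (Kreal) => D K; move: (q `^ 2^-1) => h q1 q2 qh hh h0; rewrite -qh in q1 q2 *.
have h4 : h * h * (h * h) - 1 = - ((1 + h * h) * (1 - h * h)) by ring.
rewrite !mulr1 in q1 q2; field.
by rewrite h0 h4 oppr_eq0 q1 q2 mulf_neq0.
Qed.

(** * The invariant functional on ordered monomials *)

Lemma big_set_pair (T : Type) (idx : T) (op : Monoid.com_law idx) (F : nat -> nat -> T) i a b nu :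
  (i < n)%N -> vanish i nu -> F (n - i)%N 0%N = idx ->
  \big[op/idx]_(1 <= k < n.+1) F k (set_pair i a b nu k) =
  op (F (n - i)%N a) (\big[op/idx]_(1 <= k < n.+1) F k (nu k)).
Proof.
move=> i_n nu0 F0; have N_decomp' := N_decomp.
have i_in : (n - i)%N \in index_iota 1 n.+1 by rewrite mem_index_iota; lia.
rewrite !(bigD1_seq (n - i)%N)//= ?iota_uniq// set_pair_lo.
have [/nu0 -> _] := inner_outer i_n; rewrite F0 Monoid.mul1m; congr (op _ _).
rewrite big_seq_cond [RHS]big_seq_cond; apply: eq_bigr => k /andP[].
rewrite mem_index_iota => k_in ki; rewrite /set_pair (negbTE ki).
by case: eqP => // kE; move: k_in; rewrite kE /opi; lia.
Qed.

Lemma invariant_support_set_pair i a b nu : (i < n)%N -> vanish i nu ->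
  invariant_support N (set_pair i a b nu) = (a == b) && invariant_support N nu.
Proof.
move=> i_n nu0; have N_decomp' := N_decomp; rewrite /invariant_support andbA; congr (_ && _); last first.
  case oN: (odd N) => //=; rewrite oN in N_decomp'.
  by rewrite set_pair_inner// /inner; lia.
have updE j : (0 < j <= n)%N -> j != (n - i)%N ->
    (set_pair i a b nu j == set_pair i a b nu (opi N j)) = (nu j == nu (opi N j)).
  move=> j_in /negbTE ji; rewrite /set_pair ji.
  have -> : (j == opi N (n - i)) = false by rewrite /opi; lia.
  have -> : (opi N j == (n - i)%N) = false by rewrite /opi; lia.
  by have -> : (opi N j == opi N (n - i)) = false by move: ji; rewrite /opi; lia.
have [/nu0 e1 /nu0 e2] := inner_outer i_n.
apply/allP/andP => [all0|[/eqP ab /allP all0] j].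
  split; first by have := all0 (n - i)%N; rewrite set_pair_lo set_pair_hi// mem_iota; apply; lia.
  apply/allP => j j_in; have [->|ji] := eqVneq j (n - i)%N; first by rewrite e1 e2.
  by rewrite -updE ?all0//; move: j_in; rewrite mem_iota; lia.
move=> j_in; have [->|ji] := eqVneq j (n - i)%N; first by rewrite set_pair_lo set_pair_hi// ab.
by rewrite updE ?all0//; move: j_in; rewrite mem_iota; lia.
Qed.

Definition half_degree (nu : nat -> nat) : nat :=
  (\sum_(1 <= j < n.+1) nu j + if odd N then (nu n.+1)./2 else 0)%N.

(** Makes the exponent sum in [invariant_value] a function of the degree alone, as the recursion
    with [phi_ratio] requires. *)
Lemma mdegree_half_degree nu : invariant_support N nu -> mdegree N nu = (2 * half_degree nu)%N.
Proof.
move=> /andP[/allP sym even]; rewrite -inner_degree_n /half_degree -{1}(subnn n).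
have N_decomp' := N_decomp.
suff rdE i : (i <= n)%N -> inner_degree i nu = (2 * (\sum_((n - i).+1 <= j < n.+1) nu j
   + if odd N then (nu n.+1)./2 else 0))%N by rewrite rdE// subnn.
elim: i => [|i IHi] i_n.
  rewrite inner_degree0 subn0 big_geq// add0n; case: ifP => oN; last by rewrite muln0.
  move: even; rewrite oN /= => even; rewrite mul2n -[LHS]odd_double_half.
  by rewrite (negbTE even).
rewrite inner_degreeS// IHi; last by exact: ltnW.
have -> : ((n - i.+1).+1 = n - i)%N by lia.
have /eqP <- : nu (n - i)%N == nu (opi N (n - i)) by apply: sym; rewrite mem_iota; lia.
by rewrite [in RHS]big_ltn; lia.
Qed.

Variable h : {scalar sphere q N}.
Hypothesis h_invariant : is_invariant_functional h.
Definition phi : {scalar L} := h \o tau (q := q) (N := N).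

Lemma phi_mono nu : phi (mono q N nu) =
  if invariant_support N nu then (invariant_value q N nu)%:C else 0.
Proof. exact: h_invariant. Qed.

Definition phi_ratio_real i a d : R :=
  (1 - q ^- (2 * a.+1)) / (qrho i * Kreal * (1 - q ^- (2 * n + odd N + d + 2 * a))).

Lemma qpochS (y p : R) s : qpoch y p s.+1 = qpoch y p s * (1 - y * p ^+ s).
Proof. by rewrite /qpoch big_ord_recr. Qed.

Lemma invariant_value_set_pairS i a nu : (i < n)%N -> vanish i nu -> invariant_support N nu ->
  invariant_value q N (set_pair i a.+1 a.+1 nu) =
  phi_ratio_real i a (mdegree N nu) * invariant_value q N (set_pair i a a nu).
Proof.
move=> i_n nu0 supp; rewrite (mdegree_half_degree supp).
have N_decomp' := N_decomp.
have val b : invariant_value q N (set_pair i b b nu) =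
    qpoch (q ^- 2) (q ^- 2) b * (\prod_(1 <= j < n.+1) qpoch (q ^- 2) (q ^- 2) (nu j)
      * qpoch q^-1 (q ^- 2) (if odd N then (nu n.+1)./2 else 0)
      * (1 + q) ^+ (if odd N then (nu n.+1)./2 else 0))
    / (q `^ (rho R N (n - i) * b%:R) * q `^ (\sum_(1 <= j < n.+1) rho R N j * (nu j)%:R + (if odd N then (nu n.+1)./2 else 0)%:R)
      * Kreal ^+ (b + half_degree nu) * qpoch (q `^ (- N%:R)) (q ^- 2) (b + half_degree nu)).
  rewrite /invariant_value.
  have -> : (if odd N then (set_pair i b b nu n.+1)./2 else 0)%N = (if odd N then (nu n.+1)./2 else 0)%N.
    by case: ifP => // oN; rewrite set_pair_inner// /inner; lia.
  set r := (if odd N then _ else _).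
  rewrite (@big_set_pair _ _ *%R (fun _ m => qpoch (q ^- 2) (q ^- 2) m))//; last by rewrite /qpoch big_ord0.
  rewrite (@big_set_pair _ _ addn (fun _ m => m))//.
  rewrite (@big_set_pair _ _ +%R (fun j m => rho R N j * m%:R))//; last by rewrite mulr0.
  rewrite -!addrA -addnA -/(half_degree nu) qpD.
  by rewrite !mulrA.
rewrite !val /phi_ratio_real.
have -> : q `^ (rho R N (n - i) * a.+1%:R) = q `^ (rho R N (n - i) * a%:R) * qrho i.
  by rewrite -natr1 mulrDr mulr1 qpD rho_lo.
rewrite addSn !qpochS (exprS Kreal) powRN qpn.
have -> : q ^- 2 * q ^- 2 ^+ a = q ^- (2 * a.+1).
  by rewrite -exprS exprVn -exprM.
have -> : q ^- N * q ^- 2 ^+ (a + half_degree nu) = q ^- (2 * n + odd N + 2 * half_degree nu + 2 * a).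
  rewrite exprVn -exprM -invfM -exprD; congr (_ ^- _).
  by rewrite {1}N_decomp; lia.
by rewrite !invfM; ring.
Qed.

Lemma phi_set_pairS i a d g : (i < n)%N -> graded i d g ->
  phi (X i ^+ a.+1 * g * X' i ^+ a.+1) = (phi_ratio_real i a d)%:C * phi (X i ^+ a * g * X' i ^+ a).
Proof.
move=> i_n /(graded_span (ltnW i_n)); elim=> {g} [_ [nu [nu0 <- ->]]||p r _ Hp _ Hr|c p _ Hp].
- rewrite -!mono_set_pair// !phi_mono !invariant_support_set_pair// !eqxx /=.
  case: ifP => supp; last by rewrite mulr0.
  by rewrite invariant_value_set_pairS// (rmorphM (real_complex R)).
- by rewrite !(mulr0, mul0r) linear0 mulr0.
- by rewrite !mulrDr !mulrDl !linearD Hp Hr mulrDr.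
- by rewrite -!scalerAr -!scalerAl !linearZ_LR Hp /= mulrCA.
Qed.

Lemma phi_set_pair0 i a b d g : (i < n)%N -> graded i d g -> a <> b ->
  phi (X i ^+ a * g * X' i ^+ b) = 0.
Proof.
move=> i_n /(graded_span (ltnW i_n)) Hg ab; elim: Hg => {g} [_ [nu [nu0 _ ->]]||p r _ Hp _ Hr|c p _ Hp].
- by rewrite -mono_set_pair// phi_mono invariant_support_set_pair//; case: eqP.
- by rewrite mulr0 mul0r linear0.
- by rewrite mulrDr mulrDl linearD Hp Hr addr0.
- by rewrite -scalerAr -scalerAl linearZ_LR Hp mulr0.
Qed.

Lemma tau_Qform p : tau (Qform q N 1 * p) = tau p.
Proof.
have -> : tau (Qform q N 1 * p) = tau (Qform q N 1) * tau p by rewrite /tau quot_piM.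
have -> : tau (Qform q N 1) = 1; last by rewrite mul1r.
by apply/quot_piP/ideal_gen_mem.
Qed.

(** On the sphere $Q=1$, and $Q$ is [Qc n] times [Y n]; since [qrho n ^+ 2] is [q ^+ N], the scalar
    [Qc n] equals [Kreal * q / qrho n]. *)
Lemma phi_Yn p : phi (Y n * p) = (qrho n)%:C / q%:C / Kreal%:C * phi p.
Proof.
have QY := Qform_Y (leqnn n); rewrite subnn in QY.
have : phi (Qform q N 1 * p) = phi p by rewrite /phi /= tau_Qform.
rewrite QY -scalerAl linearZ_LR => <- /=; rewrite mulrA -[LHS]mul1r; congr (_ * _).
rewrite -!(fmorphV (real_complex R)) -!(rmorphM (real_complex R)) -(rmorph1 (real_complex R)).
congr (_%:C).
have NR : q `^ (N%:R - 2) = qrho n ^+ 2 / q ^+ 2.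
  by rewrite qpD powRN !qpn qrho2 -N_decomp.
have := Kreal_neq0; rewrite /Kreal NR /Qc => K0; field.
by rewrite q_neq0 qrho_neq0 /= lt0r_neq0// addr_gt0// exprn_gt0// qrho_gt0.
Qed.

Lemma mono0 : mono q N (fun=> 0%N) = 1.
Proof. by rewrite /mono big1. Qed.

Lemma phi1 : phi 1 = 1.
Proof.
rewrite -mono0 phi_mono.
have -> : invariant_support N (fun=> 0%N) by rewrite /invariant_support all_predT implybT.
rewrite /invariant_value if_same !big1 ?addr0//=.
- by rewrite powRr0 !expr0 /qpoch !big_ord0 !mulr1 invr1 mulr1.
- by move=> j _; rewrite mulr0.
- by move=> j _; rewrite /qpoch big_ord0.
Qed.

Lemma phi_Xm : odd N -> phi Xm = 0.
Proof.
move=> oN; have [_ nuE _ mE] := Xm_monomial 1 oN; rewrite expr1 in mE.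
by rewrite -mE phi_mono /invariant_support nuE oN andbF.
Qed.

Lemma phi_Xm_real d : conjc (phi (Xm ^+ d)) = phi (Xm ^+ d).
Proof.
have [oN|oN] := boolP (odd N).
  have [_ _ _ <-] := Xm_monomial d oN; rewrite phi_mono.
  by case: ifP => _; rewrite ?conjc_real// rmorph0.
rewrite /Xm (negbTE oN) expr0n; case: d => [|d]; first by rewrite phi1 rmorph1.
by rewrite linear0 rmorph0.
Qed.

(** * The star, the polynomials t and the transfer to the stated index sets *)

Variable star : L -> L.
Hypothesis star_is_star : is_star star.

Lemma starD c (a b : L) : star (c *: a + b) = conjc c *: star a + star b.
Proof. by have [sD _ _ _] := star_is_star; rewrite sD. Qed.

Lemma starM (a b : L) : star (a * b) = star b * star a.
Proof. by have [_ -> _ _] := star_is_star. Qed.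

Lemma starK : involutive star.
Proof. by have [_ _ sK _] := star_is_star. Qed.

Lemma star1 : star 1 = 1.
Proof. by have := starM (star 1) 1; rewrite mulr1 starK mulr1. Qed.

Lemma starX i : (i < n)%N -> star (X i) = (qrho i)%:C^-1 *: X' i.
Proof.
move=> i_n; have [_ _ _ sx] := star_is_star.
by rewrite /X sx ?rho_hi// ?(fmorphV (real_complex R))//; have := N_decomp; lia.
Qed.

Lemma starX' i : (i < n)%N -> star (X' i) = (qrho i)%:C *: X i.
Proof.
move=> i_n; have [_ _ _ sx] := star_is_star; have N_decomp' := N_decomp.
rewrite /X' sx; last by rewrite /opi; lia.
by rewrite opiK ?rho_lo//; lia.
Qed.

Lemma star_Xm : star Xm = Xm.
Proof.
have [_ _ _ sx] := star_is_star; have N_decomp' := N_decomp.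
rewrite /Xm; case: ifP N_decomp' => oN N_decomp'; last first.
  exact: st0 starD.
have oE : opi N n.+1 = n.+1 by rewrite /opi; lia.
rewrite sx ?oE; last by lia.
rewrite /rho ltnn ifF; last by rewrite /opi; lia.
by rewrite powRr0 rmorph1 scale1r.
Qed.

Lemma qpMS (e : R) k : q `^ (e * k.+1%:R) = q `^ (e * k%:R) * q `^ e.
Proof. by rewrite -natr1 mulrDr mulr1 qpD. Qed.

Definition tcoef_ratio_real i a b l t : R :=
  q ^+ 2 / q ^+ (2 * l + 2 * i + odd N) * (1 - q ^+ (2 * t) / q ^+ (2 * a))
  * (1 - q ^+ (2 * t) / q ^+ (2 * b))
  / ((1 - q ^+ (2 * t.+1)) * (1 - q ^+ (2 * t.+1) / q ^+ (2 * i + odd N + 2 * (a + b + l)))).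

Lemma tcoef_ratio_realE i a b l t : tcoef_ratio q%:C (odd N) i a b l t = (tcoef_ratio_real i a b l t)%:C.
Proof.
by rewrite /tcoef_ratio /tcoef_ratio_real !(rmorphM, fmorphV, rmorphB, rmorph1, rmorphXn).
Qed.

(** Passing from $Q_j$ to [Y i.+1] costs a factor [Qc i.+1] per power, which is $1+q^{M-2}$ divided
    by [qrho i] and cancels the denominator of $t$; [eps] absorbs the half-integer in [qrho i]. *)
Lemma exponent_tpoly i l : (i < n)%N ->
  q `^ (- (n%:R - (n - i)%:R + 1) + eps R N - 2 * l%:R + 2)
    / (1 + q `^ (N%:R - 2 * (n - i)%:R + 2 - 2)) * Qc i.+1 =
  q ^+ 2 / q ^+ (2 * l + 2 * i + odd N).
Proof.
move=> i_n.
have NR : N%:R = 2 * n%:R + (odd N)%:R :> R by rewrite {1}N_decomp natrD natrM.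
have -> : q `^ (N%:R - 2 * (n - i)%:R + 2 - 2) = qrho i ^+ 2.
  rewrite qrho2 -qpn NR natrB ?(ltnW i_n)// (natrD _ (2 * i)%N) (natrM _ 2 i).
  by congr (_ `^ _); ring.
have -> : q `^ (- (n%:R - (n - i)%:R + 1) + eps R N - 2 * l%:R + 2) =
    q ^+ 2 / q ^+ (2 * l + 2 * i + odd N) * qrho i.
  rewrite -!qpn -powRN -!qpD /qrho natrB ?(ltnW i_n)// /eps.
  rewrite (natrD _ (2 * l + 2 * i)%N) (natrD _ (2 * l)%N) (natrM _ 2 l) (natrM _ 2 i).
  by congr (_ `^ _); case: (odd N) => /=; lra.
rewrite /Qc qrhoS; field.
rewrite q_neq0 qrho_neq0 !expf_neq0 ?q_neq0//=.
by rewrite lt0r_neq0// addr_gt0// exprn_gt0// qrho_gt0.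
Qed.

Lemma tpolyE i a b l s : (i < n)%N -> s = (a + b + l)%N ->
  tpoly q N (n - i) a b s = tpol q%:C X X' Xm c0real%:C (odd N) i a b l.
Proof.
move=> i_n ->; rewrite /tpoly /tpol; apply: eq_bigr => k _.
have QY := Qform_Y i_n; have iS : ((n - i.+1).+1 = n - i)%N by lia.
rewrite iS in QY; rewrite QY exprZn -!scalerAl scalerA; congr (_ *: _).
have NR : N%:R = 2 * n%:R + (odd N)%:R :> R by rewrite {1}N_decomp natrD natrM.
have -> : (a + b + l)%:R - a%:R - b%:R = l%:R :> R by rewrite !natrD; ring.
under [RHS]eq_bigr do rewrite tcoef_ratio_realE.
rewrite -rmorph_prod -(rmorphXn (real_complex R)) -(rmorphM (real_complex R)); congr (_%:C).
elim: {k}(k : nat) => [|k IHk].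
  by rewrite mulr0 powRr0 /qpoch !big_ord0 !expr0 !mulr1 !invr1 !mulr1.
rewrite big_ord_recr -IHk !qpochS qpMS !(exprSr _ k) /=.
have eT := exponent_tpoly l i_n.
rewrite /tcoef_ratio_real -eT.
have -> : q `^ (- 2 * a%:R) * q ^+ 2 ^+ k = q ^+ (2 * k) / q ^+ (2 * a).
  by rewrite mulNr powRN -natrM qpn -exprM mulrC.
have -> : q `^ (- 2 * b%:R) * q ^+ 2 ^+ k = q ^+ (2 * k) / q ^+ (2 * b).
  by rewrite mulNr powRN -natrM qpn -exprM mulrC.
have -> : q ^+ 2 * q ^+ 2 ^+ k = q ^+ (2 * k.+1) by rewrite -exprS -exprM.
have -> : q `^ (- (N%:R - 2 * (n - i)%:R + 2) - 2 * (a + b + l)%:R + 4) * q ^+ 2 ^+ k =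
     q ^+ (2 * k.+1) / q ^+ (2 * i + odd N + 2 * (a + b + l)).
  rewrite -exprM -!qpn -powRN -!qpD NR natrB ?(ltnW i_n)//.
  rewrite (natrM _ 2 k.+1) (natrM _ 2 k) (natrD _ (2 * i + odd N)%N) (natrD _ (2 * i)%N).
  rewrite (natrM _ 2 i) (natrM _ 2 (a + b + l)) -(natr1 k).
  by congr (_ `^ _); ring.
by rewrite !invfM; ring.
Qed.

Lemma lspan_lin_span (K : nzRingType) (V : lmodType K) (T : Type) (P : T -> Prop) (v : T -> V) p :
  lspan (fun p => exists t, P t /\ p = v t) p -> lin_span P v p.
Proof.
elim=> {p} [_ [t [Pt ->]]||_ _ _ [k1 [t1 [c1 [P1 ->]]]] _ [k2 [t2 [c2 [P2 ->]]]]|c _ _ [k [t [d [Pt ->]]]]].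
- by exists 1%N, (fun=> t), (fun=> 1); split=> //; rewrite big_ord1 scale1r.
- have t0 : 'I_0 -> T by case.
  by exists 0%N, t0, (fun=> 0); split; [case|rewrite big_ord0].
- exists (k1 + k2)%N, (fun i => match split i with inl j => t1 j | inr j => t2 j end),
    (fun i => match split i with inl j => c1 j | inr j => c2 j end); split.
    by move=> i; case: (split i).
  rewrite big_split_ord /=; congr (_ + _); apply: eq_bigr => i _.
    by rewrite -[lshift k2 i]/(unsplit (inl i)) unsplitK.
  by rewrite -[rshift k1 i]/(unsplit (inr i)) unsplitK.
- exists k, t, (fun i => c * d i); split=> //.
  by rewrite scaler_sumr; apply: eq_bigr => i _; rewrite scalerA.
Qed.

Variable starF : sphere q N -> sphere q N.
Hypothesis starF_induced : is_induced_star star starF.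

Lemma sprod_phi (p r : L) : sprod starF h p r = phi (star p * r).
Proof. by rewrite /sprod starF_induced /phi /= /tau quot_piM. Qed.

Lemma phiZ c a : phi (c *: a) = c * phi a.
Proof. exact: linearZ_LR. Qed.

Local Notation orthogonal_family := (xi_orthogonal_basis q%:C n X X' Xm c0real%:C (odd N) Delta phi star).
Local Notation xi := (xi q%:C X X' Xm c0real%:C (odd N)).

Lemma is_orthogonal_basis_xi m b (T0 : Type) (v0 : T0 -> L) deg0 (I : Type) (P : I -> Prop)
    (f : I -> L) (code : I -> seq (nat * nat) * T0) :
  orthogonal_family b v0 deg0 ->
  (forall t, P t -> [/\ (b + size (code t).1)%N = n, xi_degree deg0 (code t).1 (code t).2 = m
     & f t = xi b v0 deg0 (code t).1 (code t).2]) ->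
  (forall r z, (b + size r)%N = n -> xi_degree deg0 r z = m -> exists2 t, P t & code t = (r, z)) ->
  injective code ->
  is_orthogonal_basis (sprod starF h) (harmonic Delta m) P f.
Proof.
move=> [harm span orth norm] Pcode codeP code_inj.
have Porth t u : P t -> P u -> t <> u -> sprod starF h (f t) (f u) = 0.
  move=> /Pcode[tn _ ->] /Pcode[un _ ->] tu; rewrite sprod_phi orth//.
  by rewrite -!surjective_pairing => /code_inj.
split=> //; split.
- move=> t /Pcode[tn <- ->]; have [XB XD] := harm _ (code t).2 tn; split=> //.
  apply: lspan_lin_span; apply: lspan_subset (graded_span (leqnn n) XB) => _ [nu [_ <- ->]].
  by apply: lspan_mem; exists nu.
- move=> k t c t_inj Pt sum0 i; have [tn _ fE] := Pcode _ (Pt i).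
  have := norm _ (code (t i)).2 tn; rewrite -fE => norm_i.
  have : sprod starF h (f (t i)) (\sum_(j < k) c j *: f (t j)) = 0.
    by rewrite sum0 sprod_phi mulr0 linear0.
  rewrite sprod_phi mulr_sumr linear_sum (bigD1 i)// big1 ?addr0 => [|j /eqP ji]; last first.
    by rewrite -scalerAr phiZ -sprod_phi Porth ?mulr0// => tij; apply: ji; apply/esym/t_inj.
  rewrite -scalerAr phiZ => ci0.
  have /eqP : c i * phi (star (f (t i)) * f (t i)) = 0 :> R[i] by rewrite -[LHS]addr0.
  by rewrite mulf_eq0 (negbTE norm_i) orbF => /eqP.
- move=> p [/homog_graded Hp Dp]; apply: lspan_lin_span; apply: lspan_subset (span _ _ Hp Dp) => _ [r [z [rn inner_mono ->]]].
  have [t Pt tE] := codeP r z rn inner_mono; apply: lspan_mem; exists t; split=> //.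
  by have [_ _ ->] := Pcode t Pt; rewrite tE.
Qed.

Lemma rest_cons m y a z b k : rest m (y :: a) (z :: b) k.+1 = rest (m - y - z) a b k.
Proof. by elim: k m => [|k IHk] m //=; rewrite -IHk. Qed.

(** [off] counts the outer factors already stripped. The number $s_j$ computed by [rest] is the
    degree of the remaining tail, which is what makes [tpolyE] applicable. *)
Lemma prod_tpoly b (T0 : Type) (v0 : T0 -> L) deg0 z a a' off m : size a = size a' ->
  (off + size a + b)%N = n -> m = xi_degree deg0 (zip a a') z ->
  (\prod_(k < size a) tpoly q N (off + k).+1 (nth 0%N a k) (nth 0%N a' k) (rest m a a' k)) * v0 z
  = xi b v0 deg0 (zip a a') z.
Proof.
elim: a a' off m => [|y a IHa] [|y' a'] //= off m; first by rewrite big_ord0 mul1r.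
move=> [sz] offn mE; rewrite big_ord_recl /= addn0 -mulrA; congr (_ * _).
  have si : size (zip a a') = size a by rewrite size_zip sz minnn.
  have -> : off.+1 = (n - (b + size (zip a a')))%N by rewrite si; lia.
  by apply: tpolyE; [rewrite si; lia|exact: etrans mE (xi_degree_cons _ _ _ _)].
rewrite -(IHa a' off.+1 (m - y - y')%N sz); [|lia|by have := xi_degree_cons deg0 (y, y') (zip a a') z; rewrite mE /=; lia].
congr (_ * _); apply: eq_bigr => k _; rewrite /bump /= add1n addnS addSn.
by rewrite -/(rest m (y :: a) (y' :: a') k.+1) rest_cons.
Qed.

Lemma xi_degree_zip (T0 : Type) (deg0 : T0 -> nat) a a' z : size a = size a' ->
  xi_degree deg0 (zip a a') z = (sumn a + sumn a' + deg0 z)%N.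
Proof.
elim: a a' => [|y a IHa] [|y' a'] //= [sz].
by rewrite xi_degree_cons /= IHa//; lia.
Qed.

Lemma zip_inj (T1 T2 : Type) (a b : seq T1) (a' b' : seq T2) :
  size a = size a' -> size b = size b' -> zip a a' = zip b b' -> a = b /\ a' = b'.
Proof.
move=> sa sb e; split.
  by rewrite -(unzip1_zip (eq_leq sa)) e unzip1_zip ?eq_leq.
by rewrite -(unzip2_zip (eq_leq (esym sa))) e unzip2_zip ?eq_leq.
Qed.

Lemma qC_neq0 : q%:C != 0. Proof. by rewrite fmorph_eq0 q_neq0. Qed.
Lemma qCX_neq1 k : q%:C ^+ k.+1 != 1.
Proof. by rewrite -(rmorphXn (real_complex R)) fmorph_eq1 qX_neq1. Qed.
Lemma GC_neq0 i : (qrho i)%:C != 0. Proof. by rewrite fmorph_eq0 qrho_neq0. Qed.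
Lemma GCS i : (qrho i.+1)%:C = q%:C * (qrho i)%:C.
Proof. by rewrite qrhoS (rmorphM (real_complex R)). Qed.
Lemma GC2 i : (qrho i)%:C ^+ 2 = q%:C ^+ (2 * i + odd N).
Proof. by rewrite -!(rmorphXn (real_complex R)) qrho2. Qed.
Lemma KC_neq0 : Kreal%:C != 0. Proof. by rewrite fmorph_eq0 Kreal_neq0. Qed.

Lemma phi_set_pairSC i a d g : (i < n)%N -> graded i d g ->
  phi (X i ^+ a.+1 * g * X' i ^+ a.+1) =
  phi_ratio q%:C n (odd N) (fun i => (qrho i)%:C) Kreal%:C i a d * phi (X i ^+ a * g * X' i ^+ a).
Proof.
move=> i_n Hg; rewrite (phi_set_pairS _ i_n Hg); congr (_ * _).
by rewrite /phi_ratio /phi_ratio_real !(rmorphM, fmorphV, rmorphB, rmorph1, rmorphXn).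
Qed.

Lemma phi1_neq0 : phi 1 != 0. Proof. by rewrite phi1 oner_neq0. Qed.

Lemma odd_family : odd N -> orthogonal_family 0%N (fun z : bool => Xm ^+ z) nat_of_bool.
Proof.
move=> oN; apply: (odd_basis qC_neq0 XX XX' X'X X'X' XXm XmX' X'X_comm qCX_neq1 GC_neq0 GCS GC2
  KC_neq0 Delta_X Delta_Xm kappa_real_lt2 Delta_Y0 n_gt0 phi_set_pairSC phi_set_pair0 phi_Yn
  (conjc_real q) (fun i => conjc_real (qrho i)) (conjc_real Kreal) (conjc_real c0real)
  starD starM starK star1 starX starX' star_Xm phi_Xm_real phi1_neq0 _ _ (phi_Xm oN)).
  by rewrite oN.
by rewrite fmorph_eq0 lt0r_neq0// c0real_gt0.
Qed.

Lemma even_family : ~~ odd N ->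
  orthogonal_family 1%N (fun z => X 0 ^+ zpos z * X' 0 ^+ zneg z) (fun z => `|z|%N).
Proof.
move=> oN; apply: (even_basis qC_neq0 XX XX' X'X X'X' XXm XmX' X'X_comm qCX_neq1 GC_neq0 GCS GC2
  KC_neq0 Delta_X Delta_Xm kappa_real_lt2 Delta_Y0 n_gt0 phi_set_pairSC phi_set_pair0 phi_Yn
  (conjc_real q) (fun i => conjc_real (qrho i)) (conjc_real Kreal) (conjc_real c0real)
  starD starM starK star1 starX starX' star_Xm phi_Xm_real phi1_neq0 _ _).
  by rewrite (negbTE oN).
by rewrite /Xm (negbTE oN).
Qed.

Lemma orthogonal_basis_even m : ~~ odd N ->
  is_orthogonal_basis (sprod starF h) (harmonic Delta m)
    (@idx_even_ok N m) (@Xi_even R q N m).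
Proof.
move=> oN; pose code (t : idx_even N) := let: (a, b, k) := t in (zip a b, k).
apply: (is_orthogonal_basis_xi (code := code) (even_family oN)).
- move=> [[a b] k] /= tm; have sab : size a = size b by rewrite !size_tuple.
  split; first by rewrite size_zip !size_tuple minnn; have := n_gt0; lia.
    by rewrite xi_degree_zip.
  rewrite -(prod_tpoly _ (off := 0%N) (m := m)) ?xi_degree_zip//; last first.
    by rewrite add0n size_tuple; have := n_gt0; lia.
  rewrite /tprod size_tuple; congr (_ * _).
  by case: k {tm} => k; rewrite /= /X /X' subn0 ?mulr1 ?mul1r.
- move=> r z rn inner_mono.
  have s1 : size (unzip1 r) == n.-1 by rewrite size_map; apply/eqP; lia.
  have s2 : size (unzip2 r) == n.-1 by rewrite size_map; apply/eqP; lia.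
  exists (Tuple s1, Tuple s2, z); last by rewrite /code /= zip_unzip.
  by rewrite /= -inner_mono -(xi_degree_zip _ _ (etrans (eqP s1) (esym (eqP s2)))) zip_unzip.
move=> [[a b] k] [[a' b'] k'] [e ->].
have sz p (c d : p.-tuple nat) : size c = size d by rewrite !size_tuple.
by have [/val_inj-> /val_inj->] := zip_inj (sz _ a b) (sz _ a' b') e.
Qed.

Lemma orthogonal_basis_odd m : odd N ->
  is_orthogonal_basis (sprod starF h) (harmonic Delta m)
    (@idx_odd_ok N m) (@Xi_odd R q N m).
Proof.
move=> oN; pose code (t : idx_odd N) := let: (a, b, k) := t in (zip a b, k).
apply: (is_orthogonal_basis_xi (code := code) (odd_family oN)).
- move=> [[a b] k] /= tm; have sab : size a = size b by rewrite !size_tuple.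
  split; first by rewrite size_zip !size_tuple minnn.
    by rewrite xi_degree_zip.
  rewrite -(prod_tpoly _ (off := 0%N) (m := m)) ?xi_degree_zip//; last first.
    by rewrite add0n size_tuple addn0.
  by rewrite /tprod size_tuple /Xm oN.
- move=> r z rn inner_mono.
  have s1 : size (unzip1 r) == n by rewrite size_map; apply/eqP.
  have s2 : size (unzip2 r) == n by rewrite size_map; apply/eqP.
  exists (Tuple s1, Tuple s2, z); last by rewrite /code /= zip_unzip.
  by rewrite /= -inner_mono -(xi_degree_zip _ _ (etrans (eqP s1) (esym (eqP s2)))) zip_unzip.
move=> [[a b] k] [[a' b'] k'] [e ->].
have sz p (c d : p.-tuple nat) : size c = size d by rewrite !size_tuple.
by have [/val_inj-> /val_inj->] := zip_inj (sz _ a b) (sz _ a' b') e.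
Qed.

End QuantumVectorSpace.

Theorem theorem3 (R : realType) (q : R) (N : nat)
    (N_ge3 : (3 <= N)%N) (q_gt0 : 0 < q) (q_neq1 : q != 1)
    (Delta : {linear vec_alg q N -> vec_alg q N}) (Delta_qlaplace : is_qlaplace Delta)
    (star : vec_alg q N -> vec_alg q N) (star_is_star : is_star star)
    (starF : sphere q N -> sphere q N) (starF_induced : is_induced_star star starF)
    (h : {scalar sphere q N}) (h_invariant : is_invariant_functional h)
    (m : nat) :
  (~~ odd N ->
     is_orthogonal_basis (sprod starF h) (harmonic Delta m)
       (@idx_even_ok N m) (@Xi_even R q N m)) /\
  (odd N ->
     is_orthogonal_basis (sprod starF h) (harmonic Delta m)
       (@idx_odd_ok N m) (@Xi_odd R q N m)).
Proof.
split.
  by move=> oN; apply: (orthogonal_basis_even N_ge3 q_gt0 q_neq1 Delta_qlaplace h_invariant star_is_star starF_induced m oN).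
by move=> oN; apply: (orthogonal_basis_odd N_ge3 q_gt0 q_neq1 Delta_qlaplace h_invariant star_is_star starF_induced m oN).
Qed.
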